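(* Let $\Omega=A\cup B$, $J$, $G$ and the functionals $E_v$ and $F$ be as in the context, where the function $v\in L^2(B)$ entering $E_v$ is the minimizer of $F$. Then the equation $$u_t(x,t)=\Delta u(x,t)+\int_BJ(x-y)(v(y,t)-u(x,t))\,dy\ \text{ in }A\times(0,\infty),\qquad \frac{\partial u}{\partial\eta}=0\ \text{ on }\partial A\times(0,\infty),\qquad u(x,0)=u_0(x)\ \text{ in }A,$$ is the $L^2(A)$-gradient flow of $E_v$, while the equation $$0=\int_BG(x-y)(v(y,t)-v(x,t))\,dy+\int_AJ(x-y)(u(y,t)-v(x,t))\,dy,\qquad (x,t)\in B\times(0,\infty),$$ is the Euler--Lagrange equation associated with the minimization of $F$.
   Context: Setting: $\Omega\subset\mathbb{R}^N$ is a bounded smooth domain partitioned into two disjoint connected sets, $\Omega=A\cup B$; $A$ is a smooth subdomain and $\eta$ is the outward unit normal to $\partial A$. Each kernel $K=J,G\in C(\mathbb{R}^N,\mathbb{R})$ is nonnegative, continuous and radial, with $K(0)>0$, $\int_{\mathbb{R}^N}K(z)\,dz=1$, and there exist $x\in A$, $y\in B$ with $x-y\in\operatorname{supp}K$. The functional $E_v:H^1(A)\to\mathbb{R}$ is $$E_v(u)=\frac12\int_A|\nabla u(x)|^2dx+\frac12\int_A\int_BJ(x-y)u(x)^2\,dy\,dx-\int_A\int_BJ(x-y)u(x)v(y)\,dy\,dx,$$ with the convention $E_v(u)=\infty$ whenever $u\notin H^1(A)$, where $v\in L^2(B)$ is the minimizer of the functional $F:L^2(B)\to\mathbb{R}$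 (which depends on the given $u$), $$F(v)=\frac14\iint_{B\times B}G(x-y)(v(y)-v(x))^2dx\,dy+\frac12\int_A\int_BJ(x-y)(v(y)-u(x))^2dy\,dx.$$ ''$L^2(A)$-gradient flow of $E_v$'' means that the equation can be written as $u_t(t)+\partial E_v(u(t))=0$ in $L^2(A)$, where $\partial E_v(u)$ denotes the first variation of $E_v$ with respect to $u$. *)

(* Defs.v *)
From HB Require Import structures.
From mathcomp Require Import all_boot all_order all_algebra.
From mathcomp Require Import all_classical all_reals all_analysis.
Set Implicit Arguments.
Unset Strict Implicit.
Unset Printing Implicit Defensive.
Import Order.TTheory GRing.Theory Num.Theory.
Import numFieldNormedType.Exports.
Local Open Scope classical_set_scope.
Local Open Scope ring_scope.

(* R^N is the type 'rV[R]_N. Its sigma-algebra is generated by the coordinate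
   maps, i.e. it is the Borel sigma-algebra; as in the library's treatment of
   tuples. The library norm on 'rV[R]_N is the sup norm: it is used only through
   the topology it induces, and the Euclidean norm is [enorm] below. *)
Section measurable_rV.
Context {R : realType}.
Variable n : nat.

Definition coord_rV (i : 'I_n) (x : 'rV[R]_n) : measurableTypeR R := x ord0 i.

Let rV_set0 : g_sigma_preimage coord_rV set0.
Proof. exact: sigma_algebra0. Qed.

Let rV_setC A : g_sigma_preimage coord_rV A -> g_sigma_preimage coord_rV (~` A).
Proof. exact: sigma_algebraC. Qed.

Let rV_bigcup (F : (set 'rV[R]_n)^nat) : (forall i, g_sigma_preimage coord_rV (F i)) ->
  g_sigma_preimage coord_rV (\bigcup_i (F i)).
Proof. exact: sigma_algebra_bigcup. Qed.

HB.instance Definition _ := @isMeasurable.Build default_measure_display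
  'rV[R]_n (g_sigma_preimage coord_rV) rV_set0 rV_setC rV_bigcup.

End measurable_rV.


Section rV_measurability.
Context {R : realType}.

Lemma measurable_coord_rV n (i : 'I_n) :
  measurable_fun [set: 'rV[R]_n] (fun x => x ord0 i : measurableTypeR R).
Proof.
move=> _ Y mY; rewrite setTI; apply: sub_sigma_algebra => /=.
rewrite -bigcup_seq/=; exists i => /=; first by rewrite mem_index_enum.
by exists Y => //; rewrite setTI.
Qed.

Lemma measurable_fun_rV d (T : measurableType d) n (f : T -> 'rV[R]_n) :
  (forall i, measurable_fun [set: T] (fun x => f x ord0 i : measurableTypeR R)) ->
  measurable_fun [set: T] f.
Proof.
move=> mf _ Y mY; rewrite setTI.
suff : g_sigma_preimage (fun i => @coord_rV R n i \o f) `<=` measurable.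
  by rewrite g_sigma_preimage_comp; apply; exists Y => //; rewrite setTI.
apply: smallest_sub; first exact: sigma_algebra_measurable.
rewrite -bigcup_seq; apply: bigcup_sub => i _ A [B mB <-].
exact: mf.
Qed.

Definition cons_rV n (p : measurableTypeR R * 'rV[R]_n) : 'rV[R]_n.+1 :=
  row_mx (p.1%:M : 'rV[R]_1) p.2.

Definition split_rV n (x : 'rV[R]_n.+1) : measurableTypeR R * 'rV[R]_n :=
  (x ord0 ord0, rsubmx (x : 'rV[R]_(1 + n))).

Lemma cons_rVK n : cancel (@cons_rV n) (@split_rV n).
Proof.
move=> [a x]; rewrite /split_rV /cons_rV /= row_mxKr; congr pair.
have -> : ord0 = lshift n (ord0 : 'I_1) by apply/val_inj.
by rewrite (row_mxEl (a%:M : 'rV_1)) mxE eqxx.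
Qed.

Lemma split_rVK n : cancel (@split_rV n) (@cons_rV n).
Proof.
move=> x; apply/rowP => i; have [j ->|j ->] := @split_ordP 1 n i.
- rewrite /cons_rV /split_rV /= (row_mxEl ((x ord0 ord0)%:M : 'rV_1)).
  by rewrite (ord1 j) mxE eqxx; congr (x _ _); exact/val_inj.
- by rewrite /cons_rV /split_rV /= (row_mxEr ((x ord0 ord0)%:M : 'rV_1)) mxE.
Qed.

Lemma measurable_cons_rV n :
  measurable_fun [set: measurableTypeR R * 'rV[R]_n] (@cons_rV n).
Proof.
apply: measurable_fun_rV => i; have [j ij|j ij] := @split_ordP 1 n i.
- rewrite (_ : (fun _ => _) = fst) //; apply/funext => -[a x].
  by rewrite ij (row_mxEl (a%:M : 'rV_1)) (ord1 j) mxE eqxx.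
- rewrite (_ : (fun _ => _) = (fun y : 'rV[R]_n => y ord0 j : measurableTypeR R) \o snd).
    by apply: measurableT_comp => //; exact: measurable_coord_rV.
  by apply/funext => -[a x]; rewrite ij (row_mxEr (a%:M : 'rV_1)).
Qed.

Lemma measurable_split_rV n : measurable_fun [set: 'rV[R]_n.+1] (@split_rV n).
Proof.
apply/measurable_fun_pairP; split; first exact: measurable_coord_rV.
apply: measurable_fun_rV => i.
rewrite (_ : (fun _ => _) =
  (fun y : 'rV[R]_n.+1 => y ord0 (rshift 1 i) : measurableTypeR R)).
  exact: measurable_coord_rV.
by apply/funext => x /=; rewrite mxE.
Qed.


Section lebesgue_step.
Variable n : nat.
Variable m : {sigma_finite_measure set 'rV[R]_n -> \bar R}.

Definition lebesgue_rV_step : set 'rV[R]_n.+1 -> \bar R :=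
  pushforward (@lebesgue_measure R \x m)%E (@cons_rV n).

Let step0 : lebesgue_rV_step set0 = 0%E.
Proof. by rewrite /lebesgue_rV_step /pushforward preimage_set0 measure0. Qed.

Let step_ge0 A : (0 <= lebesgue_rV_step A)%E.
Proof. by rewrite /lebesgue_rV_step /pushforward; exact: measure_ge0. Qed.

Let step_sigma_additive : semi_sigma_additive lebesgue_rV_step.
Proof.
have mc B : measurable B -> measurable (@cons_rV n @^-1` B).
  by move=> mB; rewrite -[X in measurable X]setTI; exact: measurable_cons_rV.
move=> F mF tF mUF; rewrite /lebesgue_rV_step /pushforward preimage_bigcup.
apply: measure_semi_sigma_additive => [k||]; first exact: mc.
- apply/trivIsetP => i j _ _ ij; rewrite -preimage_setI.
  by move/trivIsetP : tF => /(_ _ _ _ _ ij) ->//; rewrite preimage_set0.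
- by rewrite -preimage_bigcup; exact: mc.
Qed.

HB.instance Definition _ := isMeasure.Build _ _ _ lebesgue_rV_step
  step0 step_ge0 step_sigma_additive.

Let step_sigma_finite : sigma_finite setT lebesgue_rV_step.
Proof.
have /sigma_finiteP[F [FT ndF Foo]] := sigma_finiteT (@lebesgue_measure R).
have /sigma_finiteP[G [GT ndG Goo]] := sigma_finiteT m.
exists (fun k => @split_rV n @^-1` (F k `*` G k)).
  rewrite -preimage_bigcup; apply/esym; rewrite -subTset => x _ /=.
  have [i _ Fi] : (\bigcup_i F i) (split_rV x).1 by rewrite -FT.
  have [j _ Gj] : (\bigcup_i G i) (split_rV x).2 by rewrite -GT.
  exists (maxn i j) => //; split.
  - by move: Fi; exact/subsetPset/ndF/leq_maxl.
  - by move: Gj; exact/subsetPset/ndG/leq_maxr.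
move=> k; have [mF Fk] := Foo k; have [mG Gk] := Goo k; split.
  rewrite -[X in measurable X]setTI.
  by apply: measurable_split_rV => //; exact: measurableX.
rewrite /lebesgue_rV_step /pushforward -comp_preimage.
rewrite (_ : _ \o _ = id); last by apply/funext => p /=; rewrite cons_rVK.
by rewrite preimage_id product_measure1E// lte_mul_pinfty// ge0_fin_numE.
Qed.

HB.instance Definition _ := Measure_isSigmaFinite.Build _ _ _ lebesgue_rV_step
  step_sigma_finite.

End lebesgue_step.

(* Lebesgue measure on R^n, through R^(n+1) = R x R^n. *)
Fixpoint lebesgue_rV n : {sigma_finite_measure set 'rV[R]_n -> \bar R} :=
  match n with
  | 0 => \d_(0 : 'rV[R]_0)
  | n'.+1 => lebesgue_rV_step (lebesgue_rV n')
  end.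

End rV_measurability.

Section differential_calculus.
Context {R : realType} {N : nat}.
Implicit Types (f : 'rV[R]_N -> R) (D : set 'rV[R]_N).

Definition dotp (x y : 'rV[R]_N) : R := \sum_i x ord0 i * y ord0 i.

Definition enorm (x : 'rV[R]_N) : R := Num.sqrt (dotp x x).

Definition partial (i : 'I_N) f : 'rV[R]_N -> R :=
  fun x => 'D_(delta_mx ord0 i) f x.

Definition grad f (x : 'rV[R]_N) : 'rV[R]_N := \row_i partial i f x.

Definition laplacian f (x : 'rV[R]_N) : R :=
  \sum_i partial i (partial i f) x.

Definition iter_partial (s : seq 'I_N) f : 'rV[R]_N -> R := foldr partial f s.

Definition smooth f := forall s x, differentiable (iter_partial s f) x.

(* f is of class C^2 in the open set D, and its partial derivatives of order at
   most 2 extend continuously to the closure of D. *)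
Definition C2_closure D f :=
  (forall s x, (size s <= 1)%N -> D x -> differentiable (iter_partial s f) x) /\
  (forall s, (size s <= 2)%N -> exists g : 'rV[R]_N -> R,
     {within closure D, continuous g} /\
     forall x, D x -> g x = iter_partial s f x).

Definition boundary D : set 'rV[R]_N := closure D `\` interior D.

Definition defining_function D (x : 'rV[R]_N) (rho : 'rV[R]_N -> R) :=
  [/\ smooth rho, grad rho x != 0 & \forall y \near x, D y <-> rho y < 0].

(* Nonempty connected open set with C^infinity boundary, lying locally on one
   side of its boundary. *)
Definition smooth_domain D :=
  [/\ open D, D !=set0, connected D &
      forall x, boundary D x -> exists rho, defining_function D x rho].

Definition outward_normal D (x n : 'rV[R]_N) :=
  exists2 rho, defining_function D x rho &
    n = (enorm (grad rho x))^-1 *: grad rho x.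

(* Classical homogeneous Neumann condition: at every boundary point x the
   derivative along eta x, computed inside D, tends to 0. *)
Definition classical_neumann D (eta : 'rV[R]_N -> 'rV[R]_N) f :=
  forall x, boundary D x ->
    (fun y => dotp (grad f y) (eta x)) @ within D (nbhs x) --> (0 : R).

End differential_calculus.

Section function_spaces.
Context {R : realType} {N : nat}.
Implicit Types (A : set 'rV[R]_N) (u : 'rV[R]_N -> R).
Let mu := @lebesgue_rV R N.

Definition L2 A u :=
  measurable_fun A u /\ mu.-integrable A (fun x => (u x ^+ 2)%:E).

Definition test_function A (phi : 'rV[R]_N -> R) :=
  [/\ smooth phi, compact (closure [set x | phi x != 0]) &
      closure [set x | phi x != 0] `<=` A].

Definition is_weak_gradient A u (g : 'rV[R]_N -> 'rV[R]_N) :=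
  (forall i, L2 A (fun x => g x ord0 i)) /\
  forall phi i, test_function A phi ->
    \int[mu]_(x in A) (u x * partial i phi x) =
    - \int[mu]_(x in A) (g x ord0 i * phi x).

Definition H1 A u := L2 A u /\ exists g, is_weak_gradient A u g.

(* A representative of the weak gradient of u : H1 A, which is unique a.e. *)
Definition weak_grad A u : 'rV[R]_N -> 'rV[R]_N :=
  xget (fun=> 0) (is_weak_gradient A u).

(* The distributional Laplacian of u in A is the function w : L2 A. *)
Definition is_weak_laplacian A u (w : 'rV[R]_N -> R) :=
  L2 A w /\
  forall phi, test_function A phi ->
    \int[mu]_(x in A) (u x * laplacian phi x) =
    \int[mu]_(x in A) (w x * phi x).

(* For u : H1 A with Laplacian w : L2 A, the normal derivative of u is by
   definition the functional on traces of H1 functions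
     phi |-> \int_A grad u . grad phi + \int_A w phi. *)
Definition weak_normal_derivative A u (w phi : 'rV[R]_N -> R) : R :=
  \int[mu]_(x in A) dotp (weak_grad A u x) (weak_grad A phi x) +
  \int[mu]_(x in A) (w x * phi x).

Definition weak_neumann A u (w : 'rV[R]_N -> R) :=
  forall phi, H1 A phi -> weak_normal_derivative A u w phi = 0.

(* xi : L2 A represents the first variation at u of E, a functional on L2 A;
   the directions are those along which E stays finite. *)
Definition first_variation A (E : ('rV[R]_N -> R) -> \bar R) u
    (xi : 'rV[R]_N -> R) :=
  [/\ L2 A u, L2 A xi, E u \is a fin_num &
    forall phi, L2 A phi ->
      (\forall e \near (0 : R), E (fun x => u x + e * phi x) \is a fin_num) ->
      is_derive (0 : R) (1 : R) (fun e => fine (E (fun x => u x + e * phi x)))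
        (\int[mu]_(x in A) (xi x * phi x))].

Definition L2_derivative A (u : R -> 'rV[R]_N -> R) (t : R)
    (ut : 'rV[R]_N -> R) :=
  L2 A ut /\
  (fun h : R => \int[mu]_(x in A)
     (((u (t + h) x - u t x) / h - ut x) ^+ 2)%:E)%E @ 0^' --> 0%E.

Definition initial_condition A (u : R -> 'rV[R]_N -> R)
    (u0 : 'rV[R]_N -> R) :=
  {ae mu, forall x, A x -> u 0 x = u0 x} /\
  (fun t : R => \int[mu]_(x in A) ((u t x - u0 x) ^+ 2)%:E)%E
    @ 0^'+ --> 0%E.

(* u_t + dE(u) = 0 in L2 A for t > 0, with u(0) = u0; the functional may depend
   on time. *)
Definition gradient_flow A (E : R -> ('rV[R]_N -> R) -> \bar R)
    (u : R -> 'rV[R]_N -> R) (u0 : 'rV[R]_N -> R) :=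
  initial_condition A u u0 /\
  forall t, 0 < t -> exists ut xi : 'rV[R]_N -> R,
    [/\ L2_derivative A u t ut, first_variation A (E t) (u t) xi &
        {ae mu, forall x, A x -> ut x + xi x = 0}].

Definition minimizer A (F : ('rV[R]_N -> R) -> R) u :=
  L2 A u /\ forall w, L2 A w -> F u <= F w.

End function_spaces.

Section coupled_problem.
Context {R : realType} {N : nat}.
Implicit Types (A B : set 'rV[R]_N) (J G K u v : 'rV[R]_N -> R).
Let mu := @lebesgue_rV R N.

Definition coupling_kernel A B K :=
  [/\ continuous K,
      forall z, 0 <= K z,
      forall z z', enorm z = enorm z' -> K z = K z',
      0 < K 0 &
      (\int[mu]_z (K z)%:E = 1)%E] /\
  exists x y, [/\ A x, B y & closure [set z | K z != 0] (x - y)].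

(* E_v(u), with v a fixed function: its first variation in u does not
   differentiate the dependence of the minimizer v on u. *)
Definition energy A B J v u : \bar R :=
  if `[< H1 A u >] then
    (2^-1 * \int[mu]_(x in A) dotp (weak_grad A u x) (weak_grad A u x)
     + 2^-1 * \int[mu]_(x in A) \int[mu]_(y in B) (J (x - y) * u x ^+ 2)
     - \int[mu]_(x in A) \int[mu]_(y in B) (J (x - y) * u x * v y))%:E
  else +oo%E.

(* F(v), for given u. *)
Definition nonlocal_energy A B J G u v : R :=
  4^-1 * \int[(mu \x mu)%E]_(p in B `*` B)
           (G (p.1 - p.2) * (v p.2 - v p.1) ^+ 2)
  + 2^-1 * \int[mu]_(x in A) \int[mu]_(y in B)
             (J (x - y) * (v y - u x) ^+ 2).

Definition weak_solution A B J (u v : R -> 'rV[R]_N -> R)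
    (u0 : 'rV[R]_N -> R) :=
  initial_condition A u u0 /\
  forall t, 0 < t -> exists ut w : 'rV[R]_N -> R,
    [/\ L2_derivative A u t ut, H1 A (u t), is_weak_laplacian A (u t) w,
        weak_neumann A (u t) w &
        {ae mu, forall x, A x ->
          ut x = w x + \int[mu]_(y in B) (J (x - y) * (v t y - u t x))}].

Definition classical_solution A B J (eta : 'rV[R]_N -> 'rV[R]_N)
    (u v : R -> 'rV[R]_N -> R) (u0 : 'rV[R]_N -> R) :=
  initial_condition A u u0 /\
  forall t, 0 < t -> exists ut : 'rV[R]_N -> R,
    [/\ L2_derivative A u t ut, classical_neumann A eta (u t) &
        {ae mu, forall x, A x -> ut x = laplacian (u t) x
          + \int[mu]_(y in B) (J (x - y) * (v t y - u t x))}].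

Definition nonlocal_equation A B J G u v :=
  {ae mu, forall x, B x ->
    0 = \int[mu]_(y in B) (G (x - y) * (v y - v x))
        + \int[mu]_(y in A) (J (x - y) * (u y - v x))}.

End coupled_problem.

(* Main.v *)
(* F is a nonnegative quadratic functional whose first variation at v is the residual of the nonlocal
   equation, by symmetry of the kernels and Fubini; the second assertion follows by completing the
   square. E_v is quadratic as well, and its first variation at u is xi iff
   int_A xi phi = int_A grad u . grad phi - int_A (reaction term) phi for all phi in H1, which is the
   weak form of the equation with the homogeneous Neumann condition. For u in C^2 up to the boundary
   it remains to see that the classical Neumann condition is equivalent to the weak one with
   w = Delta u. No trace theory is used: the flux of a vector field X = grad u through the boundary is
   the limit of - int_A X . grad chi_k, where chi_k = S(-(k+1) rho - 1) is a cutoff built on a local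
   defining function rho. If X has no normal component then |X . grad rho| <= C |rho|, while
   |grad chi_k| = O(1 / |rho|) on a layer that shrinks to the boundary, so the flux vanishes by
   dominated convergence. Conversely a nonzero normal component at a boundary point has a sign
   nearby, and comparison with a constant field, whose flux is explicit, makes the flux of a suitable
   bump times X nonzero. *)
Require Import Defs.
From mathcomp Require Import all_boot all_order all_algebra.
From mathcomp Require Import all_classical all_reals all_analysis.
From mathcomp Require Import measurable_realfun ring lra.
Set Implicit Arguments.
Unset Strict Implicit.
Unset Printing Implicit Defensive.
Import Order.TTheory GRing.Theory Num.Theory.
Import numFieldNormedType.Exports.
Local Open Scope classical_set_scope.
Local Open Scope ring_scope.

(** * Elementary smooth functions *)

(** Weak gradients are defined against smooth test functions only, whereas the fields zeta grad u of
    the flux argument are merely C^1 when u is C^2; this gap forces a mollification step. The decay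
    |X . grad rho| <= C |rho| concerns a field that is C^1 inside A and has only a limit at the
    boundary, so it is not a Taylor expansion at a boundary point: the mean value theorem is applied
    along a coordinate segment going from an interior point to the boundary, in a direction in which
    rho increases. This requires the vanishing limit at all boundary points of a neighbourhood for
    one and the same rho, hence the uniqueness of the outward normal. In the converse direction the
    comparison field is a small multiple of that coordinate direction e. Its flux weighted by zeta
    is the integral over A of the derivative of zeta along e; the sign of this integral is visible
    because zeta is a bump on a box centred slightly outside A, so that A meets only the half where
    zeta increases along e. *)

Section elementary_functions.
Context {R : realType}.
Implicit Types f g : R -> R.

(* x^-k exp(-1/x), extended by 0: this family is stable under differentiation up to linear
   combinations, so that the class [elementary] below is closed under derivatives. *)
Definition exp_inv (k : nat) (x : R) : R :=
  if x <= 0 then 0 else x^-1 ^+ k * expR (- x^-1).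

Inductive elementary : (R -> R) -> Prop :=
| elementary_exp_inv k : elementary (exp_inv k)
| elementary_cst c : elementary (fun=> c)
| elementary_id : elementary (fun x => x)
| elementaryD f g : elementary f -> elementary g ->
    elementary (fun x => f x + g x)
| elementaryM f g : elementary f -> elementary g ->
    elementary (fun x => f x * g x)
| elementaryV f : (forall x, f x != 0) -> elementary f ->
    elementary (fun x => (f x)^-1)
| elementary_comp f g : elementary f -> elementary g ->
    elementary (fun x => f (g x)).

(** e^y is the (n+1)-st power of e^(y/(n+1)), which is at least 1 + y/(n+1). *)
Lemma expR_ge_expn (n : nat) (y : R) : 0 <= y -> (y / n.+1%:R) ^+ n.+1 <= expR y.
Proof.
move=> y0; rewrite -[in leRHS](divfK (_ : n.+1%:R != 0 :> R) y) ?pnatr_eq0//.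
rewrite expRM_natr lerXn2r ?nnegrE ?expR_ge0 ?divr_ge0//.
by apply: le_trans (expR_ge1Dx _); rewrite lerDr.
Qed.

(** With y = 1/x, [expR_ge_expn] gives y^(k+1) e^(-y) <= (k+1)^(k+1), whence the constant. The
    linear bound is what makes all members of the family flat at 0. *)
Lemma exp_inv_le (k : nat) : exists2 C, 0 <= C & forall x : R,
  0 < x -> exp_inv k x <= C * x.
Proof.
exists (k.+1%:R ^+ k.+1) => [|x x0]; first by rewrite exprn_ge0.
rewrite /exp_inv ifF; last by apply/negbTE; rewrite -ltNge.
rewrite expRN ler_pdivrMr ?expR_gt0//.
have y0 : 0 <= x^-1 by rewrite invr_ge0 ltW.
have := expR_ge_expn k y0.
rewrite expr_div_n ler_pdivrMr ?exprn_gt0// => h.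
rewrite -(@ler_pM2r _ x^-1) ?invr_gt0// -exprSr (le_trans h)//.
by rewrite mulrC -!mulrA [x * _]mulrC -mulrA mulVf ?gt_eqF ?mulr1.
Qed.

Lemma exp_inv_ge0 k x : 0 <= exp_inv k x.
Proof.
rewrite /exp_inv; case: (leP x 0) => [//|x0].
by rewrite mulr_ge0 ?expR_ge0// exprn_ge0// invr_ge0 ltW.
Qed.

Lemma exp_inv_le0 k x : x <= 0 -> exp_inv k x = 0.
Proof. by move=> x0; rewrite /exp_inv x0. Qed.

Lemma exp_inv_gt0 k x : 0 < x -> 0 < exp_inv k x.
Proof.
move=> x0; rewrite /exp_inv leNgt x0 /=.
by rewrite mulr_gt0 ?expR_gt0// exprn_gt0// invr_gt0.
Qed.

Lemma is_derive_exp_inv k (x : R) :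
  is_derive x (1 : R) (exp_inv k) (exp_inv k.+2 x - k%:R * exp_inv k.+1 x).
Proof.
case: (ltgtP x 0) => x0.
- have -> : exp_inv k.+2 x - k%:R * exp_inv k.+1 x = 0.
    by rewrite !exp_inv_le0 ?(ltW x0)// mulr0 subr0.
  apply: (@near_eq_is_derive _ _ _ (cst 0)).
  by near=> y; rewrite /exp_inv ifT// ltW//; near: y; exact: lt_nbhsl.
- have xn0 : x != 0 by rewrite gt_eqF.
  apply: (@near_eq_is_derive _ _ _ ((GRing.inv : R -> R) ^+ k * (expR \o (-%R \o GRing.inv)))).
  + near=> y; rewrite /exp_inv /= ifF ?fctE//=.
    by apply/negbTE; rewrite -ltNge; near: y; exact: lt_nbhsr.
  + have dV : is_derive x (1:R) (GRing.inv : R -> R) (- x ^- 2).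
      have := @is_deriveV R id x 1 1 xn0 (is_derive_id _ _).
      by rewrite /= /GRing.scale/= mulr1.
    have dN : is_derive x (1 : R) (-%R \o GRing.inv) (x ^- 2).
      have -> : x ^- 2 = - - x ^- 2 by rewrite opprK.
      exact: is_deriveN.
    have dE := is_derive1_comp (is_derive_expR _) dN.
    have := is_deriveM (is_deriveX k dV) dE.
    rewrite /exp_inv ifF; last by apply/negbTE; rewrite -ltNge.
    rewrite ifF; last by apply/negbTE; rewrite -ltNge.
    move=> h; apply: (is_derive_eq h); rewrite /GRing.scale /= !fctE /=.
    rewrite !exprS expr0 mulr1.
    move: (expR _) => e; clear h dE dN dV; case: k => [|k].
      by rewrite !mul0r !mulr0 !expr0; field.
    rewrite /= !exprS; move: (_ ^+ k) => y; field; exact: xn0.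
(* At the origin the difference quotient is 0 on the left and [exp_inv k.+1 h] on the right, hence
   O(h). *)
- rewrite x0 !exp_inv_le0// mulr0 subr0.
  have [C C0 hC] := exp_inv_le k.+1.
  have e0 : exp_inv k 0 = 0 by rewrite exp_inv_le0.
  suff h : h^-1 *: ((exp_inv k \o shift 0) (h *: (1 : R)) - exp_inv k 0) @[h --> (0:R)^'] --> (0 : R).
    apply: DeriveDef; last exact: cvg_lim.
    by apply/cvg_ex; exists 0.
  apply: norm_cvg0.
  apply: (@squeeze_cvgr _ _ _ _ (cst 0) (fun h => C * `|h|)).
  + near=> h; rewrite normr_ge0 /= addr0 e0 subr0 /GRing.scale /= mulr1.
    have : h != 0 by near: h; exact: nbhs_dnbhs_neq.
    rewrite neq_lt => /orP[h0|h0].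
      by rewrite exp_inv_le0 ?(ltW h0)// mulr0 normr0 mulr_ge0.
    rewrite (gtr0_norm h0) ger0_norm; last by rewrite mulr_ge0 ?exp_inv_ge0// invr_ge0 ltW.
    rewrite (le_trans _ (hC _ h0))// /exp_inv ifF; last by apply/negbTE; rewrite -ltNge.
    by rewrite ifF ?exprS ?mulrA//; apply/negbTE; rewrite -ltNge.
  + exact: cvg_cst.
  + have : C * `|h| @[h --> (0:R)^'] --> C * `|0 : R|.
      by apply: cvgMr; apply: cvg_norm; apply: cvg_within_filter; exact: cvg_id.
    by rewrite normr0 mulr0.
Unshelve. all: by end_near. Qed.

Lemma elementary_derive f : elementary f ->
  exists2 df, elementary df & forall x : R, is_derive x (1 : R) f (df x).
Proof.
elim=> {f}.
- move=> k; exists (fun x => exp_inv k.+2 x + (- k%:R) * exp_inv k.+1 x).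
    do ![apply: elementaryD|apply: elementaryM|exact: elementary_exp_inv|exact: elementary_cst].
  by move=> x; rewrite mulNr; exact: is_derive_exp_inv.
- by move=> c; exists (fun=> 0) => [|x]; [exact: elementary_cst|exact: is_derive_cst].
- by exists (fun=> 1) => [|x]; [exact: elementary_cst|exact: is_derive_id].
- move=> f g _ [df ef df'] _ [dg eg dg']; exists (fun x => df x + dg x).
    exact: elementaryD.
  by move=> x; exact: is_deriveD.
- move=> f g ef [df edf df'] eg [dg edg dg']; exists (fun x => f x * dg x + g x * df x).
    by apply: elementaryD; apply: elementaryM.
  by move=> x; exact: is_deriveM.
- move=> f f0 ef [df edf df']; exists (fun x => (-1) * ((f x)^-1 * (f x)^-1) * df x).
    apply: elementaryM => //; apply: elementaryM; first exact: elementary_cst.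
    by apply: elementaryM; exact: elementaryV.
  move=> x; have := is_deriveV (f0 x) (df' x).
  by rewrite /GRing.scale /= expr2 invfM mulN1r.
- move=> f g ef [df edf df'] eg [dg edg dg']; exists (fun x => df (g x) * dg x).
    by apply: elementaryM => //; exact: elementary_comp.
  by move=> x; apply: is_derive1_comp.
Qed.

Lemma elementary_continuous f : elementary f -> continuous f.
Proof.
move=> /elementary_derive[df _ h] x; apply/differentiable_continuous.
by apply/derivable1_diffP; exact: (@ex_derive _ _ _ _ _ _ _ (h x)).
Qed.

Lemma elementary_derive1 f : elementary f -> elementary f^`()%classic.
Proof.
move=> /elementary_derive[df edf h]; rewrite (_ : f^`()%classic = df)//.
by apply/funext => x; rewrite derive1E derive_val.
Qed.

Lemma elementaryN f : elementary f -> elementary (fun x => - f x).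
Proof.
move=> ef; rewrite (_ : (fun _ => _) = fun x => (-1) * f x).
  by apply: elementaryM => //; exact: elementary_cst.
by apply/funext => x; rewrite mulN1r.
Qed.

Lemma elementaryB f g : elementary f -> elementary g -> elementary (fun x => f x - g x).
Proof. by move=> ef eg; apply: elementaryD => //; exact: elementaryN. Qed.

(** Smooth transition from 0 on x <= 0 to 1 on x >= 1; x and 1 - x are never both nonpositive, so
    the denominator does not vanish. *)
Definition step (x : R) : R :=
  exp_inv 0 x / (exp_inv 0 x + exp_inv 0 (1 - x)).

Lemma step_den_gt0 x : 0 < exp_inv 0 x + exp_inv 0 (1 - x).
Proof.
have [x0|x0] := ltP 0 x; first by rewrite ltr_wpDr ?exp_inv_ge0 ?exp_inv_gt0.
by rewrite ltr_wpDl ?exp_inv_ge0 ?exp_inv_gt0// subr_gt0 (le_lt_trans x0).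
Qed.

Lemma step_elementary : elementary step.
Proof.
rewrite /step; apply: elementaryM; first exact: elementary_exp_inv.
apply: elementaryV => [x|]; first by rewrite gt_eqF// step_den_gt0.
apply: elementaryD; first exact: elementary_exp_inv.
apply: (elementary_comp (elementary_exp_inv 0)).
by apply: elementaryB; [exact: elementary_cst|exact: elementary_id].
Qed.

Lemma step_le0 x : x <= 0 -> step x = 0.
Proof. by move=> x0; rewrite /step exp_inv_le0// mul0r. Qed.

Lemma step_ge1 x : 1 <= x -> step x = 1.
Proof.
move=> x1; rewrite /step (@exp_inv_le0 _ (1 - x)) ?subr_le0// addr0 divff//.
by rewrite gt_eqF// exp_inv_gt0// (lt_le_trans _ x1).
Qed.

Lemma step_ge0 x : 0 <= step x.
Proof. by rewrite divr_ge0 ?exp_inv_ge0// ltW// step_den_gt0. Qed.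

Lemma step_le1 x : step x <= 1.
Proof. by rewrite ler_pdivrMr ?step_den_gt0// mul1r lerDl exp_inv_ge0. Qed.

Definition dstep : R -> R := step^`()%classic.

Lemma is_derive_step (x : R) : is_derive x (1 : R) step (dstep x).
Proof.
have [df _ h] := elementary_derive step_elementary.
by rewrite /dstep derive1E derive_val; exact: h.
Qed.

Lemma dstep_elementary : elementary dstep.
Proof. exact/elementary_derive1/step_elementary. Qed.

Lemma dstep_lt0 x : x < 0 -> dstep x = 0.
Proof.
move=> x0; rewrite /dstep derive1E.
have : is_derive x 1 step 0; last by move=> h; rewrite derive_val.
apply: (@near_eq_is_derive _ _ _ (cst 0)).
by near=> y; rewrite step_le0// ltW//; near: y; exact: lt_nbhsl.
Unshelve. all: by end_near. Qed.

Lemma dstep_gt1 x : 1 < x -> dstep x = 0.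
Proof.
move=> x0; rewrite /dstep derive1E.
have : is_derive x 1 step 0; last by move=> h; rewrite derive_val.
apply: (@near_eq_is_derive _ _ _ (cst (1:R))).
by near=> y; rewrite step_ge1// ltW//; near: y; exact: lt_nbhsr.
Unshelve. all: by end_near. Qed.

(** The derivative of a / (a + b) is (a' b - a b') / (a + b)^2, with a increasing and b decreasing.
    This sign makes [dstep] a probability density for mollification and fixes the direction of the
    cutoff gradients. *)
Lemma dstep_ge0 x : 0 <= dstep x.
Proof.
pose d k x := exp_inv k.+2 x - k%:R * exp_inv k.+1 x : R.
pose a := exp_inv 0; pose b x := exp_inv 0 (1 - x).
have da : is_derive x (1 : R) a (exp_inv 2 x).
  by have := is_derive_exp_inv 0 x; rewrite mul0r subr0.
have db : is_derive x (1 : R) b (- exp_inv 2 (1 - x)).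
  have h := is_derive_exp_inv 0 (1 - x); rewrite mul0r subr0 in h.
  have k : is_derive x (1 : R) (fun x => 1 - x) (-1).
    by have := is_deriveB (is_derive_cst (1 : R) x 1) (is_derive_id x (1:R)); rewrite sub0r.
  by rewrite -mulrN1; exact: (@is_derive1_comp _ _ (fun x => 1 - x) _ _ _ h k).
have den0 : a x + b x != 0 by rewrite gt_eqF// step_den_gt0.
have dV := @is_deriveV _ (a + b) _ _ _ den0 (is_deriveD da db).
have := is_deriveM da dV; rewrite -[_ * _]/step => h.
rewrite /dstep derive1E (@derive_val _ _ _ _ _ _ _ h).
rewrite /GRing.scale /= !fctE.
have -> : a x * (- (a x + b x) ^- 2 * (exp_inv 2 x - exp_inv 2 (1 - x))) +
  (a x + b x)^-1 * exp_inv 2 x =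
  (a x * exp_inv 2 (1 - x) + b x * exp_inv 2 x) / (a x + b x) ^+ 2.
  by field.
apply: divr_ge0; last by rewrite exprn_ge0// ltW// step_den_gt0.
by rewrite addr_ge0// mulr_ge0 ?exp_inv_ge0.
Qed.

End elementary_functions.

(** * Smooth functions on R^N built by arithmetic and composition *)

Section elementary_rV.
Context {R : realType} {N : nat}.
Implicit Types f g : 'rV[R]_N -> R.

(** Every member is differentiable and its partial derivatives are again members, so membership
    gives smoothness of all orders at once. *)
Inductive elementary_rV : ('rV[R]_N -> R) -> Prop :=
| elementary_rV_smooth f : smooth f -> elementary_rV f
| elementary_rV_coord i : elementary_rV (fun x => x ord0 i)
| elementary_rV_cst c : elementary_rV (fun=> c)
| elementary_rVD f g : elementary_rV f -> elementary_rV g ->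
    elementary_rV (fun x => f x + g x)
| elementary_rVM f g : elementary_rV f -> elementary_rV g ->
    elementary_rV (fun x => f x * g x)
| elementary_rV_comp h f : elementary h -> elementary_rV f ->
    elementary_rV (fun x => h (f x)).

Lemma is_derive_comp_diff (V : normedModType R) (h : R -> R) (f : V -> R) x v d :
  differentiable f x -> is_derive (f x) (1 : R) h d ->
  is_derive x v (fun y => h (f y)) (d * 'D_v f x).
Proof.
move=> df dh.
have dh' : differentiable h (f x) by apply/derivable1_diffP; exact: (@ex_derive _ _ _ _ _ _ _ dh).
have dhf : differentiable (fun y => h (f y)) x by exact: (differentiable_comp df dh').
apply: DeriveDef; first exact: diff_derivable.
rewrite !deriveE// (diff_comp df dh') /= diff1E// /GRing.scale /=.
by rewrite derive1E derive_val mulrC.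
Qed.

Lemma is_derive_coord (i j : 'I_N) (x : 'rV[R]_N) :
  is_derive x (delta_mx ord0 j) (fun y : 'rV[R]_N => y ord0 i) (i == j)%:R.
Proof.
apply: DeriveDef; first exact/diff_derivable/differentiable_coord.
apply: cvg_lim => //.
apply: cvg_near_cst.
near=> h.
have h0 : h != 0 by near: h; exact: nbhs_dnbhs_neq.
by rewrite /= !mxE addrK eqxx /= /GRing.scale /= mulKf.
Unshelve. all: by end_near. Qed.

Lemma smooth_partial f i : smooth f -> smooth (partial i f).
Proof.
by move=> sf s x; have := sf (rcons s i) x; rewrite /iter_partial foldr_rcons.
Qed.

Lemma smooth_differentiable f x : smooth f -> differentiable f x.
Proof. by move=> sf; exact: (sf [::] x). Qed.

Lemma differentiable_partial i f x : differentiable f x ->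
  is_derive x (delta_mx ord0 i) f (partial i f x).
Proof. by move=> df; apply: derivableP; exact: diff_derivable. Qed.

Lemma elementary_rV_diff f : elementary_rV f -> forall x, differentiable f x.
Proof.
elim=> {f}.
- by move=> f sf x; exact: smooth_differentiable.
- by move=> i x; exact: differentiable_coord.
- by move=> c x; exact: differentiable_cst.
- by move=> f g _ df _ dg x; exact: differentiableD.
- by move=> f g _ df _ dg x; exact: differentiableM.
- move=> h f /elementary_derive[dh _ hdh] _ df x.
  apply: (differentiable_comp (df x)); apply/derivable1_diffP.
  exact: (@ex_derive _ _ _ _ _ _ _ (hdh (f x))).
Qed.

Lemma elementary_rV_partial f i : elementary_rV f -> elementary_rV (partial i f).
Proof.
have val g x d : is_derive x (delta_mx ord0 i) g d -> partial i g x = d.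
  by move=> h; rewrite /partial derive_val.
elim=> {f}.
- by move=> f sf; apply/elementary_rV_smooth/smooth_partial.
- move=> j; rewrite (_ : partial _ _ = fun=> (j == i)%:R); first exact: elementary_rV_cst.
  by apply/funext => x; apply: val; exact: is_derive_coord.
- move=> c; rewrite (_ : partial _ _ = fun=> 0); first exact: elementary_rV_cst.
  by apply/funext => x; apply: val; exact: is_derive_cst.
- move=> f g ef edf eg edg.
  rewrite (_ : partial _ _ = fun x => partial i f x + partial i g x); first exact: elementary_rVD.
  apply/funext => x; apply: val; apply: is_deriveD; apply: differentiable_partial;
    exact: elementary_rV_diff.
- move=> f g ef edf eg edg.
  rewrite (_ : partial _ _ = fun x => f x * partial i g x + g x * partial i f x).
    by apply: elementary_rVD; exact: elementary_rVM.
  apply/funext => x; apply: val; apply: is_deriveM; apply: differentiable_partial;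
    exact: elementary_rV_diff.
- move=> h f eh ef edf; have [dh edh hdh] := elementary_derive eh.
  rewrite (_ : partial _ _ = fun x => dh (f x) * partial i f x).
    by apply: elementary_rVM => //; exact: elementary_rV_comp.
  by apply/funext => x; apply: val; apply: is_derive_comp_diff => //; exact: elementary_rV_diff.
Qed.

Lemma elementary_rVP f : elementary_rV f -> smooth f.
Proof.
move=> ef s; suff h : elementary_rV (iter_partial s f) by exact: elementary_rV_diff.
by elim: s => //= i s ih; exact: elementary_rV_partial.
Qed.

Lemma smooth_continuous f : smooth f -> continuous f.
Proof. by move=> sf x; apply: differentiable_continuous; exact: smooth_differentiable. Qed.

Lemma elementary_rV_prod (I : Type) (r : seq I) (F : I -> 'rV[R]_N -> R) :
  (forall i, elementary_rV (F i)) -> elementary_rV (fun x => \prod_(i <- r) F i x).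
Proof.
move=> h; elim: r => [|i r ih].
  under eq_fun do rewrite big_nil; exact: elementary_rV_cst.
by under eq_fun do rewrite big_cons; exact: elementary_rVM.
Qed.

Lemma elementary_rV_sum (I : Type) (r : seq I) (F : I -> 'rV[R]_N -> R) :
  (forall i, elementary_rV (F i)) -> elementary_rV (fun x => \sum_(i <- r) F i x).
Proof.
move=> h; elim: r => [|i r ih].
  under eq_fun do rewrite big_nil; exact: elementary_rV_cst.
by under eq_fun do rewrite big_cons; exact: elementary_rVD.
Qed.

End elementary_rV.

(** * Borel sets and Lebesgue measure on R^N *)
Section rV_topology.
Context {R : realType} {N : nat}.
Implicit Types (x y a b : 'rV[R]_N) (U : set 'rV[R]_N).

Lemma continuous_mul (f g : 'rV[R]_N -> R) :
  continuous f -> continuous g -> continuous (fun x => f x * g x).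
Proof. by move=> cf cg x; apply: continuousM; [exact: cf|exact: cg]. Qed.

Lemma ball_rVP x e y :
  ball x e y <-> 0 < e /\ forall i, `|x ord0 i - y ord0 i| < e.
Proof.
split=> [[e0 h]|[e0 h]]; split=> // i; first exact: h.
by move=> j; rewrite (ord1 i); exact: h.
Qed.

Lemma continuous_rV (T : topologicalType) (f : T -> 'rV[R]_N) t :
  (forall i, f s ord0 i @[s --> t] --> f t ord0 i) -> {for t, continuous f}.
Proof.
move=> h; apply/cvg_ballP => e e0.
have : \forall s \near t, forall i : 'I_N, `|f t ord0 i - f s ord0 i| < e.
  apply: filter_forall => i.
  by have /cvgrPdist_lt/(_ _ e0) := h i.
by apply: filterS => s hs; apply/ball_rVP.
Qed.

Definition obox a b := [set x : 'rV[R]_N | forall i, a ord0 i < x ord0 i < b ord0 i].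
Definition cbox a b := [set x : 'rV[R]_N | forall i, a ord0 i <= x ord0 i <= b ord0 i].

Lemma obox_cbox a b : obox a b `<=` cbox a b.
Proof. by move=> x h i; have /andP[/ltW-> /ltW->] := h i. Qed.

Lemma measurable_coord_set (P : 'I_N -> set (measurableTypeR R)) :
  (forall i, measurable (P i)) ->
  measurable [set x : 'rV[R]_N | forall i, P i (x ord0 i)].
Proof.
move=> mP; rewrite (_ : [set _ | _] =
    \bigcap_(i in [set: 'I_N]) ((fun x : 'rV[R]_N => x ord0 i : measurableTypeR R) @^-1` P i)).
  apply: fin_bigcap_measurable => // i _.
  by rewrite -[X in measurable X]setTI; apply: measurable_coord_rV => //; exact: mP.
by apply/seteqP; split=> x /= h i => [_|]; exact: h.
Qed.

Lemma measurable_obox a b : measurable (obox a b).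
Proof.
rewrite (_ : obox a b = [set x : 'rV[R]_N | forall i, `]a ord0 i, b ord0 i[%classic (x ord0 i)]).
  by apply: (measurable_coord_set (P := fun i => `]a ord0 i, b ord0 i[%classic)).
by apply/seteqP; split=> x /= h i; have := h i; rewrite in_itv.
Qed.

Lemma measurable_cbox a b : measurable (cbox a b).
Proof.
rewrite (_ : cbox a b = [set x : 'rV[R]_N | forall i, `[a ord0 i, b ord0 i]%classic (x ord0 i)]).
  by apply: (measurable_coord_set (P := fun i => `[a ord0 i, b ord0 i]%classic)).
by apply/seteqP; split=> x /= h i; have := h i; rewrite in_itv.
Qed.

Lemma compact_cbox a b : compact (cbox a b).
Proof.
rewrite (_ : cbox a b = [set x : 'rV[R]_N | forall i, `[a ord0 i, b ord0 i]%classic (x ord0 i)]).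
  by apply: (rV_compact (A := fun i => `[a ord0 i, b ord0 i]%classic)) => i; exact: segment_compact.
by apply/seteqP; split=> x /= h i; have := h i; rewrite in_itv.
Qed.

(** Boxes with rational corners form a countable type and a basis of the topology. *)
Definition rat_box := ('rV[rat]_N * 'rV[rat]_N)%type.
Definition rat_lo (p : rat_box) : 'rV[R]_N := map_mx ratr p.1.
Definition rat_hi (p : rat_box) : 'rV[R]_N := map_mx ratr p.2.

Lemma open_rat_box U x : open U -> U x ->
  exists p : rat_box, obox (rat_lo p) (rat_hi p) x /\ cbox (rat_lo p) (rat_hi p) `<=` U.
Proof.
move=> oU Ux; have /nbhs_ballP[e /= e0 hU] : nbhs x U by exact: open_nbhs_nbhs.
have /choice[l hl] i : exists q : rat, (ratr q : R) \in `]x ord0 i - e, x ord0 i[.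
  by apply: rat_in_itvoo; rewrite ltrBlDr ltrDl.
have /choice[r hr] i : exists q : rat, (ratr q : R) \in `]x ord0 i, x ord0 i + e[.
  by apply: rat_in_itvoo; rewrite ltrDl.
exists (\row_i l i, \row_i r i); split=> [i|y hy].
  rewrite !mxE; have := hl i; have := hr i.
  by rewrite !in_itv /= => /andP[-> _] /andP[_ ->].
apply: hU; apply/ball_rVP; split=> // i.
have := hy i; rewrite !mxE; have := hl i; have := hr i; rewrite !in_itv /=.
move=> /andP[h1 h2] /andP[h3 h4] /andP[h5 h6]; rewrite ltr_norml; apply/andP; split; lra.
Qed.

(** The sigma-algebra is generated by the coordinates; second countability, through rational boxes,
    makes it contain the topology. *)
Lemma open_measurable_rV U : open U -> measurable U.
Proof.
move=> oU.
pose D := [set p : rat_box | cbox (rat_lo p) (rat_hi p) `<=` U].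
(* Boxes not contained in U are replaced by the empty set, so that the union runs over a whole
   countable type. *)
have -> : U = \bigcup_(p in [set: rat_box])
    (if `[< D p >] then obox (rat_lo p) (rat_hi p) else set0).
  apply/seteqP; split=> [x Ux|x [p _]].
    have [p [h1 h2]] := open_rat_box oU Ux; exists p => //.
    by rewrite ifT//; apply/asboolP.
  by case: asboolP => // Dp; move/obox_cbox; exact: Dp.
apply: countable_bigcupT_measurable => [|p]; first exact: countableP.
by case: ifP => // _; exact: measurable_obox.
Qed.

Lemma continuous_measurable_rV (f : 'rV[R]_N -> R) (D : set 'rV[R]_N) :
  measurable D -> continuous f -> measurable_fun D f.
Proof.
move=> mD cf; apply: measurable_funTS; apply: (measurability _ (RGenOpens.measurableE R)).
move=> _ [_ [a [b ->] <-]]; rewrite setTI; apply: open_measurable_rV.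
by apply: open_comp => // x _; exact: cf.
Qed.

Lemma continuous_in_measurable_rV (f : 'rV[R]_N -> R) U :
  open U -> (forall x, U x -> {for x, continuous f}) -> measurable_fun U f.
Proof.
move=> oU cf; apply: (measurability _ (RGenOpens.measurableE R)).
move=> _ [_ [a [b ->] <-]]; apply: open_measurable_rV.
rewrite openE => x [Ux fx]; apply: filterI; first exact: open_nbhs_nbhs.
by apply: (cf x Ux); apply: open_nbhs_nbhs; split=> //; exact: interval_open.
Qed.

End rV_topology.

(** * Finiteness on bounded sets and integration on R^(n+1) as R x R^n *)

Section lebesgue_rV_theory.
Context {R : realType}.
Let mu n := @lebesgue_rV R n.

Lemma cons_rV0 n (p : measurableTypeR R * 'rV[R]_n) : cons_rV p ord0 ord0 = p.1.
Proof.
have -> : ord0 = lshift n (ord0 : 'I_1) by apply/val_inj.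
by rewrite /cons_rV (row_mxEl (p.1%:M : 'rV_1)) mxE eqxx.
Qed.

Lemma cons_rVS n (p : measurableTypeR R * 'rV[R]_n) i : cons_rV p ord0 (lift ord0 i) = p.2 ord0 i.
Proof.
have -> : lift ord0 i = rshift 1 i by apply/val_inj.
by rewrite /cons_rV (row_mxEr (p.1%:M : 'rV_1)).
Qed.

Lemma segment_fin (p q : R) : (@lebesgue_measure R `[p, q]%classic < +oo)%E.
Proof. by rewrite lebesgue_measure_itv /=; case: ifP => _; rewrite -?EFinB ltry. Qed.

Lemma cbox_fin n (a b : 'rV[R]_n) : (mu n (cbox a b) < +oo)%E.
Proof.
rewrite /mu; elim: n a b => [|n ih] a b.
  by rewrite /= diracE ltry.
rewrite /= /lebesgue_rV_step /pushforward /=.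
pose a' : 'rV[R]_n := \row_i a ord0 (lift ord0 i).
pose b' : 'rV[R]_n := \row_i b ord0 (lift ord0 i).
rewrite (_ : _ @^-1` _ = `[a ord0 ord0, b ord0 ord0]%classic `*` cbox a' b').
  rewrite product_measure1E//; last exact: measurable_cbox.
  apply: lte_mul_pinfty => //.
  rewrite ge0_fin_numE; last exact: measure_ge0.
  exact: segment_fin.
apply/seteqP; split=> -[t y] /=.
  move=> h; split; first by have := h ord0; rewrite cons_rV0 in_itv.
  by move=> i; have := h (lift ord0 i); rewrite cons_rVS !mxE.
move=> [/= ht hy] i; have [j ->|->] := unliftP ord0 i.
  by rewrite cons_rVS; have := hy j; rewrite !mxE.
by rewrite cons_rV0; rewrite in_itv in ht.
Qed.

Lemma norm_coord_le n (x : 'rV[R]_n) i : `|x ord0 i| <= `|x|.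
Proof.
by rewrite [leRHS]/Num.norm /= mx_normrE; apply/bigmax_geP; right => /=; exists (ord0, i).
Qed.

Lemma bounded_cbox n (A : set 'rV[R]_n) : bounded_set A ->
  exists2 M : R, 0 <= M & A `<=` cbox (const_mx (- M)) (const_mx M).
Proof.
move=> [M [_ hM]]; have M1 : M < `|M| + 1 by rewrite ltr_pwDr// ler_norm.
exists (`|M| + 1) => [|x Ax i]; first by rewrite addr_ge0.
by rewrite !mxE -ler_norml; apply: le_trans (norm_coord_le _ _) (hM _ M1 x Ax).
Qed.

Lemma bounded_mu_fin n (A : set 'rV[R]_n) : measurable A -> bounded_set A ->
  (mu n A < +oo)%E.
Proof.
move=> mA /bounded_cbox[M _ hM]; apply: le_lt_trans (cbox_fin (const_mx (- M)) (const_mx M)).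
by apply: le_measure => //; rewrite inE//; exact: measurable_cbox.
Qed.

Lemma integrable_cons_rV n (f : 'rV[R]_n.+1 -> \bar R) :
  (mu n.+1).-integrable setT f ->
  (@lebesgue_measure R \x mu n)%E.-integrable setT (f \o @cons_rV R n).
Proof.
move=> /integrableP[mf fi]; apply/integrableP; split.
  exact: (measurableT_comp mf (@measurable_cons_rV R n)).
apply: le_lt_trans fi; rewrite /mu /= /lebesgue_rV_step.
rewrite ge0_integral_pushforward//=.
- exact: measurable_cons_rV.
- exact: measurableT_comp.
Qed.

Lemma integral_cons_rV n (f : 'rV[R]_n.+1 -> \bar R) :
  (mu n.+1).-integrable setT f ->
  (\int[mu n.+1]_x f x = \int[(@lebesgue_measure R \x mu n)%E]_p f (cons_rV p))%E.
Proof.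
move=> fi; have mf := measurable_int _ fi.
rewrite /mu /= /lebesgue_rV_step integral_pushforward//=.
- exact: measurable_cons_rV.
- exact: integrable_cons_rV.
Qed.

End lebesgue_rV_theory.

(** * Integrals of compactly supported functions and of their partial derivatives *)

Section compact_support.
Context {R : realType}.
Let mu n := @lebesgue_rV R n.

Lemma continuous_compact_bound (T : topologicalType) (K : set T) (f : T -> R) :
  compact K -> {within K, continuous f} -> exists2 C, 0 <= C & forall x, K x -> `|f x| <= C.
Proof.
move=> cK cf; have /compact_bounded[M [_ hM]] := continuous_compact cf cK.
exists (`|M| + 1) => [|x Kx]; first by rewrite addr_ge0.
by apply: hM; [rewrite ltr_pwDr// ler_norm|exists x].
Qed.

Lemma bounded_by_integrable d (T : measurableType d) (nu : measure T R) (D : set T) (f : T -> R) C :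
  measurable D -> (nu D < +oo)%E -> measurable_fun D f -> (forall x, D x -> `|f x| <= C) ->
  nu.-integrable D (EFin \o f).
Proof.
move=> mD fD mf hC; apply: measurable_bounded_integrable => //.
by exists C; split=> [|y Cy x Dx]; [exact: num_real|exact: le_trans (hC x Dx) (ltW Cy)].
Qed.

Lemma const_cboxP n (M : R) (x : 'rV[R]_n) :
  cbox (const_mx (- M)) (const_mx M) x <-> forall i, `|x ord0 i| <= M.
Proof. by split=> h i; have := h i; rewrite !mxE ler_norml. Qed.

Lemma csupp_integrable n (F : 'rV[R]_n -> R) M :
  continuous F -> (forall (x : 'rV[R]_n) i, M < `|x ord0 i| -> F x = 0) ->
  (mu n).-integrable setT (EFin \o F).
Proof.
move=> cF F0; pose K : set 'rV[R]_n := cbox (const_mx (- M)) (const_mx M).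
have mK : measurable K by exact: measurable_cbox.
have [C C0 hC] := continuous_compact_bound (@compact_cbox _ _ _ _ : compact K) (continuous_subspaceT cF).
have -> : EFin \o F = (EFin \o F) \_ K.
  apply/funext => x; rewrite patchE; case: ifPn => // /negP xK /=.
  have [i hi] : exists i, M < `|x ord0 i|.
    apply/not_existsP => h; apply: xK; rewrite inE; apply/const_cboxP => i.
    by rewrite leNgt; apply/negP; exact: h.
  by rewrite (F0 x i).
apply/(integrable_mkcond _ mK).
apply: (bounded_by_integrable (C := C)) => //; first exact: cbox_fin.
exact: continuous_measurable_rV.
Qed.

(** The two difference quotients are the same function of h, so no differentiability beyond one
    direction is involved. It covers slices, translations, reflections and lines. *)
Lemma is_derive_affine (V W : normedModType R) (g : W -> V) (f : V -> R) y w v (d : R) :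
  (forall h : R, g (h *: w + y) = h *: v + g y) ->
  is_derive (g y) v f d -> is_derive y w (f \o g) d.
Proof.
move=> hg [df vf].
have E : (fun h : R => h^-1 *: (((f \o g) \o shift y) (h *: w) - (f \o g) y)) =
         (fun h : R => h^-1 *: ((f \o shift (g y)) (h *: v) - f (g y))).
  by apply/funext => h /=; rewrite hg.
by apply: DeriveDef; [rewrite /derivable E|rewrite /derive E].
Qed.

Lemma integral_derive_csupp (f F : R -> R) (M a : R) :
  (forall x : R, is_derive x (1 : R) f (F x)) -> continuous F ->
  (forall x, M < `|x| -> F x = 0) -> M < a -> 0 < a ->
  (\int[@lebesgue_measure R]_x (F x)%:E = (f a - f (- a))%:E)%E.
Proof.
move=> df cF F0 aM a0.
have -> : (fun x => (F x)%:E) = (fun x => (F x)%:E) \_ `[- a, a]%classic.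
  apply/funext => x; rewrite patchE; case: ifPn => // /negP xK /=.
  rewrite (F0 x _)//; apply: (lt_trans aM); rewrite ltNge; apply/negP => h.
  by apply: xK; rewrite inE /= in_itv /= -ler_norml.
rewrite -integral_mkcond (@continuous_FTC2 _ F f) ?EFinB//.
- by rewrite -subr_gt0 opprK addr_gt0.
- exact: continuous_subspaceT.
- have cf x : {for x, continuous f}.
    apply/differentiable_continuous/derivable1_diffP.
    exact: (@ex_derive _ _ _ _ _ _ _ (df x)).
  split.
  + by move=> x _; exact: (@ex_derive _ _ _ _ _ _ _ (df x)).
  + by apply: cvg_at_right_filter; exact: cf.
  + by apply: cvg_at_left_filter; exact: cf.
- by move=> x _; rewrite derive1E derive_val.
Qed.

Lemma integral_fubini1 d1 d2 (T1 : measurableType d1) (T2 : measurableType d2)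
  (m1 : {sigma_finite_measure set T1 -> \bar R}) (m2 : {sigma_finite_measure set T2 -> \bar R})
  (f : T1 * T2 -> \bar R) : (m1 \x m2)%E.-integrable setT f ->
  (\int[(m1 \x m2)%E]_p f p = \int[m1]_x \int[m2]_y f (x, y))%E.
Proof. by move=> h; rewrite -fubini1. Qed.

Lemma integral_fubini2 d1 d2 (T1 : measurableType d1) (T2 : measurableType d2)
  (m1 : {sigma_finite_measure set T1 -> \bar R}) (m2 : {sigma_finite_measure set T2 -> \bar R})
  (f : T1 * T2 -> \bar R) : (m1 \x m2)%E.-integrable setT f ->
  (\int[(m1 \x m2)%E]_p f p = \int[m2]_y \int[m1]_x f (x, y))%E.
Proof. by move=> h; rewrite -fubini2. Qed.

(** Induction on the dimension through Fubini: the partial derivative is integrated to zero along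
    its own coordinate by the fundamental theorem of calculus. *)
Lemma integral_partial_csupp n (i : 'I_n) (f F : 'rV[R]_n -> R) (M : R) :
  (forall x, is_derive x (delta_mx ord0 i) f (F x)) -> continuous F ->
  (forall (x : 'rV[R]_n) j, M < `|x ord0 j| -> f x = 0 /\ F x = 0) ->
  (\int[mu n]_x (F x)%:E = 0)%E.
Proof.
elim: n i f F => [i|n ih i f F df cF F0]; first by have := ltn_ord i.
have Fi := csupp_integrable cF (fun x j h => (F0 x j h).2).
rewrite integral_cons_rV//.
have ci := integrable_cons_rV Fi.
have cc (y : 'rV[R]_n) : continuous (fun t : R => cons_rV (t, y)).
  move=> t; apply: continuous_rV => k; have [j ->|->] := unliftP ord0 k.
    by under eq_fun do rewrite cons_rVS; rewrite cons_rVS; exact: cvg_cst.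
  by under eq_fun do rewrite cons_rV0; rewrite cons_rV0; exact: cvg_id.
have cy (t : R) (y : 'rV[R]_n) : {for y, continuous (fun y : 'rV[R]_n => cons_rV (t, y))}.
  apply: continuous_rV => k; have [j ->|->] := unliftP ord0 k.
    by under eq_fun do rewrite cons_rVS; rewrite cons_rVS; exact: coord_continuous.
  rewrite (_ : (fun s => _) = cst t); last by apply/funext => s; rewrite cons_rV0.
  by rewrite cons_rV0 /=; exact: cst_continuous.
have [j ij|i0] := unliftP ord0 i.
(* The differentiated coordinate is not the first one: for a fixed first coordinate t the slice
   falls under the induction hypothesis. *)
- rewrite integral_fubini1//; apply: integral0_eq => t _.
  apply: (ih j (f \o (fun y => cons_rV (t, y)))).
  + move=> y; apply: (@is_derive_affine 'rV[R]_n.+1 'rV[R]_n (fun y => cons_rV (t, y)) f y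
      _ (delta_mx ord0 i) _ _ (df _)).
    move=> h; apply/rowP => k; have [l ->|->] := unliftP ord0 k.
      by rewrite [LHS]cons_rVS [RHS]mxE cons_rVS !mxE ij eqxx (inj_eq (@lift_inj _ _)).
    by rewrite [LHS]cons_rV0 [RHS]mxE cons_rV0 !mxE ij eqxx /= mulr0 add0r.
  + move=> y; apply: continuous_comp; [exact: cy|exact: cF].
  + by move=> y k hk; apply: (F0 _ (lift ord0 k)); rewrite cons_rVS.
- rewrite integral_fubini2//; apply: integral0_eq => y _.
  (* The end points are pushed to |M| + 1, positive and strictly above M, so that f vanishes at both
     of them. *)
  have a0 : 0 < `|M| + 1 by rewrite ltr_pwDr.
  have aM : M < `|M| + 1 by rewrite ltr_pwDr// ler_norm.
  have f0 t : M < `|t| -> f (cons_rV (t, y)) = 0.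
    by move=> ht; have [] := F0 (cons_rV (t, y)) ord0; rewrite ?cons_rV0.
  rewrite (@integral_derive_csupp (f \o (fun t => cons_rV (t, y))) _ M _ _ _ _ aM a0) /=.
  + by rewrite !f0 ?subrr// ?normrN gtr0_norm.
  + move=> t; apply: (@is_derive_affine 'rV[R]_n.+1 R (fun t => cons_rV (t, y)) f t
      _ (delta_mx ord0 i) _ _ (df _)).
    move=> h; apply/rowP => k; have [l ->|->] := unliftP ord0 k.
      by rewrite [LHS]cons_rVS [RHS]mxE cons_rVS !mxE i0 eqxx /= mulr0 add0r.
    by rewrite [LHS]cons_rV0 [RHS]mxE cons_rV0 !mxE i0 eqxx /GRing.scale /= !mulr1.
  + move=> t; apply: continuous_comp; [exact: cc|exact: cF].
  + by move=> t ht; have [] := F0 (cons_rV (t, y)) ord0; rewrite ?cons_rV0.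
Qed.

End compact_support.

(** * Test functions exhausting an open set *)

Section exhaustion.
Context {R : realType} {N : nat}.
Implicit Types (U : set 'rV[R]_N).

Definition bump (a b x : 'rV[R]_N) : R :=
  \prod_i (exp_inv 0 (x ord0 i - a ord0 i) * exp_inv 0 (b ord0 i - x ord0 i)).

Lemma bump_elementary a b : elementary_rV (bump a b).
Proof.
apply: elementary_rV_prod => i.
apply: elementary_rVM.
  apply: (elementary_rV_comp (h := fun t => exp_inv 0 (t - a ord0 i))); last exact: elementary_rV_coord.
  apply: (elementary_comp (elementary_exp_inv 0)).
  by apply: elementaryB; [exact: elementary_id|exact: elementary_cst].
apply: (elementary_rV_comp (h := fun t => exp_inv 0 (b ord0 i - t))); last exact: elementary_rV_coord.
apply: (elementary_comp (elementary_exp_inv 0)).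
by apply: elementaryB; [exact: elementary_cst|exact: elementary_id].
Qed.

Lemma bump_ge0 a b x : 0 <= bump a b x.
Proof. by apply: prodr_ge0 => i _; rewrite mulr_ge0 ?exp_inv_ge0. Qed.

Lemma bump_gt0 a b x : obox a b x -> 0 < bump a b x.
Proof.
move=> h; apply: prodr_gt0 => i _; have /andP[h1 h2] := h i.
by rewrite mulr_gt0 ?exp_inv_gt0 ?subr_gt0.
Qed.

Lemma bump_out a b x : bump a b x != 0 -> obox a b x.
Proof.
move=> /prodf_neq0 h i; have := h i isT; apply: contraNT.
rewrite negb_and -!leNgt => /orP[h1|h1].
  by rewrite exp_inv_le0 ?mul0r// subr_le0.
by rewrite [X in _ * X]exp_inv_le0 ?mulr0// subr_le0.
Qed.

(** Enumeration of the bumps on rational boxes whose closure lies in U; every other code gives the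
    zero function. *)
Definition inner_bump U (k : nat) (x : 'rV[R]_N) : R :=
  if (unpickle k : option rat_box) is Some p then
    if `[< cbox (rat_lo p) (rat_hi p) `<=` U >] then bump (rat_lo p) (rat_hi p) x else 0
  else 0.

(* Test functions of U that converge pointwise to the indicator function of U. *)
Definition exhaustion U (n : nat) (x : 'rV[R]_N) : R :=
  step (n%:R * \sum_(k <- iota 0 n) inner_bump U k x).

Lemma inner_bump_elementary U k : elementary_rV (inner_bump U k).
Proof.
rewrite /inner_bump; case: unpickle => [p|]; last exact: elementary_rV_cst.
by case: (asbool _); [exact: bump_elementary|exact: elementary_rV_cst].
Qed.

Lemma inner_bump_ge0 U k x : 0 <= inner_bump U k x.
Proof.
by rewrite /inner_bump; case: unpickle => // p; case: ifP => // _; exact: bump_ge0.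
Qed.

Lemma exhaustion_elementary U n : elementary_rV (exhaustion U n).
Proof.
apply: (elementary_rV_comp step_elementary); apply: elementary_rVM.
  exact: elementary_rV_cst.
by apply: elementary_rV_sum => k; exact: inner_bump_elementary.
Qed.

Lemma closed_cbox (a b : 'rV[R]_N) : closed (cbox a b).
Proof. by apply: compact_closed; [exact: norm_hausdorff|exact: compact_cbox]. Qed.

Lemma exhaustion_csupp U n : exists K, [/\ compact K, K `<=` U &
  forall x, exhaustion U n x != 0 -> K x].
Proof.
pose C k : set 'rV[R]_N := if (unpickle k : option rat_box) is Some p then
  (if `[< cbox (rat_lo p) (rat_hi p) `<=` U >] then cbox (rat_lo p) (rat_hi p) else set0) else set0.
have [K [cK KU hK]] : exists K, [/\ compact K, K `<=` U &
    forall x k, k \in iota 0 n -> inner_bump U k x != 0 -> K x].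
  elim: (iota 0 n) => [|k s [K [cK KU hK]]].
    by exists set0; split=> //; exact: compact0.
  exists (C k `|` K); split.
  - apply: compactU => //; rewrite /C; case: unpickle => [p|]; last exact: compact0.
    by case: ifP => _; [exact: compact_cbox|exact: compact0].
  - move=> x [|]; last exact: KU.
    by rewrite /C; case: unpickle => [p|//]; case: asboolP => // h; exact: h.
  - move=> x j; rewrite inE => /orP[/eqP ->|js]; last by move=> h; right; exact: (hK x j).
    rewrite /inner_bump /C => h; left; move: h; case: unpickle => [p|]; last by rewrite eqxx.
    by case: ifP => _; [move=> /bump_out; exact: obox_cbox|rewrite eqxx].
exists K; split=> // x; rewrite /exhaustion => h.
have [k hk] : exists k, k \in iota 0 n /\ inner_bump U k x != 0.
  apply/not_existsP => hn; move/eqP: h; apply.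
  rewrite big_seq big1 ?mulr0 ?step_le0// => k ks.
  by apply/eqP; apply/negPn/negP => hk; apply: (hn k).
by case: hk => hk hk'; exact: (hK x k).
Qed.

Lemma exhaustion_out U n x : ~ U x -> exhaustion U n x = 0.
Proof.
move=> Ux; apply/eqP/negPn/negP => h; apply: Ux.
by have [K [_ KU hK]] := exhaustion_csupp U n; exact/KU/hK.
Qed.

(** A rational box around x has a fixed code and a bump value b > 0 at x. Once n exceeds that code
    and 1/b, the argument of [step] is at least n b >= 1. *)
Lemma exhaustion_in U x : open U -> U x -> \forall n \near \oo, exhaustion U n x = 1.
Proof.
move=> oU Ux; have [p [px pU]] := open_rat_box oU Ux.
have b0 := bump_gt0 px; set b := bump _ _ x in b0.
near=> n; apply: step_ge1.
have kn : (pickle p < n)%N by near: n; exact: nbhs_infty_gt.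
apply: (@le_trans _ _ (n%:R * b)).
  rewrite -ler_pdivrMr// div1r; near: n; exact: nbhs_infty_ger.
rewrite ler_wpM2l// (big_rem (pickle p)) ?mem_iota//=.
rewrite {1}/inner_bump pickleK ifT; last exact/asboolP.
by rewrite lerDl; apply: sumr_ge0 => k _; exact: inner_bump_ge0.
Unshelve. all: by end_near. Qed.

Lemma exhaustion_norm U n x : `|exhaustion U n x| <= 1.
Proof. by rewrite ger0_norm ?step_ge0 ?step_le1. Qed.

Lemma test_function_subset U V phi : U `<=` V -> test_function U phi -> test_function V phi.
Proof. by move=> UV [? ? h]; split=> //; exact: subset_trans h UV. Qed.

Lemma csupp_closure (phi : 'rV[R]_N -> R) K U : compact K -> K `<=` U ->
  (forall x, phi x != 0 -> K x) ->
  compact (closure [set x | phi x != 0]) /\ closure [set x | phi x != 0] `<=` U.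
Proof.
move=> cK KU hK; have clK : closed K by apply: compact_closed => //; exact: norm_hausdorff.
have sub : closure [set x | phi x != 0] `<=` K.
  by rewrite [X in _ `<=` X](closure_id K).1//; exact: closureS.
split; last exact: subset_trans KU.
by apply: (subclosed_compact _ cK sub); exact: closed_closure.
Qed.

Lemma exhaustion_test U n : test_function U (exhaustion U n).
Proof.
have [K [cK KU hK]] := exhaustion_csupp U n.
have [h1 h2] := csupp_closure cK KU hK.
by split=> //; apply: elementary_rVP; exact: exhaustion_elementary.
Qed.

End exhaustion.

(** * Fundamental lemma of the calculus of variations *)

Section fundamental_lemma.
Context {R : realType} {N : nat}.
Let mu := @lebesgue_rV R N.

(** Open sets are stable under intersection, so this form of the sigma-algebra is the one suited to
    Dynkin induction. *)
Lemma measurable_rV_open : (@measurable _ 'rV[R]_N) = <<s [set U : set 'rV[R]_N | open U] >>.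
Proof.
apply/seteqP; split; last first.
  apply: smallest_sub; first exact: sigma_algebra_measurable.
  by move=> U oU; exact: open_measurable_rV.
apply: smallest_sub; first exact: smallest_sigma_algebra.
rewrite -bigcup_seq; apply: bigcup_sub => i _ _ [B mB <-].
have : measurable_fun [set: g_sigma_algebraType [set U : set 'rV[R]_N | open U]]
    (@coord_rV R N i).
  apply: (measurability _ (RGenOpens.measurableE R)).
  move=> _ [_ [a [b ->] <-]]; rewrite setTI; apply: sub_sigma_algebra.
  by apply: open_comp => [x _|]; [exact: coord_continuous|exact: interval_open].
by move/(_ measurableT _ mB).
Qed.

Lemma dominated_convergence_Rintegral d (T : measurableType d) (nu : measure T R) (D : set T)
    (f_ : nat -> T -> R) (f g : T -> R) :
  measurable D -> (forall n, measurable_fun D (f_ n)) -> measurable_fun D f ->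
  (forall x, D x -> f_ n x @[n --> \oo] --> f x) -> nu.-integrable D (EFin \o g) ->
  (forall n x, D x -> `|f_ n x| <= g x) ->
  (\int[nu]_(x in D) f_ n x) @[n --> \oo] --> \int[nu]_(x in D) f x.
Proof.
move=> mD mf_ mf cf ig dom.
have cf' x : D x -> (f_ n x)%:E @[n --> \oo] --> (f x)%:E.
  by move=> Dx; apply: cvg_EFin; [exact: nearW|exact: cf].
have [fi _ h] := @dominated_convergence _ _ _ nu D mD (fun n x => (f_ n x)%:E) (EFin \o f)
  (EFin \o g)
  (fun n => (measurable_EFinP _ _).2 (mf_ n))
  ((measurable_EFinP _ _).2 mf)
  (aeW _ cf') ig
  (aeW _ (fun x n Dx => dom n x Dx)).
apply: fine_cvg; rewrite fineK//.
by have := integrable_fin_num mD fi.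
Qed.

(** On A intersected with an open set, h integrates to zero by dominated convergence along an
    exhaustion of that intersection. The sets E over which h integrates to zero on A and E form a
    Dynkin class, which therefore contains all Borel sets. *)
Lemma fundamental_lemma (A : set 'rV[R]_N) (h : 'rV[R]_N -> R) :
  open A -> mu.-integrable A (EFin \o h) ->
  (forall phi, test_function A phi -> \int[mu]_(x in A) (h x * phi x) = 0) ->
  {ae mu, forall x, A x -> h x = 0}.
Proof.
move=> oA ih hphi; have mA := open_measurable_rV oA.
have open0 (U : set 'rV[R]_N) : open U -> (\int[mu]_(x in A `&` U) (h x)%:E = 0)%E.
  move=> oU; pose V := A `&` U; have oV : open V by exact: openI.
  have mV := open_measurable_rV oV.
  have ihV : mu.-integrable V (EFin \o h) by apply: integrableS ih => //; exact: subIsetl.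
  have mh : measurable_fun V h by apply/measurable_EFinP; exact: (measurable_int _ ihV).
  have c0 : (\int[mu]_(x in V) (h x * exhaustion V n x)) @[n --> \oo] --> \int[mu]_(x in V) h x.
    apply: (dominated_convergence_Rintegral (g := fun x => `|h x|)) => //.
    - move=> n; apply: measurable_funM => //; apply: continuous_measurable_rV => //.
      by have [s _ _] := exhaustion_test V n; exact: smooth_continuous.
    - move=> x Vx; rewrite -[X in _ --> X]mulr1; apply: cvgMr; apply: cvg_near_cst.
      exact: exhaustion_in.
    - exact: (integrable_abse ihV).
    - by move=> n x Vx; rewrite normrM ler_piMr// exhaustion_norm.
  have e0 n : \int[mu]_(x in V) (h x * exhaustion V n x) = 0.
    rewrite -(hphi (exhaustion V n)); last first.
      by apply: test_function_subset (exhaustion_test V n); exact: subIsetl.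
    rewrite /V Rintegral_mkcondr; apply: eq_Rintegral => x _; rewrite patchE.
    case: ifPn => // xU; rewrite exhaustion_out ?mulr0// => -[_ Ux].
    by move: xU; rewrite notin_setE.
  have : \int[mu]_(x in V) h x = 0.
    move: c0; rewrite (_ : (fun n => _) = cst 0); last exact/funext.
    by move=> c0; apply/esym/(cvg_unique _ (@cvg_cst R 0 nat \oo _) c0).
  move=> h0; rewrite -/V -[LHS]fineK; last exact: (integrable_fin_num mV ihV).
  by rewrite -[fine _]/(\int[mu]_(x in V) h x) h0.
have all0 E : measurable E -> (\int[mu]_(x in A `&` E) (h x)%:E = 0)%E.
  move=> mE; have := mE; rewrite measurable_rV_open => sE.
  have A0 : (\int[mu]_(x in A) (h x)%:E = 0)%E by rewrite -(setIT A); apply: open0; exact: openT.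
  apply: (dynkin_induction (P := [set E | (\int[mu]_(x in A `&` E) (h x)%:E = 0)%E])
    measurable_rV_open _ _ _ _ _ sE) => /=.
  - by move=> X Y oX oY; exact: openI.
  - by rewrite setIT.
  - by move=> U oU; exact: open0.
  - move=> S mS S0.
    have : (\int[mu]_(x in (A `&` S) `|` (A `&` ~` S)) (h x)%:E = 0)%E by rewrite -setIUr setUv setIT.
    rewrite integral_setU_EFin//.
    + by rewrite S0 add0e.
    + exact: measurableI.
    + by apply: measurableI => //; exact: measurableC.
    + rewrite -setIUr setUv setIT; apply/measurable_EFinP; exact: (measurable_int _ ih).
    + by apply/disj_setPS => x [[_ Sx] [_ nSx]].
  - move=> F mF tF F0; rewrite setI_bigcupr integral_bigcup.
    + by apply: eseries0 => k _ _; exact: F0.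
    + apply/trivIsetP => i j _ _ ij; move/trivIsetP : tF => /(_ i j Logic.I Logic.I ij) hij.
      by rewrite setIACA hij setI0.
    + by move=> k; exact: measurableI.
    + apply: integrableS ih => //; first by apply: bigcupT_measurable => k; exact: measurableI.
      by apply: bigcup_sub => k _; exact: subIsetl.
have : ae_eq mu A (EFin \o h) (cst 0%E).
  apply: integral_ae_eq => // E EA mE.
  by rewrite integral0 -(setIidr EA); exact: all0.
by apply: filterS => x hx Ax; have /= [] := hx Ax.
Qed.

End fundamental_lemma.

(** * Square integrable functions on a measurable set *)

Section L2_theory.
Context {R : realType} {N : nat}.
Let mu := @lebesgue_rV R N.
Variable A : set 'rV[R]_N.
Hypothesis mA : measurable A.
Implicit Types (u v : 'rV[R]_N -> R).

Lemma ae_eq_Rintegral (f g : 'rV[R]_N -> R) :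
  measurable_fun A f -> measurable_fun A g -> {ae mu, forall x, A x -> f x = g x} ->
  \int[mu]_(x in A) f x = \int[mu]_(x in A) g x.
Proof.
move=> mf mg h; rewrite /Rintegral; congr fine; apply: ae_eq_integral => //.
- exact/measurable_EFinP.
- exact/measurable_EFinP.
- by apply: filterS h => x hx Ax /=; rewrite hx.
Qed.

Lemma le_integrable_real (f g : 'rV[R]_N -> R) : measurable_fun A f ->
  (forall x, A x -> `|f x| <= g x) -> mu.-integrable A (EFin \o g) ->
  mu.-integrable A (EFin \o f).
Proof.
move=> mf fg; apply: le_integrable => //; first exact/measurable_EFinP.
by move=> x Ax; rewrite /= lee_fin (le_trans (fg x Ax))// ler_norm.
Qed.

Lemma L2_mul_integrable u v : L2 A u -> L2 A v -> mu.-integrable A (fun x => (u x * v x)%:E).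
Proof.
move=> [mu1 iu] [mv iv].
apply: (@le_integrable_real _ (fun x => u x ^+ 2 + v x ^+ 2)).
- exact: measurable_funM.
- move=> x _; rewrite normrM -(real_normK (num_real (u x))) -(real_normK (num_real (v x))).
  have := sqr_ge0 (`|u x| - `|v x|); have := normr_ge0 (u x); have := normr_ge0 (v x).
  by move: `|u x| `|v x| => a b; nra.
- rewrite (_ : _ \o _ = (fun x => (u x ^+ 2)%:E) \+ (fun x => (v x ^+ 2)%:E))%E.
    exact: integrableD.
  by apply/funext => x /=; rewrite EFinD.
Qed.

Lemma L2D u v : L2 A u -> L2 A v -> L2 A (fun x => u x + v x).
Proof.
move=> hu hv; have [mu1 iu] := hu; have [mv iv] := hv; split; first exact: measurable_funD.
have iuv := L2_mul_integrable hu hv.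
rewrite (_ : (fun x => _) = ((fun x => (u x ^+ 2)%:E) \+ ((fun x => (v x ^+ 2)%:E) \+
   ((fun x => (u x * v x)%:E) \+ (fun x => (u x * v x)%:E)))))%E.
  by do !apply: integrableD => //.
by apply/funext => x /=; rewrite -!EFinD; congr EFin; ring.
Qed.

Lemma L2Z (c : R) u : L2 A u -> L2 A (fun x => c * u x).
Proof.
move=> [mu1 iu]; split; first exact: measurable_funM.
rewrite (_ : (fun x => _) = (fun x => ((c ^+ 2)%:E * (u x ^+ 2)%:E)%E)).
  exact: integrableZl.
by apply/funext => x /=; rewrite -EFinM exprMn.
Qed.

Lemma L2N u : L2 A u -> L2 A (fun x => - u x).
Proof. by move=> /(L2Z (-1)); under eq_fun do rewrite mulN1r. Qed.

Lemma L2B u v : L2 A u -> L2 A v -> L2 A (fun x => u x - v x).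
Proof. by move=> hu /L2N hv; exact: L2D. Qed.

Lemma L2_mul_bounded u (b : 'rV[R]_N -> R) C : measurable_fun A b ->
  (forall x, A x -> `|b x| <= C) -> L2 A u -> L2 A (fun x => b x * u x).
Proof.
move=> mb hb [mu1 iu]; split; first exact: measurable_funM.
apply: (@le_integrable_real _ (fun x => C ^+ 2 * u x ^+ 2)).
- by apply: measurable_funX; exact: measurable_funM.
- move=> x Ax; rewrite normrX normrM exprMn !real_normK ?num_real//.
  rewrite ler_wpM2r ?sqr_ge0// -[b x ^+ 2]real_normK ?num_real//.
  rewrite lerXn2r ?nnegrE//; last exact: hb.
  exact: le_trans (hb _ Ax).
- rewrite (_ : _ \o _ = (fun x => ((C ^+ 2)%:E * (u x ^+ 2)%:E)%E)).
    exact: integrableZl.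
  by apply/funext => x /=; rewrite -EFinM.
Qed.

(** Measurability of v is a separate assumption: equality almost everywhere with a measurable
    function does not give Borel measurability. *)
Lemma L2_eq u v : measurable_fun A v -> {ae mu, forall x, A x -> u x = v x} ->
  L2 A u -> L2 A v.
Proof.
move=> mv h [mu1 iu]; split=> //.
have mv2 : measurable_fun A (fun x => (v x ^+ 2)%:E).
  by apply/measurable_EFinP; exact: measurable_funX.
have [mu2 iu2] := integrableP _ _ _ iu.
apply/integrableP; split=> //.
suff <- : (\int[mu]_(x in A) `|(u x ^+ 2)%:E| = \int[mu]_(x in A) `|(v x ^+ 2)%:E|)%E by [].
apply: ae_eq_integral => //.
- exact: measurableT_comp.
- exact: measurableT_comp.
- by apply: filterS h => x hx Ax /=; rewrite hx.
Qed.

Lemma L2_eq_in u v : (forall x, A x -> u x = v x) -> L2 A u -> L2 A v.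
Proof.
move=> h hu; apply: (L2_eq _ _ hu); last by apply: aeW => x; exact: h.
by apply: eq_measurable_fun hu.1 => x; rewrite inE => /h.
Qed.

Lemma integrable_addr (f g : 'rV[R]_N -> R) : mu.-integrable A (EFin \o f) ->
  mu.-integrable A (EFin \o g) -> mu.-integrable A (EFin \o (fun x => f x + g x)).
Proof. by move=> hf hg; have := integrableD mA hf hg; apply: eq_integrable. Qed.

Lemma integrable_sumr (I : Type) (s : seq I) (F : I -> 'rV[R]_N -> R) :
  (forall i, mu.-integrable A (EFin \o F i)) ->
  mu.-integrable A (EFin \o (fun x => \sum_(i <- s) F i x)).
Proof.
move=> h; elim: s => [|i s ih].
  by under eq_fun do rewrite big_nil; exact: integrable0.
by under eq_fun do rewrite big_cons; exact: integrable_addr.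
Qed.

Lemma Rintegral_sumr (I : Type) (s : seq I) (F : I -> 'rV[R]_N -> R) :
  (forall i, mu.-integrable A (EFin \o F i)) ->
  \int[mu]_(x in A) (\sum_(i <- s) F i x) = \sum_(i <- s) \int[mu]_(x in A) F i x.
Proof.
move=> h; elim: s => [|i s ih].
  by under eq_Rintegral do rewrite big_nil; rewrite Rintegral_cst// mul0r big_nil.
under eq_Rintegral do rewrite big_cons; rewrite big_cons -ih.
exact: (RintegralD mA (h i) (integrable_sumr s h)).
Qed.

Hypothesis fA : (mu A < +oo)%E.

Lemma L2_bounded u C : measurable_fun A u -> (forall x, A x -> `|u x| <= C) -> L2 A u.
Proof.
move=> mu1 hC; split=> //.
apply: (@bounded_by_integrable R _ _ mu A (fun x => u x ^+ 2) (C ^+ 2)) => //.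
  exact: measurable_funX.
move=> x Ax; rewrite normrX lerXn2r ?nnegrE//; last exact: hC.
exact: le_trans (hC _ Ax).
Qed.

Lemma L2_cst (c : R) : L2 A (fun=> c).
Proof. exact: (@L2_bounded _ `|c|). Qed.

Lemma L2_integrable u : L2 A u -> mu.-integrable A (EFin \o u).
Proof.
move=> hu; have := L2_mul_integrable hu (L2_cst 1).
by under eq_fun do rewrite mulr1.
Qed.

Lemma L2_sqr_eq0 u : L2 A u -> \int[mu]_(x in A) (u x * u x) = 0 ->
  {ae mu, forall x, A x -> u x = 0}.
Proof.
move=> hu h; have iu := L2_mul_integrable hu hu.
have : (\int[mu]_(x in A) `|(u x * u x)%:E| = 0)%E.
  under eq_integral do rewrite gee0_abs ?lee_fin -?expr2 ?sqr_ge0//.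
  under eq_integral do rewrite expr2.
  by rewrite -[LHS]fineK; [rewrite -[fine _]/(\int[mu]_(x in A) (u x * u x)) h
    |exact: (integrable_fin_num mA iu)].
move/(ae_eq_integral_abs mu mA (measurable_int _ iu)).
apply: filterS => x hx Ax; have /= [] := hx Ax.
by move/eqP; rewrite mulf_eq0 => /orP[]/eqP.
Qed.

End L2_theory.

(** * Kernel operators and the nonlocal equation *)
Section product_integrals.
Context {R : realType} {N : nat}.
Let mu := @lebesgue_rV R N.

Lemma continuous_subl (x : 'rV[R]_N) : continuous (fun y : 'rV[R]_N => x - y).
Proof. by move=> y; apply: continuousB; [exact: cst_continuous|move=> ?; exact]. Qed.

Lemma integrable_tensor (a b : 'rV[R]_N -> R) :
  mu.-integrable setT (EFin \o a) -> mu.-integrable setT (EFin \o b) ->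
  (mu \x mu)%E.-integrable setT (fun p => (a p.1 * b p.2)%:E).
Proof.
move=> ia ib.
have ma : measurable_fun setT a by apply/measurable_EFinP; exact: (measurable_int _ ia).
have mb : measurable_fun setT b by apply/measurable_EFinP; exact: (measurable_int _ ib).
have mab : measurable_fun setT (fun p : 'rV[R]_N * 'rV[R]_N => (a p.1 * b p.2)%:E).
  apply/measurable_EFinP; apply: measurable_funM.
    by apply: (measurableT_comp ma); exact: measurable_fst.
  by apply: (measurableT_comp mb); exact: measurable_snd.
apply/(integrable12ltyP mu mu mab).
have nab (c : 'rV[R]_N -> R) : measurable_fun setT c -> measurable_fun setT (fun y => `|(c y)%:E|%E).
  by move=> mc; apply: measurableT_comp => //; exact/measurable_EFinP.
have [_ fa] := integrableP _ _ _ ia; have [_ fb] := integrableP _ _ _ ib.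
have E x : (\int[mu]_y `|(a x * b y)%:E| = `|(a x)%:E| * \int[mu]_y `|(b y)%:E|)%E.
  under eq_integral do rewrite EFinM abseM.
  by rewrite ge0_integralZl//; exact: nab mb.
under eq_integral do rewrite E.
rewrite ge0_integralZr//.
- by rewrite lte_mul_pinfty// ?integral_ge0// ge0_fin_numE ?integral_ge0.
- exact: nab ma.
- by rewrite integral_ge0.
Qed.

Variables (A B : set 'rV[R]_N) (K : 'rV[R]_N -> R).
Hypotheses (mA : measurable A) (bA : bounded_set A) (mB : measurable B) (bB : bounded_set B).
Hypothesis cK : continuous K.
Implicit Types a b : 'rV[R]_N -> R.

(** For bounded A and B the differences x - y stay in a compact box, on which the continuous K is
    bounded. *)
Lemma kernel_bound : exists2 C, 0 <= C & forall x y, A x -> B y -> `|K (x - y)| <= C.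
Proof.
have [M1 _ h1] := bounded_cbox bA; have [M2 _ h2] := bounded_cbox bB.
pose D : set 'rV[R]_N := cbox (const_mx (- (M1 + M2))) (const_mx (M1 + M2)).
have [C C0 hC] := continuous_compact_bound (@compact_cbox _ _ _ _ : compact D) (continuous_subspaceT cK).
exists C => // x y Ax By; apply: hC; apply/const_cboxP => i; rewrite !mxE.
have /const_cboxP/(_ i) ha := h1 _ Ax; have /const_cboxP/(_ i) hb := h2 _ By.
by rewrite (le_trans (ler_normB _ _))// lerD.
Qed.

Lemma measurable_sub_rV : measurable_fun [set: 'rV[R]_N * 'rV[R]_N] (fun p => p.1 - p.2).
Proof.
apply: measurable_fun_rV => i.
rewrite (_ : (fun _ => _) = (fun p : 'rV[R]_N * 'rV[R]_N => (p.1 ord0 i : R) - p.2 ord0 i)).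
  apply: measurable_funB.
    by apply: (measurableT_comp (measurable_coord_rV i)); exact: measurable_fst.
  by apply: (measurableT_comp (measurable_coord_rV i)); exact: measurable_snd.
by apply/funext => p; rewrite !mxE.
Qed.

(** Dominated by a constant times the tensor product of a and b. Extension by zero turns integrals
    over A x B into integrals over the whole product, where Fubini is applied. *)
Lemma kernel_patch_integrable a b :
  mu.-integrable A (EFin \o a) -> mu.-integrable B (EFin \o b) ->
  (mu \x mu)%E.-integrable setT
    (fun p => (K (p.1 - p.2) * ((a \_ A) p.1 * (b \_ B) p.2))%:E).
Proof.
move=> ia ib; have [C C0 hC] := kernel_bound.
have ia' : mu.-integrable setT (EFin \o a \_ A).
  by rewrite -restrict_EFin; apply/(integrable_mkcond _ mA).
have ib' : mu.-integrable setT (EFin \o b \_ B).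
  by rewrite -restrict_EFin; apply/(integrable_mkcond _ mB).
have it := integrable_tensor ia' ib'.
have mt := measurable_int _ it.
apply: (@le_integrable _ _ _ _ setT measurableT _ (fun p => (C%:E * ((a \_ A) p.1 * (b \_ B) p.2)%:E)%E)).
- apply/measurable_EFinP; apply: measurable_funM; last exact/measurable_EFinP.
  by apply: (measurableT_comp (continuous_measurable_rV measurableT cK)); exact: measurable_sub_rV.
- move=> p _; rewrite -EFinM /= lee_fin !normrM (ger0_norm C0).
  rewrite !patchE; case: ifPn => [|_]; last by rewrite normr0 mul0r !mulr0.
  case: ifPn => [|_]; last by rewrite normr0 !mulr0.
  rewrite !inE => By Ax; rewrite ler_wpM2r ?mulr_ge0//; exact: hC.
- exact: integrableZl.
Qed.

(** Convolution-type operator restricted to S. The nonlocal terms of the equations have the form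
    [kop S L b x - kop S L (fun=> 1) x * c] with c a value at the point x. *)
Definition kop (S : set 'rV[R]_N) (L : 'rV[R]_N -> R) b x := \int[mu]_(y in S) (L (x - y) * b y).

Lemma kernel_slice_integrable b x : A x -> mu.-integrable B (EFin \o b) ->
  mu.-integrable B (fun y => (K (x - y) * b y)%:E).
Proof.
move=> Ax ib; have [C C0 hC] := kernel_bound.
apply: (@le_integrable _ _ _ _ B mB _ (fun y => (C%:E * (b y)%:E)%E)).
- apply/measurable_EFinP; apply: measurable_funM; last by apply/measurable_EFinP; exact: (measurable_int _ ib).
  apply: continuous_measurable_rV => // y; apply: continuous_comp; last exact: cK.
  exact: continuous_subl.
- move=> y By; rewrite /= lee_fin !normrM (ger0_norm C0).
  by rewrite ler_wpM2r// hC.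
- exact: integrableZl.
Qed.

Lemma kernel_inner a b x : mu.-integrable B (EFin \o b) ->
  (\int[mu]_y (K (x - y) * ((a \_ A) x * (b \_ B) y))%:E)%E =
  ((fun x => a x * kop B K b x) \_ A x)%:E.
Proof.
move=> ib; rewrite !patchE; case: ifPn => [|xA]; last first.
  by apply: integral0_eq => y _; rewrite mul0r mulr0.
rewrite inE => Ax; have ik := kernel_slice_integrable Ax ib.
rewrite /kop /Rintegral.
have -> : (fun y => (K (x - y) * (a x * (b \_ B) y))%:E) =
    (fun y => (a x)%:E * (K (x - y) * b y)%:E)%E \_ B.
  apply/funext => y; rewrite !patchE; case: ifP => _; last by rewrite !mulr0.
  by rewrite -EFinM mulrCA.
rewrite -integral_mkcond integralZl// EFinM fineK//.
exact: (integrable_fin_num mB ik).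
Qed.

Lemma kop_fubini a b : mu.-integrable A (EFin \o a) -> mu.-integrable B (EFin \o b) ->
  \int[(mu \x mu)%E]_(p in A `*` B) (K (p.1 - p.2) * (a p.1 * b p.2)) =
  \int[mu]_(x in A) (a x * kop B K b x).
Proof.
move=> ia ib; rewrite /Rintegral; congr fine.
rewrite integral_mkcond [in RHS]integral_mkcond.
have -> : (fun p : 'rV[R]_N * 'rV[R]_N => (K (p.1 - p.2) * (a p.1 * b p.2))%:E) \_ (A `*` B) =
    (fun p => (K (p.1 - p.2) * ((a \_ A) p.1 * (b \_ B) p.2))%:E).
  apply/funext => p; rewrite !patchE in_setX.
  by case: ifP => //=; [move=> /andP[-> ->]|case: (p.1 \in A); case: (p.2 \in B);
    rewrite ?mul0r ?mulr0].
rewrite integral_fubini1; last exact: kernel_patch_integrable.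
apply: eq_integral => x _ /=; rewrite kernel_inner// patchE [in RHS]patchE.
by case: ifP.
Qed.

Lemma kernel_integrable a b : mu.-integrable A (EFin \o a) -> mu.-integrable B (EFin \o b) ->
  (mu \x mu)%E.-integrable (A `*` B) (EFin \o (fun p => K (p.1 - p.2) * (a p.1 * b p.2))).
Proof.
move=> ia ib; apply/(integrable_mkcond _ (measurableX mA mB)).
apply: eq_integrable (kernel_patch_integrable ia ib) => // p _; rewrite !patchE in_setX.
by case: (p.1 \in A); case: (p.2 \in B); rewrite /= ?mul0r ?mulr0.
Qed.

(** The inner integral of Fubini's theorem is measurable; it is taken with a = 1 on A. *)
Lemma kop_measurable b : mu.-integrable B (EFin \o b) -> measurable_fun A (kop B K b).
Proof.
move=> ib.
have i1 : mu.-integrable A (EFin \o cst (1 : R)).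
  apply: (bounded_by_integrable (C := 1)) => //; first exact: bounded_mu_fin.
  by move=> x _ /=; rewrite normr1.
have := measurable_fubini_F (kernel_patch_integrable i1 ib).
rewrite (_ : fubini_F _ _ = EFin \o (fun x => cst 1 x * kop B K b x) \_ A); last first.
  by apply/funext => x; rewrite /fubini_F /= kernel_inner.
move/measurable_EFinP => /(measurable_restrictT _ mA).
by apply: eq_measurable_fun => x _; rewrite mul1r.
Qed.

Lemma kop_bounded b : mu.-integrable B (EFin \o b) ->
  exists C, forall x, A x -> `|kop B K b x| <= C.
Proof.
move=> ib; have [C C0 hC] := kernel_bound.
exists (C * \int[mu]_(y in B) `|b y|) => x Ax.
have ik := kernel_slice_integrable Ax ib.
apply: (le_trans (le_normr_Rintegral mB ik)).
rewrite -RintegralZl//; last exact: (integrable_abse ib).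
apply: le_Rintegral => //.
- exact: (integrable_abse ik).
- have := integrableZl mB C (integrable_abse ib).
  by under eq_fun do rewrite /= -EFinM.
- by move=> y By; rewrite normrM ler_wpM2r// hC.
Qed.

Lemma kop_L2 b : mu.-integrable B (EFin \o b) -> L2 A (kop B K b).
Proof.
move=> ib; have [C hC] := kop_bounded ib.
by apply: (L2_bounded mA _ (kop_measurable ib) hC); exact: bounded_mu_fin.
Qed.

Lemma kopD b b' x (e : R) : A x -> mu.-integrable B (EFin \o b) -> mu.-integrable B (EFin \o b') ->
  kop B K (fun y => b y + e * b' y) x = kop B K b x + e * kop B K b' x.
Proof.
move=> Ax ib ib'; rewrite /kop -RintegralZl//; last exact: kernel_slice_integrable.
rewrite -RintegralD//.
- by apply: eq_Rintegral => y _; ring.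
- exact: kernel_slice_integrable.
- have := integrableZl mB e (kernel_slice_integrable Ax ib').
  by under eq_fun do rewrite /= -EFinM.
Qed.

End product_integrals.

(** * Adjoints of kernel operators *)

Section symmetric_kernels.
Context {R : realType} {N : nat}.
Let mu := @lebesgue_rV R N.
Variables (A B : set 'rV[R]_N) (K : 'rV[R]_N -> R).
Hypotheses (mA : measurable A) (bA : bounded_set A) (mB : measurable B) (bB : bounded_set B).
Hypothesis cK : continuous K.
Implicit Types a b : 'rV[R]_N -> R.

Lemma continuous_reflect : continuous (fun z : 'rV[R]_N => K (- z)).
Proof.
have -> : (fun z : 'rV[R]_N => K (- z)) = (fun z => K (0 - z)) by apply/funext => z; rewrite sub0r.
by move=> z; apply: continuous_comp; [exact: continuous_subl|exact: cK].
Qed.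

Lemma kop_fubini2 a b : mu.-integrable A (EFin \o a) -> mu.-integrable B (EFin \o b) ->
  \int[(mu \x mu)%E]_(p in A `*` B) (K (p.1 - p.2) * (a p.1 * b p.2)) =
  \int[mu]_(y in B) (b y * kop A (fun z => K (- z)) a y).
Proof.
move=> ia ib; rewrite /Rintegral; congr fine.
rewrite integral_mkcond [in RHS]integral_mkcond.
have -> : (fun p : 'rV[R]_N * 'rV[R]_N => (K (p.1 - p.2) * (a p.1 * b p.2))%:E) \_ (A `*` B) =
    (fun p => (K (p.1 - p.2) * ((a \_ A) p.1 * (b \_ B) p.2))%:E).
  apply/funext => p; rewrite !patchE in_setX.
  by case: (p.1 \in A); case: (p.2 \in B); rewrite /= ?mul0r ?mulr0.
rewrite integral_fubini2; last exact: kernel_patch_integrable.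
apply: eq_integral => y _ /=.
(* Since x - y = - (y - x), integrating in x first produces the reflected kernel. *)
under eq_integral do rewrite -opprB [X in _ * X]mulrC.
rewrite (kernel_inner bB mA bA continuous_reflect)// patchE [in RHS]patchE.
by case: ifP.
Qed.

(** Kept for kernels without symmetry, because the mollifiers below are supported on one side of the
    origin. *)
Lemma kop_adjoint a b : mu.-integrable A (EFin \o a) -> mu.-integrable B (EFin \o b) ->
  \int[mu]_(x in A) (a x * kop B K b x) =
  \int[mu]_(y in B) (b y * kop A (fun z => K (- z)) a y).
Proof. by move=> ia ib; rewrite -kop_fubini// kop_fubini2. Qed.

Hypothesis eK : forall z, K (- z) = K z.

Lemma kop_sym a b : mu.-integrable A (EFin \o a) -> mu.-integrable B (EFin \o b) ->
  \int[mu]_(x in A) (a x * kop B K b x) = \int[mu]_(y in B) (b y * kop A K a y).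
Proof.
move=> ia ib; rewrite (kop_adjoint ia ib).
by have -> : (fun z : 'rV[R]_N => K (- z)) = K by exact/funext.
Qed.

End symmetric_kernels.

(** * Expansion of quadratic functionals along lines *)

Section bilinear.
Context {R : realType} {N : nat}.
Let mu := @lebesgue_rV R N.
Variables (S : set 'rV[R]_N).
Hypothesis mS : measurable S.
Implicit Types f g h : 'rV[R]_N -> R.

Lemma Rintegral_L2_lin f g h (e : R) : L2 S f -> L2 S g -> L2 S h ->
  \int[mu]_(x in S) ((f x + e * g x) * h x) =
  \int[mu]_(x in S) (f x * h x) + e * \int[mu]_(x in S) (g x * h x).
Proof.
move=> hf hg hh; have ifh := L2_mul_integrable mS hf hh; have igh := L2_mul_integrable mS hg hh.
rewrite -RintegralZl// -RintegralD//.
  by apply: eq_Rintegral => x _; ring.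
have := integrableZl mS e igh.
by under eq_fun do rewrite -EFinM.
Qed.

Lemma Rintegral_L2_lin2 f g h (e : R) : L2 S f -> L2 S g -> L2 S h ->
  \int[mu]_(x in S) (h x * (f x + e * g x)) =
  \int[mu]_(x in S) (h x * f x) + e * \int[mu]_(x in S) (h x * g x).
Proof.
move=> hf hg hh; under eq_Rintegral do rewrite mulrC.
rewrite Rintegral_L2_lin//; congr (_ + _ * _);
  by apply: eq_Rintegral => x _; rewrite mulrC.
Qed.

Lemma Rintegral_lin3 d (T : measurableType d) (nu : measure T R) (D : set T)
    (f1 f2 f3 : T -> R) (c2 c3 : R) : measurable D ->
  nu.-integrable D (EFin \o f1) -> nu.-integrable D (EFin \o f2) ->
  nu.-integrable D (EFin \o f3) ->
  \int[nu]_(x in D) (f1 x + c2 * f2 x + c3 * f3 x) =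
  \int[nu]_(x in D) f1 x + c2 * \int[nu]_(x in D) f2 x + c3 * \int[nu]_(x in D) f3 x.
Proof.
move=> mD i1 i2 i3.
have j (c : R) (f : T -> R) : nu.-integrable D (EFin \o f) -> nu.-integrable D (EFin \o (fun x => c * f x)).
  by move=> h; have := integrableZl mD c h; under eq_fun do rewrite /= -EFinM.
have k : nu.-integrable D (EFin \o (fun x => f1 x + c2 * f2 x)).
  have := integrableD mD i1 (j c2 _ i2); apply: eq_integrable => // x _ /=.
rewrite (RintegralD mD k (j c3 _ i3)) (RintegralD mD i1 (j c2 _ i2)).
by rewrite (RintegralZl c2 mD i2) (RintegralZl c3 mD i3).
Qed.

(** Both functionals restrict to quadratic polynomials in e on every admissible line; the first
    variation is the linear coefficient. *)
Lemma is_derive_quadratic (c0 c1 c2 : R) :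
  is_derive (0 : R) (1 : R) (fun e : R => c0 + e * c1 + e ^+ 2 * c2) c1.
Proof.
have h := is_deriveD (is_deriveD (is_derive_cst c0 (0 : R) (1 : R))
  (is_deriveM (is_derive_id (0 : R) (1 : R)) (is_derive_cst c1 (0 : R) (1 : R))))
  (is_deriveM (is_deriveX 2 (is_derive_id (0 : R) (1 : R))) (is_derive_cst c2 (0 : R) (1 : R))).
apply: (is_derive_eq h); rewrite /GRing.scale /= /cst !mul0r !mulr0 !mul0r !mulr0.
by rewrite !add0r !addr0 mulr1.
Qed.

(** The symmetric operator for which F(v) = 1/2 <v, op v> - <v, J u> + c(u); [op v - kop A J u] is
    the residual of the nonlocal equation up to sign. *)
Definition nonlocal_op (A B : set 'rV[R]_N) (J G v : 'rV[R]_N -> R) (x : 'rV[R]_N) : R :=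
  (kop B G (fun=> 1) x + kop A J (fun=> 1) x) * v x - kop B G v x.

End bilinear.

(** * The functional F, its minimizers and its Euler-Lagrange equation *)

Section nonlocal_part.
Context {R : realType} {N : nat}.
Let mu := @lebesgue_rV R N.
Variables (A B : set 'rV[R]_N) (J G : 'rV[R]_N -> R).
Hypotheses (mA : measurable A) (bA : bounded_set A) (mB : measurable B) (bB : bounded_set B).
Hypotheses (cJ : continuous J) (eJ : forall z, J (- z) = J z) (J0 : forall z, 0 <= J z).
Hypotheses (cG : continuous G) (eG : forall z, G (- z) = G z) (G0 : forall z, 0 <= G z).
Implicit Types u v w : 'rV[R]_N -> R.

Let fA : (mu A < +oo)%E. Proof. exact: bounded_mu_fin. Qed.
Let fB : (mu B < +oo)%E. Proof. exact: bounded_mu_fin. Qed.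
Local Notation one := (fun=> 1).
Let oneA : mu.-integrable A (EFin \o (fun=> 1)). Proof. exact: (L2_integrable mA fA (L2_cst mA fA 1)). Qed.
Let oneB : mu.-integrable B (EFin \o (fun=> 1)). Proof. exact: (L2_integrable mB fB (L2_cst mB fB 1)). Qed.

Local Notation m x := (kop B G one x + kop A J one x).
Local Notation op := (nonlocal_op A B J G).

Let L2I v : L2 B v -> mu.-integrable B (EFin \o v). Proof. exact: L2_integrable. Qed.
Let L2IA v : L2 A v -> mu.-integrable A (EFin \o v). Proof. exact: L2_integrable. Qed.
Let L2sqI (S : set 'rV[R]_N) v : measurable S -> L2 S v -> mu.-integrable S (EFin \o (fun x => v x * v x)).
Proof. by move=> mS h; exact: L2_mul_integrable. Qed.

Let op_L2 v : L2 B v -> L2 B (op v).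
Proof.
move=> hv; have [C1 h1] := kop_bounded bB mB bB cG oneB.
have [C2 h2] := kop_bounded bB mA bA cJ oneA.
apply: L2B => //; last exact: kop_L2 (L2I hv).
apply: (@L2_mul_bounded _ _ _ mB _ _ (C1 + C2)) => //.
  by apply: measurable_funD; [exact: (kop_measurable mB bB mB bB cG oneB)
    |exact: (kop_measurable mB bB mA bA cJ oneA)].
by move=> x Bx; rewrite (le_trans (ler_normD _ _))// lerD// ?h1 ?h2.
Qed.

Let op_lin v w (e : R) x : B x -> L2 B v -> L2 B w ->
  op (fun y => v y + e * w y) x = op v x + e * op w x.
Proof.
move=> Bx hv hw; rewrite /nonlocal_op (kopD bB mB bB cG)//; [ring|exact: L2I|exact: L2I].
Qed.

Let op_sym v w : L2 B v -> L2 B w ->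
  \int[mu]_(x in B) (v x * op w x) = \int[mu]_(x in B) (w x * op v x).
Proof.
have mL2 u : L2 B u -> L2 B (fun x => m x * u x).
  move=> hu; have h1 := op_L2 hu.
  apply: (L2_eq_in mB _ (L2D mB h1 (kop_L2 mB bB mB bB cG (L2I hu)))) => x _.
  by rewrite /nonlocal_op subrK.
have E v' w' : L2 B v' -> L2 B w' -> \int[mu]_(x in B) (v' x * op w' x) =
    \int[mu]_(x in B) (v' x * (m x * w' x)) + (-1) * \int[mu]_(x in B) (v' x * kop B G w' x).
  move=> hv hw; rewrite -Rintegral_L2_lin2//; first by apply: eq_Rintegral => x _; rewrite mulN1r.
  - exact: mL2.
  - exact: kop_L2 (L2I hw).
move=> hv hw; rewrite (E v w hv hw) (E w v hw hv).
rewrite (kop_sym mB bB mB bB cG eG (L2I hv) (L2I hw)).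
have -> // : \int[mu]_(x in B) (v x * (m x * w x)) = \int[mu]_(x in B) (w x * (m x * v x)).
by apply: eq_Rintegral => x _; rewrite mulrCA [RHS]mulrCA (mulrC (v x)).
Qed.

Local Notation const u := ( 2^-1 * \int[mu]_(x in A) (u x * u x * kop B J one x)).

Let sq_kop_integrable (S T : set 'rV[R]_N) L v : measurable S -> bounded_set S ->
  measurable T -> bounded_set T -> continuous L -> L2 S v ->
  mu.-integrable T (EFin \o (fun=> 1)) ->
  mu.-integrable S (EFin \o (fun x => v x * v x * kop T L (fun=> 1) x)).
Proof.
move=> mS bS mT bT cL hv i1; have [C hC] := kop_bounded bS mT bT cL i1.
have := L2_mul_integrable mS hv (L2_mul_bounded mS (kop_measurable mS bS mT bT cL i1) hC hv).
by apply: eq_integrable => // x _ /=; rewrite -mulrA (mulrC (v x) (kop _ _ _ _)).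
Qed.

(** Both squares are expanded. As G is even, the terms in v(x)^2 and v(y)^2 contribute equally,
    which turns the factor 1/4 into 1/2; the last term depends on u only. *)
Lemma nonlocal_energyE u v : L2 A u -> L2 B v ->
  nonlocal_energy A B J G u v = 2^-1 * \int[mu]_(x in B) (v x * op v x)
    - \int[mu]_(x in B) (v x * kop A J u x) + const u.
Proof.
move=> hu hv; have iv := L2I hv; have iu := L2IA hu.
have ivv := L2sqI mB hv; have iuu := L2sqI mA hu.
have mBB : measurable (B `*` B) by exact: measurableX.
have T1 : \int[(mu \x mu)%E]_(p in B `*` B) (G (p.1 - p.2) * (v p.2 - v p.1) ^+ 2) =
    2 * \int[mu]_(x in B) (v x * v x * kop B G one x) - 2 * \int[mu]_(x in B) (v x * kop B G v x).
  have i1 := kernel_integrable mB bB mB bB cG ivv oneB.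
  have i2 := kernel_integrable mB bB mB bB cG oneB ivv.
  have i3 := kernel_integrable mB bB mB bB cG iv iv.
  have e : {in B `*` B, (fun p : 'rV[R]_N * 'rV[R]_N => G (p.1 - p.2) * (v p.2 - v p.1) ^+ 2) =1
      (fun p => G (p.1 - p.2) * (v p.1 * v p.1 * 1) + 1 * (G (p.1 - p.2) * (1 * (v p.2 * v p.2)))
        + (- 2) * (G (p.1 - p.2) * (v p.1 * v p.2)))}.
    by move=> p _ /=; move: (G _) (v p.1) (v p.2) => x y z; ring.
  rewrite (eq_Rintegral _ e) (Rintegral_lin3 1 (- 2) mBB i1 i2 i3).
  rewrite (kop_fubini mB bB mB bB cG ivv oneB) (kop_fubini mB bB mB bB cG iv iv).
  rewrite (kop_fubini mB bB mB bB cG oneB ivv) (kop_sym mB bB mB bB cG eG oneB ivv).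
  move: (\int[_]_(_ in _) _) (\int[_]_(_ in _) _) => x y; ring.
have T2 : \int[mu]_(x in A) \int[mu]_(y in B) (J (x - y) * (v y - u x) ^+ 2) =
    \int[mu]_(x in B) (v x * v x * kop A J one x) - 2 * \int[mu]_(x in B) (v x * kop A J u x)
    + \int[mu]_(x in A) (u x * u x * kop B J one x).
  have e : {in A, (fun x => \int[mu]_(y in B) (J (x - y) * (v y - u x) ^+ 2)) =1
      (fun x => 1 * kop B J (fun y => v y * v y) x + (- 2) * (u x * kop B J v x)
        + 1 * (u x * u x * kop B J one x))}.
    move=> x; rewrite inE => Ax.
    have i1 := kernel_slice_integrable bA mB bB cJ Ax ivv.
    have i2 := kernel_slice_integrable bA mB bB cJ Ax iv.
    have i3 := kernel_slice_integrable bA mB bB cJ Ax oneB.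
    have e : {in B, (fun y => J (x - y) * (v y - u x) ^+ 2) =1
       (fun y => J (x - y) * (v y * v y) + (- 2 * u x) * (J (x - y) * v y)
          + (u x * u x) * (J (x - y) * 1))}.
      by move=> y _ /=; move: (J _) (v y) (u x) => a b c; ring.
    rewrite (eq_Rintegral _ e) (Rintegral_lin3 _ _ mB i1 i2 i3).
    by rewrite /kop !mul1r mulrA.
  have j1 : mu.-integrable A (EFin \o (fun x => 1 * kop B J (fun y => v y * v y) x)).
    exact: (L2_mul_integrable mA (L2_cst mA fA 1) (kop_L2 mA bA mB bB cJ ivv)).
  have j2 : mu.-integrable A (EFin \o (fun x => u x * kop B J v x)).
    exact: (L2_mul_integrable mA hu (kop_L2 mA bA mB bB cJ iv)).
  have j3 := sq_kop_integrable mA bA mB bB cJ hu oneB.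
  rewrite (eq_Rintegral _ e) (Rintegral_lin3 _ _ mA j1 j2 j3) mul1r mulNr.
  by rewrite (kop_sym mA bA mB bB cJ eJ oneA ivv) (kop_sym mA bA mB bB cJ eJ iu iv).
have T3 : \int[mu]_(x in B) (v x * op v x) = \int[mu]_(x in B) (v x * v x * kop B G one x)
   + \int[mu]_(x in B) (v x * v x * kop A J one x) - \int[mu]_(x in B) (v x * kop B G v x).
  have j1 := sq_kop_integrable mB bB mB bB cG hv oneB.
  have j2 := sq_kop_integrable mB bB mA bA cJ hv oneA.
  have j3 : mu.-integrable B (EFin \o (fun x => v x * kop B G v x)).
    exact: (L2_mul_integrable mB hv (kop_L2 mB bB mB bB cG iv)).
  have := Rintegral_lin3 1 (- 1) mB j1 j2 j3; rewrite mul1r mulN1r => <-.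
  by apply: eq_Rintegral => x _; rewrite /nonlocal_op; ring.
rewrite /nonlocal_energy T1 T2 T3; move: (\int[_]_(_ in _) _) (\int[_]_(_ in _) _).
by move: (\int[_]_(_ in _) _) (\int[_]_(_ in _) _) (\int[_]_(_ in _) _) => a b c d e; field.
Qed.

(** The coefficient of e^2 is the functional itself taken at u = 0, hence nonnegative: this
    convexity makes critical points minimizers. *)
Lemma nonlocal_energy_quadratic u v w (e : R) : L2 A u -> L2 B v -> L2 B w ->
  nonlocal_energy A B J G u (fun x => v x + e * w x) = nonlocal_energy A B J G u v
    + e * \int[mu]_(x in B) (w x * (op v x - kop A J u x))
    + e ^+ 2 * nonlocal_energy A B J G (fun=> 0) w.
Proof.
move=> hu hv hw; have hvw : L2 B (fun x => v x + e * w x) by apply: L2D => //; exact: L2Z.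
have h0 : L2 A (fun=> 0) by exact: L2_cst.
have k0 x : kop A J (fun=> 0) x = 0.
  rewrite /kop; under eq_Rintegral do rewrite mulr0.
  by rewrite Rintegral_cst// mul0r.
have c0 : const (fun=> 0) = 0.
  under eq_Rintegral do rewrite !mul0r.
  by rewrite Rintegral_cst// mul0r mulr0.
have hk : L2 B (kop A J u) by apply: kop_L2 => //; exact: L2IA.
have hov := op_L2 hv; have how := op_L2 hw.
rewrite (nonlocal_energyE hu hvw) (nonlocal_energyE hu hv) (nonlocal_energyE h0 hw) c0 addr0.
have E1 : \int[mu]_(x in B) ((v x + e * w x) * op (fun y => v y + e * w y) x) =
    \int[mu]_(x in B) (v x * op v x) + 2 * e * \int[mu]_(x in B) (w x * op v x) +
    e ^+ 2 * \int[mu]_(x in B) (w x * op w x).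
  have e1 : {in B, (fun x => (v x + e * w x) * op (fun y => v y + e * w y) x) =1
      (fun x => (v x + e * w x) * (op v x + e * op w x))}.
    by move=> x; rewrite inE => Bx; rewrite (op_lin e Bx hv hw).
  rewrite (eq_Rintegral _ e1).
  rewrite (Rintegral_L2_lin2 mB e hov how hvw) (Rintegral_L2_lin mB e hv hw hov).
  rewrite (Rintegral_L2_lin mB e hv hw how) (op_sym hv hw).
  by move: (\int[_]_(_ in _) _) (\int[_]_(_ in _) _) (\int[_]_(_ in _) _) => x y z; ring.
have E2 : \int[mu]_(x in B) (w x * (op v x - kop A J u x)) =
    \int[mu]_(x in B) (w x * op v x) + (-1) * \int[mu]_(x in B) (w x * kop A J u x).
  rewrite -(Rintegral_L2_lin2 mB (-1) hov hk hw).
  by apply: eq_Rintegral => x _; rewrite mulN1r.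
rewrite E1 E2 (Rintegral_L2_lin mB e hv hw hk).
have -> : \int[mu]_(x in B) (w x * kop A J (fun=> 0) x) = 0.
  under eq_Rintegral do rewrite k0 mulr0.
  by rewrite Rintegral_cst// mul0r.
move: (\int[_]_(_ in _) _) (\int[_]_(_ in _) _) (\int[_]_(_ in _) _).
move: (\int[_]_(_ in _) _) (\int[_]_(_ in _) _) (\int[_]_(_ in _) _) => a b c d f g.
by field.
Qed.

Lemma nonlocal_energy_ge0 u v : 0 <= nonlocal_energy A B J G u v.
Proof.
rewrite addr_ge0// mulr_ge0// ?invr_ge0// Rintegral_ge0// => x _.
  by rewrite mulr_ge0 ?sqr_ge0.
by rewrite Rintegral_ge0// => y _; rewrite mulr_ge0 ?sqr_ge0.
Qed.

Lemma nonlocal_equationE u v : L2 A u -> L2 B v -> nonlocal_equation A B J G u v <->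
  {ae mu, forall x, B x -> op v x - kop A J u x = 0}.
Proof.
move=> hu hv; have E x : B x ->
    \int[mu]_(y in B) (G (x - y) * (v y - v x)) + \int[mu]_(y in A) (J (x - y) * (u y - v x)) =
    - (op v x - kop A J u x).
  move=> Bx.
  have -> : \int[mu]_(y in B) (G (x - y) * (v y - v x)) = kop B G (fun y => v y + (- v x) * 1) x.
    by apply: eq_Rintegral => y _; rewrite mulr1.
  have -> : \int[mu]_(y in A) (J (x - y) * (u y - v x)) = kop A J (fun y => u y + (- v x) * 1) x.
    by apply: eq_Rintegral => y _; rewrite mulr1.
  rewrite (kopD bB mB bB cG)//; last exact: L2I.
  rewrite (kopD bB mA bA cJ)//; last exact: L2IA.
  by rewrite /nonlocal_op; ring.
split; apply: filterS => x hx Bx; have := hx Bx; rewrite E//.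
  by move/esym/eqP; rewrite oppr_eq0 => /eqP.
by move=> ->; rewrite oppr0.
Qed.

Let residual_L2 u v : L2 A u -> L2 B v -> L2 B (fun x => op v x - kop A J u x).
Proof. by move=> hu hv; apply: L2B => //; [exact: op_L2|apply: kop_L2 => //; exact: L2IA]. Qed.

Let derive_nonlocal u v w : L2 A u -> L2 B v -> L2 B w ->
  is_derive (0 : R) (1 : R) (fun e : R => nonlocal_energy A B J G u (fun x => v x + e * w x))
    (\int[mu]_(x in B) (w x * (op v x - kop A J u x))).
Proof.
move=> hu hv hw.
rewrite (_ : (fun e : R => _) = (fun e => nonlocal_energy A B J G u v
    + e * \int[mu]_(x in B) (w x * (op v x - kop A J u x))
    + e ^+ 2 * nonlocal_energy A B J G (fun=> 0) w)); first exact: is_derive_quadratic.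
by apply/funext => e; rewrite (nonlocal_energy_quadratic e hu hv hw).
Qed.

Lemma first_variation_nonlocal u v : L2 A u -> L2 B v ->
  first_variation B (EFin \o nonlocal_energy A B J G u) v (cst 0) <-> nonlocal_equation A B J G u v.
Proof.
move=> hu hv; have hr := residual_L2 hu hv; split.
- move=> [_ _ _ h]; apply/(nonlocal_equationE hu hv).
  (* The residual r is itself an admissible direction, and the derivative of F along it is its
     squared norm. *)
  apply: (L2_sqr_eq0 mB hr); set r := fun x => op v x - kop A J u x in hr *.
  have h1 : is_derive (0 : R) (1 : R)
      (fun e : R => nonlocal_energy A B J G u (fun x => v x + e * r x))
      (\int[mu]_(x in B) (cst 0 x * r x)).
    by apply: (h _ hr); near=> e.
  rewrite -[LHS](@derive_val _ _ _ _ _ _ _ (derive_nonlocal hu hv hr)).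
  rewrite (@derive_val _ _ _ _ _ _ _ h1).
  by under eq_Rintegral do rewrite /= mul0r; rewrite Rintegral_cst// mul0r.
- move/(nonlocal_equationE hu hv) => h; split; [exact: hv|exact: L2_cst|by []|].
  move=> phi hphi _ /=.
  have -> : \int[mu]_(x in B) (cst 0 x * phi x) =
      \int[mu]_(x in B) (phi x * (op v x - kop A J u x)).
    apply: (ae_eq_Rintegral mB).
    + by apply: measurable_funM; [exact: measurable_cst|exact: hphi.1].
    + by apply: measurable_funM; [exact: hphi.1|exact: hr.1].
    + by apply: filterS h => x hx Bx; rewrite hx// mulr0 mul0r.
  exact: derive_nonlocal.
Unshelve. all: by end_near. Qed.

Lemma minimizer_nonlocal u v : L2 A u -> L2 B v ->
  minimizer B (nonlocal_energy A B J G u) v <-> nonlocal_equation A B J G u v.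
Proof.
move=> hu hv; have hr := residual_L2 hu hv; split.
- move=> [_ h]; apply/(nonlocal_equationE hu hv); apply: (L2_sqr_eq0 mB hr).
  set r := fun x => op v x - kop A J u x in hr *.
  set c1 := \int[mu]_(x in B) _; set c2 := nonlocal_energy A B J G (fun=> 0) r.
  have c10 : 0 <= c1 by apply: Rintegral_ge0 => x _; rewrite -expr2 sqr_ge0.
  have c20 : 0 <= c2 by exact: nonlocal_energy_ge0.
  have hq (e : R) : 0 <= e * c1 + e ^+ 2 * c2.
    have : L2 B (fun x => v x + e * r x) by apply: L2D => //; exact: L2Z.
    by move=> /h; rewrite (nonlocal_energy_quadratic e hu hv hr) -addrA lerDl.
  apply/eqP; rewrite eq_le c10 andbT leNgt; apply/negP => c1p.
  have := hq (- (c1 / (2 * (c1 + c2)))).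
  have c12 : 0 < c1 + c2 by rewrite ltr_wpDr.
  have -> : - (c1 / (2 * (c1 + c2))) * c1 + (- (c1 / (2 * (c1 + c2)))) ^+ 2 * c2 =
    - (c1 ^+ 2 * (2 * c1 + c2) / (2 * (c1 + c2)) ^+ 2).
    by field; rewrite gt_eqF.
  rewrite oppr_ge0 leNgt => /negP; apply.
  by rewrite divr_gt0// ?mulr_gt0 ?exprn_gt0// ?mulr_gt0// ltr_wpDr// mulr_gt0.
- move/(nonlocal_equationE hu hv) => h; split; first exact: hv.
  move=> w hw; have hd : L2 B (fun x => w x - v x) by exact: L2B.
  (* With e = 1 the expansion is exact: F(w) - F(v) is the linear term, which vanishes, plus a
     nonnegative energy of w - v. *)
  have -> : w = (fun x => v x + 1 * (w x - v x)) by apply/funext => x; ring.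
  rewrite (nonlocal_energy_quadratic 1 hu hv hd).
  have -> : \int[mu]_(x in B) ((w x - v x) * (op v x - kop A J u x)) = \int[mu]_(x in B) cst 0 x.
    apply: (ae_eq_Rintegral mB); last 1 first.
    + by apply: filterS h => x hx Bx; rewrite hx// mulr0.
    + by apply: measurable_funM; [exact: hd.1|exact: hr.1].
    + exact: measurable_cst.
  rewrite Rintegral_cst// mul0r mulr0 addr0 lerDl mulr_ge0 ?sqr_ge0//.
  exact: nonlocal_energy_ge0.
Qed.

End nonlocal_part.

(** * Weak gradients and the gradient flow *)
Section C1_functions.
Context {R : realType} {N : nat}.
Let mu := @lebesgue_rV R N.
Implicit Types (A K : set 'rV[R]_N) (f g : 'rV[R]_N -> R).

(** Only points of A are constrained: outside A the functions at hand carry arbitrary values. *)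
Definition C1_on A f := forall x, A x ->
  differentiable f x /\ forall i, {for x, continuous (partial i f)}.

Definition csupp_in A f :=
  exists K, [/\ compact K, K `<=` A & forall x, ~ K x -> f x = 0].

Lemma compact_closed_rV K : compact K -> closed K.
Proof. by apply: compact_closed; exact: norm_hausdorff. Qed.

Lemma near_off_compact K x : compact K -> ~ K x -> \forall y \near x, ~ K y.
Proof.
move=> /compact_closed_rV cK Kx; have oK : open (~` K) by exact: closed_openC.
by have := open_nbhs_nbhs (conj oK Kx).
Qed.

Lemma csupp_partial_out K f i x : compact K -> (forall y, ~ K y -> f y = 0) -> ~ K x ->
  is_derive x (delta_mx ord0 i) f 0.
Proof.
move=> cK f0 Kx; apply: (@near_eq_is_derive _ _ _ (cst (0 : R))).
by apply: filterS (near_off_compact cK Kx) => y /f0 ->.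
Qed.

Lemma csupp_partial0 K f i x : compact K -> (forall y, ~ K y -> f y = 0) -> ~ K x ->
  partial i f x = 0.
Proof. by move=> cK f0 Kx; have h := csupp_partial_out i cK f0 Kx; rewrite /partial derive_val. Qed.

Lemma csupp_in_partial A f i : csupp_in A f -> csupp_in A (partial i f).
Proof. by move=> [K [cK KA f0]]; exists K; split=> // x; exact: csupp_partial0. Qed.

Lemma csupp_inM A f g : csupp_in A f -> csupp_in A (fun x => f x * g x).
Proof. by move=> [K [cK KA f0]]; exists K; split=> // x /f0 ->; rewrite mul0r. Qed.

Lemma test_functionP A f : test_function A f <-> smooth f /\ csupp_in A f.
Proof.
split=> [[sf cf fA]|[sf [K [cK KA f0]]]].
  split=> //; exists (closure [set x | f x != 0]); split=> // x hx.
  by apply/eqP/negPn/negP => fx; apply: hx; exact: subset_closure.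
have [|h1 h2] := csupp_closure cK KA (phi := f); last by split.
by move=> x fx; apply: contrapT => /f0 h; move: fx; rewrite h eqxx.
Qed.

Lemma test_function_smooth A f : test_function A f -> smooth f.
Proof. by case. Qed.

Lemma test_function_partial A f i : test_function A f -> test_function A (partial i f).
Proof.
move=> /test_functionP[sf cf]; apply/test_functionP; split; first exact: smooth_partial.
exact: csupp_in_partial.
Qed.

Lemma smooth_C1_on A f : smooth f -> C1_on A f.
Proof.
move=> sf x _; split; first exact: smooth_differentiable.
by move=> i; apply: smooth_continuous; exact: smooth_partial.
Qed.

Lemma partialM f g i x : differentiable f x -> differentiable g x ->
  partial i (fun x => f x * g x) x = f x * partial i g x + g x * partial i f x.
Proof.
move=> df dg; have h := is_deriveM (differentiable_partial i df) (differentiable_partial i dg).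
by rewrite {1}/partial; apply: (@derive_val _ _ _ _ _ _ _ h).
Qed.

Lemma partialD f g i x : differentiable f x -> differentiable g x ->
  partial i (fun x => f x + g x) x = partial i f x + partial i g x.
Proof.
move=> df dg; have h := is_deriveD (differentiable_partial i df) (differentiable_partial i dg).
by rewrite {1}/partial; apply: (@derive_val _ _ _ _ _ _ _ h).
Qed.

Lemma open_near_eq_cvg A f g x : open A -> A x -> (forall y, A y -> f y = g y) ->
  {for x, continuous g} -> {for x, continuous f}.
Proof.
move=> oA Ax fg cg; suff : f @ x --> f x by [].
have n : \forall y \near x, g y = f y.
  by apply: filterS (open_nbhs_nbhs (conj oA Ax)) => y /fg.
by rewrite (fg x Ax); apply: cvg_trans cg; exact: near_eq_cvg n.
Qed.

Lemma C1_onM A f g : open A -> C1_on A f -> C1_on A g -> C1_on A (fun x => f x * g x).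
Proof.
move=> oA cf cg x Ax; have [df pf] := cf x Ax; have [dg pg] := cg x Ax.
split=> [|i]; first exact: differentiableM.
apply: (@open_near_eq_cvg A _ (fun x => f x * partial i g x + g x * partial i f x)) => //.
  by move=> y Ay; have [dfy _] := cf y Ay; have [dgy _] := cg y Ay; exact: partialM.
apply: continuousD; apply: continuousM => //; exact: differentiable_continuous.
Qed.

Lemma C1_on_continuous A f x : C1_on A f -> A x -> {for x, continuous f}.
Proof. by move=> cf Ax; have [df _] := cf x Ax; exact: differentiable_continuous. Qed.

(** At a point off A the function vanishes in a neighbourhood, since the compact K is closed;
    continuity is at stake inside A only. *)
Lemma csupp_continuous A f : open A -> csupp_in A f ->
  (forall x, A x -> {for x, continuous f}) -> continuous f.
Proof.
move=> oA [K [cK KA f0]] cf; suff : forall x : 'rV[R]_N, f @ x --> f x by [].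
move=> x; have [Ax|Ax] := pselect (A x); first exact: cf.
have Kx : ~ K x by move=> /KA.
have near0 : \forall y \near x, f y = 0 by apply: filterS (near_off_compact cK Kx) => y /f0.
by rewrite (f0 x Kx); exact: cvg_near_cst near0.
Qed.

Lemma csupp_continuous_integrable A f : continuous f -> csupp_in A f ->
  mu.-integrable setT (EFin \o f) /\ (measurable A -> \int[mu]_(x in A) f x = \int[mu]_x f x).
Proof.
move=> cf [K [cK KA f0]]; split.
  have [M M0 hM] := bounded_cbox (compact_bounded cK).
  apply: (csupp_integrable (M := M)) => // x i hx; apply: f0 => /hM/const_cboxP/(_ i).
  by rewrite leNgt hx.
move=> mA; rewrite Rintegral_mkcond; apply: eq_Rintegral => x _; rewrite patchE.
case: ifPn => // /negP Ax; rewrite f0// => /KA; rewrite -inE.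
by [].
Qed.

Lemma integral_csupp_partial A f i : open A -> C1_on A f -> csupp_in A f ->
  \int[mu]_(x in A) partial i f x = 0.
Proof.
move=> oA cf sf; have sp := csupp_in_partial i sf.
have cp : continuous (partial i f).
  by apply: csupp_continuous sp _ => // x Ax; have [_] := cf x Ax; exact.
have [ip ->] := csupp_continuous_integrable cp sp; last exact: open_measurable_rV.
have [K [cK KA f0]] := sf.
have [M M0 hM] := bounded_cbox (compact_bounded cK).
suff E : (\int[mu]_x (partial i f x)%:E = 0)%E by rewrite /Rintegral E.
apply: (integral_partial_csupp (i := i) (f := f) (M := M)) => //.
- move=> x; have [Ax|Ax] := pselect (A x).
    by apply: differentiable_partial; have [] := cf x Ax.
  have Kx : ~ K x by move=> /KA.
  by rewrite (csupp_partial0 i cK f0 Kx); exact: csupp_partial_out Kx.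
- move=> x j hx; have Kx : ~ K x by move=> /hM/const_cboxP/(_ j); rewrite leNgt hx.
  by split; [exact: f0|exact: csupp_partial0 Kx].
Qed.

Lemma integration_by_parts A f g i : open A -> C1_on A f -> C1_on A g -> csupp_in A g ->
  \int[mu]_(x in A) (f x * partial i g x) = - \int[mu]_(x in A) (partial i f x * g x).
Proof.
move=> oA cf cg sg.
have mA := open_measurable_rV oA.
have cgf : C1_on A (fun x => g x * f x) by exact: C1_onM.
have := integral_csupp_partial i oA cgf (csupp_inM f sg).
have int h : (forall x, A x -> {for x, continuous h}) -> csupp_in A h ->
    mu.-integrable A (EFin \o h).
  move=> ch sh; have [ih _] := csupp_continuous_integrable (csupp_continuous oA sh ch) sh.
  by apply: integrableS ih.
have i1 : mu.-integrable A (EFin \o (fun x => f x * partial i g x)).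
  apply: int => [x Ax|].
    by apply: continuousM; [exact: C1_on_continuous Ax|have [_] := cg x Ax; exact].
  have [K [cK KA g0]] := csupp_in_partial i sg; exists K; split=> // x /g0 ->; exact: mulr0.
have i2 : mu.-integrable A (EFin \o (fun x => partial i f x * g x)).
  apply: int => [x Ax|].
    by apply: continuousM; [have [_] := cf x Ax; exact|exact: C1_on_continuous Ax].
  have [K [cK KA g0]] := sg; exists K; split=> // x /g0 ->; exact: mulr0.
rewrite (@eq_Rintegral _ _ _ _ _ (fun x => partial i f x * g x + f x * partial i g x)); last first.
  move=> x; rewrite inE => Ax; have [df _] := cf x Ax; have [dg _] := cg x Ax.
  by rewrite partialM//; ring.
rewrite (RintegralD mA i2 i1) => /eqP; rewrite addr_eq0 => /eqP ->.
by rewrite opprK.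
Qed.

End C1_functions.

(** * Weak gradients, the space H^1 and the Dirichlet form *)

Section weak_gradients.
Context {R : realType} {N : nat}.
Let mu := @lebesgue_rV R N.
Variable A : set 'rV[R]_N.
Hypotheses (oA : open A) (bA : bounded_set A).
Implicit Types (u v phi : 'rV[R]_N -> R) (g k : 'rV[R]_N -> 'rV[R]_N).

Let mA : measurable A. Proof. exact: open_measurable_rV. Qed.
Let fA : (mu A < +oo)%E. Proof. exact: bounded_mu_fin. Qed.

Definition L2_field g := forall i, L2 A (fun x => g x ord0 i).

Lemma csupp_L2 f : continuous f -> csupp_in A f -> L2 A f.
Proof.
move=> cf [K [cK KA f0]].
have [C C0 hC] := continuous_compact_bound cK (continuous_subspaceT cf).
apply: (L2_bounded mA fA (C := C)); first exact: continuous_measurable_rV.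
move=> x _; have [/hC//|/f0 ->] := pselect (K x); by rewrite normr0.
Qed.

Lemma test_L2 phi : test_function A phi -> L2 A phi.
Proof. by move=> /test_functionP[/smooth_continuous cf sf]; exact: csupp_L2. Qed.

(** The compact support of the test function leaves no boundary term, so a square integrable
    classical gradient is a weak one. *)
Lemma C1_bounded_weak_gradient u : C1_on A u -> L2 A u ->
  (forall i, L2 A (partial i u)) -> is_weak_gradient A u (grad u).
Proof.
move=> cu hu hg; split=> [i|phi i /test_functionP[sphi cphi]].
  by apply: L2_eq_in (hg i) => // x _; rewrite mxE.
rewrite integration_by_parts//; last exact: smooth_C1_on.
by congr (- _); apply: eq_Rintegral => x _; rewrite mxE.
Qed.

Lemma test_weak_gradient phi : test_function A phi -> is_weak_gradient A phi (grad phi).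
Proof.
move=> tphi; apply: C1_bounded_weak_gradient; last 2 first.
- exact: test_L2.
- by move=> i; apply: test_L2; exact: test_function_partial.
- by apply: smooth_C1_on; exact: test_function_smooth tphi.
Qed.

(** The fundamental lemma applies to each component of g - k; finitely many coordinates share one
    null set. *)
Lemma weak_gradient_unique u g k : is_weak_gradient A u g -> is_weak_gradient A u k ->
  {ae mu, forall x, A x -> g x = k x}.
Proof.
move=> [hg dg] [hk dk].
have h i : {ae mu, forall x, A x -> g x ord0 i - k x ord0 i = 0}.
  have hgk : L2 A (fun x => g x ord0 i - k x ord0 i) by exact: L2B.
  apply: fundamental_lemma => //; first exact: L2_integrable.
  move=> phi tphi; have hphi := test_L2 tphi.
  have := dg phi i tphi; rewrite (dk phi i tphi) => /oppr_inj e.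
  have := Rintegral_L2_lin mA (-1) (hg i) (hk i) hphi.
  rewrite e mulN1r subrr => <-; apply: eq_Rintegral => x _.
  by rewrite mulN1r.
have {}h : {ae mu, forall x i, A x -> g x ord0 i - k x ord0 i = 0} by apply: filter_forall.
apply: filterS h => x hx Ax; apply/rowP => i; apply/eqP.
by rewrite -subr_eq0; apply/eqP; exact: hx.
Qed.

Lemma weak_gradient_lin u v g k (e : R) : L2 A u -> L2 A v ->
  is_weak_gradient A u g -> is_weak_gradient A v k ->
  is_weak_gradient A (fun x => u x + e * v x) (fun x => g x + e *: k x).
Proof.
move=> hu hv [hg dg] [hk dk]; split=> [i|phi i tphi].
  apply: (L2_eq_in mA _ (L2D mA (hg i) (L2Z mA e (hk i)))) => x _.
  by rewrite !mxE.
have hphi := test_L2 tphi; have hdphi := test_L2 (test_function_partial i tphi).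
rewrite (Rintegral_L2_lin mA e hu hv hdphi) (dg _ _ tphi) (dk _ _ tphi).
have -> : \int[lebesgue_rV N]_(x in A) ((g x + e *: k x) ord0 i * phi x) =
    \int[mu]_(x in A) ((g x ord0 i + e * k x ord0 i) * phi x).
  by apply: eq_Rintegral => x _; rewrite !mxE.
by rewrite (Rintegral_L2_lin mA e (hg i) (hk i) hphi); ring.
Qed.

Lemma H1_lin u v (e : R) : H1 A u -> H1 A v -> H1 A (fun x => u x + e * v x).
Proof.
move=> [hu [g hg]] [hv [k hk]]; split; first by apply: L2D => //; exact: L2Z.
by exists (fun x => g x + e *: k x); exact: weak_gradient_lin.
Qed.

Lemma test_H1 phi : test_function A phi -> H1 A phi.
Proof. by move=> t; split; [exact: test_L2|exists (grad phi); exact: test_weak_gradient]. Qed.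

Lemma weak_gradP u : H1 A u -> is_weak_gradient A u (weak_grad A u).
Proof. by move=> [_ [g hg]]; rewrite /weak_grad; apply: xgetPex; exists g. Qed.

Definition dirichlet g k := \int[mu]_(x in A) dotp (g x) (k x).

Lemma dirichletE g k : L2_field g -> L2_field k ->
  dirichlet g k = \sum_i \int[mu]_(x in A) (g x ord0 i * k x ord0 i).
Proof.
move=> hg hk; rewrite /dirichlet /dotp.
elim: (index_enum _) => [|i s ih].
  under eq_Rintegral do rewrite big_nil; by rewrite Rintegral_cst// mul0r big_nil.
under eq_Rintegral do rewrite big_cons; rewrite big_cons -ih RintegralD//.
  exact: L2_mul_integrable.
have -> : EFin \o (fun x => \sum_(j <- s) g x ord0 j * k x ord0 j) =
    (fun x => \sum_(j <- s) (g x ord0 j * k x ord0 j)%:E)%E.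
  by apply/funext => x /=; rewrite -sumEFin.
by apply: integrable_sum => // j _; exact: L2_mul_integrable.
Qed.

Lemma measurable_dotp g k : L2_field g -> L2_field k -> measurable_fun A (fun x => dotp (g x) (k x)).
Proof.
move=> hg hk; apply: measurable_sum => i.
by apply: measurable_funM; [exact: (hg i).1|exact: (hk i).1].
Qed.

Lemma ae_eq_dirichlet g g' k k' : L2_field g -> L2_field k -> L2_field g' -> L2_field k' ->
  {ae mu, forall x, A x -> g x = g' x} -> {ae mu, forall x, A x -> k x = k' x} ->
  dirichlet g k = dirichlet g' k'.
Proof.
move=> hg hk hg' hk' e e'; apply: (ae_eq_Rintegral mA); try exact: measurable_dotp.
by apply: filterS2 e e' => x h h' Ax; rewrite h// h'.
Qed.

Lemma dirichlet_lin g k l (e : R) : L2_field g -> L2_field k -> L2_field l ->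
  dirichlet (fun x => g x + e *: k x) l = dirichlet g l + e * dirichlet k l.
Proof.
move=> hg hk hl; rewrite !dirichletE//.
  rewrite mulr_sumr -big_split /=; apply: eq_bigr => i _.
  rewrite -(Rintegral_L2_lin mA e (hg i) (hk i) (hl i)).
  by apply: eq_Rintegral => x _; rewrite !mxE.
move=> i; apply: (L2_eq_in mA _ (L2D mA (hg i) (L2Z mA e (hk i)))) => x _.
by rewrite !mxE.
Qed.

Lemma dotpC (x y : 'rV[R]_N) : dotp x y = dotp y x.
Proof. by apply: eq_bigr => i _; rewrite mulrC. Qed.

Lemma dirichletC g k : dirichlet g k = dirichlet k g.
Proof. by apply: eq_Rintegral => x _; exact: dotpC. Qed.

Lemma weak_grad_field u : H1 A u -> L2_field (weak_grad A u).
Proof. by move=> /weak_gradP[]. Qed.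

(** The chosen representatives need not depend linearly on u pointwise. Uniqueness gives linearity
    almost everywhere, which suffices under integrals. *)
Lemma weak_grad_lin u v (e : R) : H1 A u -> H1 A v ->
  {ae mu, forall x, A x -> weak_grad A (fun x => u x + e * v x) x =
    weak_grad A u x + e *: weak_grad A v x}.
Proof.
move=> hu hv; apply: (weak_gradient_unique (weak_gradP (H1_lin e hu hv))).
by apply: weak_gradient_lin; [exact: hu.1|exact: hv.1|exact: weak_gradP|exact: weak_gradP].
Qed.

Lemma dirichlet_quadratic u v (e : R) : H1 A u -> H1 A v ->
  let w := weak_grad A (fun x => u x + e * v x) in
  dirichlet w w = dirichlet (weak_grad A u) (weak_grad A u)
    + 2 * e * dirichlet (weak_grad A u) (weak_grad A v)
    + e ^+ 2 * dirichlet (weak_grad A v) (weak_grad A v).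
Proof.
move=> hu hv w; have fu := weak_grad_field hu; have fv := weak_grad_field hv.
have fw := weak_grad_field (H1_lin e hu hv); have e1 := weak_grad_lin e hu hv.
have fl : L2_field (fun x => weak_grad A u x + e *: weak_grad A v x).
  have [] := weak_gradient_lin e hu.1 hv.1 (weak_gradP hu) (weak_gradP hv); exact.
have E z : L2_field z -> dirichlet z (fun x => weak_grad A u x + e *: weak_grad A v x) =
    dirichlet z (weak_grad A u) + e * dirichlet z (weak_grad A v).
  move=> hz; rewrite dirichletC (dirichlet_lin e fu fv hz).
  by rewrite (dirichletC _ z) (dirichletC _ z).
rewrite (ae_eq_dirichlet fw fw fl fl e1 e1) (dirichlet_lin e fu fv fl) (E _ fu) (E _ fv).
rewrite (dirichletC (weak_grad A v) (weak_grad A u)).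
by move: (dirichlet _ _) (dirichlet _ _) (dirichlet _ _) => x y z; ring.
Qed.

End weak_gradients.

(** * First variation of E_v and the weak Neumann problem *)

Section weak_gradient_flow.
Context {R : realType} {N : nat}.
Let mu := @lebesgue_rV R N.
Variables (A B : set 'rV[R]_N) (J : 'rV[R]_N -> R).
Hypotheses (oA : open A) (bA : bounded_set A) (mB : measurable B) (bB : bounded_set B).
Hypothesis cJ : continuous J.
Implicit Types (u v w phi xi : 'rV[R]_N -> R).

Let mA : measurable A. Proof. exact: open_measurable_rV. Qed.
Let fA : (mu A < +oo)%E. Proof. exact: bounded_mu_fin. Qed.
Let fB : (mu B < +oo)%E. Proof. exact: bounded_mu_fin. Qed.
Let oneB : mu.-integrable B (EFin \o (fun=> 1)).
Proof. exact: (L2_integrable mB fB (L2_cst mB fB 1)). Qed.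
Let L2I v : L2 B v -> mu.-integrable B (EFin \o v). Proof. exact: L2_integrable. Qed.

Definition reaction (u v : 'rV[R]_N -> R) x := \int[mu]_(y in B) (J (x - y) * (v y - u x)).

Lemma reactionE u v x : A x -> L2 B v ->
  reaction u v x = kop B J v x - kop B J (fun=> 1) x * u x.
Proof.
move=> Ax hv; have e := kopD bA mB bB cJ (- u x) Ax (L2I hv) oneB.
rewrite mulrC -mulNr -e; apply: eq_Rintegral => y _; congr (_ * _).
by rewrite mulr1.
Qed.

Let kop1_L2 u : L2 A u -> L2 A (fun x => kop B J (fun=> 1) x * u x).
Proof.
have [C hC] := kop_bounded bA mB bB cJ oneB.
exact: (L2_mul_bounded mA (kop_measurable mA bA mB bB cJ oneB) hC).
Qed.

Lemma reaction_L2 u v : L2 A u -> L2 B v -> L2 A (reaction u v).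
Proof.
move=> hu hv; apply: (L2_eq_in mA _ (L2B mA (kop_L2 mA bA mB bB cJ (L2I hv)) (kop1_L2 hu))).
by move=> x Ax; rewrite reactionE.
Qed.

Lemma energy_finP v u : energy A B J v u \is a fin_num <-> H1 A u.
Proof. by rewrite /energy; case: asboolP. Qed.

Lemma energyE v u : L2 B v -> H1 A u -> energy A B J v u =
  (2^-1 * dirichlet A (weak_grad A u) (weak_grad A u)
   + 2^-1 * \int[mu]_(x in A) (u x * (kop B J (fun=> 1) x * u x))
   - \int[mu]_(x in A) (u x * kop B J v x))%:E.
Proof.
move=> hv hu; rewrite /energy; case: asboolP => // _; congr (_ + _ * _ - _)%:E.
  apply: eq_Rintegral => x; rewrite inE => Ax.
  have i1 := kernel_slice_integrable bA mB bB cJ Ax oneB.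
  rewrite mulrA (mulrC (u x)) -mulrA -expr2 /kop -(RintegralZr _ mB i1).
  by apply: eq_Rintegral => y _; rewrite mulr1.
apply: eq_Rintegral => x; rewrite inE => Ax.
have i1 := kernel_slice_integrable bA mB bB cJ Ax (L2I hv).
rewrite /kop -(RintegralZl _ mB i1).
by apply: eq_Rintegral => y _; rewrite (mulrC (J _)) mulrA.
Qed.

Lemma is_derive_energy v u phi : L2 B v -> H1 A u -> H1 A phi ->
  is_derive (0 : R) (1 : R) (fun e : R => fine (energy A B J v (fun x => u x + e * phi x)))
    (dirichlet A (weak_grad A u) (weak_grad A phi) - \int[mu]_(x in A) (reaction u v x * phi x)).
Proof.
move=> hv hu hphi; have Lu := hu.1; have Lphi := hphi.1.
have ku := kop1_L2 Lu; have kphi := kop1_L2 Lphi.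
have kv := kop_L2 mA bA mB bB cJ (L2I hv).
pose c2 := 2^-1 * dirichlet A (weak_grad A phi) (weak_grad A phi)
   + 2^-1 * \int[mu]_(x in A) (phi x * (kop B J (fun=> 1) x * phi x)).
rewrite (_ : (fun e : R => _) = (fun e => fine (energy A B J v u) +
  e * (dirichlet A (weak_grad A u) (weak_grad A phi) - \int[mu]_(x in A) (reaction u v x * phi x))
  + e ^+ 2 * c2)); first exact: is_derive_quadratic.
apply/funext => e; have Lue : L2 A (fun x => u x + e * phi x) by apply: L2D => //; exact: L2Z.
rewrite (energyE hv (H1_lin oA bA e hu hphi)) (energyE hv hu) /=.
rewrite (dirichlet_quadratic oA bA e hu hphi).
rewrite (Rintegral_L2_lin mA e Lu Lphi kv).
have -> : \int[mu]_(x in A) ((u x + e * phi x) * (kop B J (fun=> 1) x * (u x + e * phi x))) =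
    \int[mu]_(x in A) (u x * (kop B J (fun=> 1) x * u x))
    + 2 * e * \int[mu]_(x in A) (phi x * (kop B J (fun=> 1) x * u x))
    + e ^+ 2 * \int[mu]_(x in A) (phi x * (kop B J (fun=> 1) x * phi x)).
  have -> : \int[mu]_(x in A) ((u x + e * phi x) * (kop B J (fun=> 1) x * (u x + e * phi x))) =
      \int[mu]_(x in A) ((u x + e * phi x) *
        (kop B J (fun=> 1) x * u x + e * (kop B J (fun=> 1) x * phi x))).
    by apply: eq_Rintegral => x _; rewrite mulrDr (mulrCA _ e).
  rewrite (Rintegral_L2_lin2 mA e ku kphi Lue) !(Rintegral_L2_lin mA e Lu Lphi)//.
  have -> : \int[mu]_(x in A) (u x * (kop B J (fun=> 1) x * phi x)) =
      \int[mu]_(x in A) (phi x * (kop B J (fun=> 1) x * u x)).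
    by apply: eq_Rintegral => x _; rewrite mulrCA [RHS]mulrCA (mulrC (u x)).
  by move: (\int[_]_(_ in _) _) (\int[_]_(_ in _) _) (\int[_]_(_ in _) _) => x y z; ring.
have -> : \int[mu]_(x in A) (reaction u v x * phi x) =
    \int[mu]_(x in A) (phi x * kop B J v x)
    + (-1) * \int[mu]_(x in A) (phi x * (kop B J (fun=> 1) x * u x)).
  rewrite -(Rintegral_L2_lin2 mA (-1) kv ku Lphi).
  apply: eq_Rintegral => x; rewrite inE => Ax.
  by rewrite (reactionE _ Ax hv) mulN1r mulrC.
rewrite /c2; move: (dirichlet _ _ _) (dirichlet _ _ _) (dirichlet _ _ _).
move: (\int[_]_(_ in _) _) (\int[_]_(_ in _) _) (\int[_]_(_ in _) _).
by move: (\int[_]_(_ in _) _) (\int[_]_(_ in _) _) => a b c d f g h i; field.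
Qed.

(** The directions along which the energy stays finite near u in H^1 are exactly those of H^1, so
    the variational identity is tested on H^1. *)
Lemma first_variation_energyP v u xi : L2 B v ->
  first_variation A (energy A B J v) u xi <->
  [/\ H1 A u, L2 A xi & forall phi, H1 A phi ->
    \int[mu]_(x in A) (xi x * phi x) =
    dirichlet A (weak_grad A u) (weak_grad A phi) - \int[mu]_(x in A) (reaction u v x * phi x)].
Proof.
move=> hv; split.
- move=> [Lu Lxi /energy_finP hu h]; split=> // phi hphi.
  have h1 : is_derive (0 : R) (1 : R) (fun e : R => fine (energy A B J v (fun x => u x + e * phi x)))
      (\int[mu]_(x in A) (xi x * phi x)).
    by apply: (h _ hphi.1); near=> e; apply/energy_finP; exact: H1_lin.
  rewrite -(@derive_val _ _ _ _ _ _ _ h1).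
  exact: (@derive_val _ _ _ _ _ _ _ (is_derive_energy hv hu hphi)).
- move=> [hu Lxi h]; split; [exact: hu.1|exact: Lxi|exact/energy_finP|].
  move=> phi Lphi near_fin.
  (* One nonzero e with finite energy is enough: phi is then e^-1 ((u + e phi) - u), a combination
     of functions of H^1. *)
  have [e [e0 he]] : exists e : R, e != 0 /\ H1 A (fun x => u x + e * phi x).
    have : \forall e \near (0 : R)^', energy A B J v (fun x => u x + e * phi x) \is a fin_num.
      exact: cvg_within.
    move=> near_fin'; have [e [e0 /energy_finP he]] := @filter_ex _ _ _ _
      (filterI (nbhs_dnbhs_neq (0 : R)) near_fin').
    by exists e.
  have hphi : H1 A phi.
    have := H1_lin oA bA e^-1 (H1_lin oA bA (-1) hu hu)
      (H1_lin oA bA (-1) he hu).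
    rewrite (_ : (fun x => _) = phi)//; apply/funext => x.
    by rewrite !mulN1r subrr add0r addrAC subrr add0r mulKf.
  by rewrite (h _ hphi); exact: is_derive_energy.
Unshelve. all: by end_near. Qed.

(** Restricting the Neumann identity to test functions and applying the definition of the weak
    gradient of u to each partial derivative of phi gives the distributional Laplacian. *)
Lemma weak_neumann_laplacian u w : H1 A u -> L2 A w -> weak_neumann A u w -> is_weak_laplacian A u w.
Proof.
move=> hu Lw hn; have Lu := hu.1.
split=> // phi tphi; have hphi := test_H1 oA bA tphi.
have := hn phi hphi; rewrite /weak_normal_derivative -/(dirichlet A _ _) => /eqP.
rewrite addrC addr_eq0 => /eqP ->.
have gphi := test_weak_gradient oA bA tphi.
have fg := weak_grad_field hu; have fphi := weak_grad_field hphi.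
rewrite (ae_eq_dirichlet oA fg fphi fg gphi.1 (aeW _ (fun _ _ => erefl))
  (weak_gradient_unique oA bA (weak_gradP hphi) gphi)).
rewrite (dirichletE oA fg gphi.1) -sumrN.
have [_ dg] := weak_gradP hu.
have -> : \int[lebesgue_rV N]_(x in A) (u x * laplacian phi x) =
    \sum_i \int[lebesgue_rV N]_(x in A) (u x * partial i (partial i phi) x).
  have Ld i : L2 A (partial i (partial i phi)).
    by apply: test_L2 => //; do 2 apply: test_function_partial.
  rewrite /laplacian; elim: (index_enum _) => [|i s ih].
    under eq_Rintegral do rewrite big_nil mulr0; by rewrite Rintegral_cst// mul0r big_nil.
  have Ls : L2 A (fun x => \sum_(j <- s) partial j (partial j phi) x).
    elim: s {ih} => [|j s ih]; first by under eq_fun do rewrite big_nil; exact: L2_cst.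
    by under eq_fun do rewrite big_cons; exact: L2D.
  rewrite big_cons -ih -[X in _ + X]mul1r -(Rintegral_L2_lin2 mA 1 (Ld i) Ls Lu).
  by apply: eq_Rintegral => x _; rewrite big_cons mul1r.
apply: eq_bigr => i _; rewrite (dg _ _ (test_function_partial i tphi)).
by congr (- _); apply: eq_Rintegral => x _; rewrite mxE.
Qed.

(** The substitution xi = - w - [reaction u v] turns the weak Neumann identity for w into the first
    variation identity for xi, and conversely. *)
Lemma weak_solution_stepP v u ut : L2 A u -> L2 B v -> L2 A ut ->
  (exists w, [/\ H1 A u, is_weak_laplacian A u w, weak_neumann A u w &
     {ae mu, forall x, A x -> ut x = w x + reaction u v x}]) <->
  (exists xi, first_variation A (energy A B J v) u xi /\ {ae mu, forall x, A x -> ut x + xi x = 0}).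
Proof.
move=> Lu hv Lut; have Lr := reaction_L2 Lu hv; split.
- move=> [w [hu [Lw _] hn hut]]; exists (fun x => - w x - reaction u v x); split; last first.
    by apply: filterS hut => x hx Ax; rewrite hx//; ring.
  have Lw' := L2N mA Lw; have Lxi := L2B mA Lw' Lr.
  apply/(first_variation_energyP u _ hv); split=> // phi hphi.
  have := hn phi hphi; rewrite /weak_normal_derivative => /eqP.
  rewrite addr_eq0 => /eqP e; rewrite /dirichlet e.
  have := Rintegral_L2_lin mA 1 (L2Z mA (-1) Lw) (L2Z mA (-1) Lr) hphi.1.
  have := Rintegral_L2_lin mA (-1) (L2_cst mA fA 0) Lw hphi.1.
  have := Rintegral_L2_lin mA (-1) (L2_cst mA fA 0) Lr hphi.1.
  have -> : \int[lebesgue_rV N]_(x in A) (0 * phi x) = 0.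
    by under eq_Rintegral do rewrite mul0r; rewrite Rintegral_cst// mul0r.
  rewrite !add0r !mulN1r mul1r => e1 e2 e3.
  have -> : \int[mu]_(x in A) ((- w x - reaction u v x) * phi x) =
     \int[lebesgue_rV N]_(x in A) ((-1 * w x + 1 * (-1 * reaction u v x)) * phi x).
    by apply: eq_Rintegral => x _; congr (_ * _); ring.
  rewrite e3 -e1 -e2; congr (_ + _); apply: eq_Rintegral => x _; ring.
- move=> [xi [/(first_variation_energyP _ _ hv)[hu Lxi h] hut]].
  pose w x := - xi x - reaction u v x.
  have Lw : L2 A w by exact: (L2B mA (L2N mA Lxi) Lr).
  have hn : weak_neumann A u w.
    move=> phi hphi; rewrite /weak_normal_derivative -/(dirichlet A _ _).
    have := Rintegral_L2_lin mA 1 Lxi Lr hphi.1.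
    have := Rintegral_L2_lin mA (-1) (L2_cst mA fA 0) (L2D mA Lxi Lr) hphi.1.
    have -> : \int[lebesgue_rV N]_(x in A) (0 * phi x) = 0.
      by under eq_Rintegral do rewrite mul0r; rewrite Rintegral_cst// mul0r.
    have -> : \int[lebesgue_rV N]_(x in A) ((0 + -1 * (xi x + reaction u v x)) * phi x) =
       \int[lebesgue_rV N]_(x in A) (w x * phi x).
      by apply: eq_Rintegral => x _; rewrite /w; ring.
    have -> : \int[lebesgue_rV N]_(x in A) ((xi x + 1 * reaction u v x) * phi x) =
       \int[lebesgue_rV N]_(x in A) ((xi x + reaction u v x) * phi x).
      by apply: eq_Rintegral => x _; rewrite mul1r.
    by move=> -> ->; rewrite (h _ hphi); ring.
  exists w; split=> //; first exact: weak_neumann_laplacian.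
  by apply: filterS hut => x hx Ax; have := hx Ax; rewrite /w => /eqP; rewrite addr_eq0 => /eqP ->; ring.
Unshelve. all: by end_near. Qed.

End weak_gradient_flow.

(** * A compactly supported approximate unit *)

Section mollifier.
Context {R : realType}.
Let mu n := @lebesgue_rV R n.

Lemma continuous_prod_coord n (f : 'I_n -> R -> R) : (forall i, continuous (f i)) ->
  continuous (fun y : 'rV[R]_n => \prod_i f i (y ord0 i)).
Proof.
move=> cf; elim: (index_enum _) => [|i s ihs].
  by under eq_fun do rewrite big_nil; exact: cst_continuous.
under eq_fun do rewrite big_cons.
move=> y; apply: continuousM; last exact: ihs.
by apply: continuous_comp; [exact: coord_continuous|exact: cf].
Qed.

Lemma integrable_prod_coord n (f : 'I_n -> R -> R) (M : R) :
  (forall i, continuous (f i)) -> (forall i t, M < `|t| -> f i t = 0) ->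
  (mu n).-integrable setT (fun y => (\prod_i f i (y ord0 i))%:E).
Proof.
move=> cf f0; apply: (csupp_integrable (M := M) (continuous_prod_coord cf)) => y i h.
apply/eqP; rewrite prodf_seq_eq0; apply/hasP; exists i; first by rewrite mem_index_enum.
by rewrite f0//= eqxx.
Qed.

Lemma integral_prod_one n (f : 'I_n -> R -> R) (M : R) :
  (forall i, continuous (f i)) -> (forall i t, M < `|t| -> f i t = 0) ->
  (forall i, \int[@lebesgue_measure R]_t (f i t)%:E = 1)%E ->
  (\int[mu n]_y (\prod_i f i (y ord0 i))%:E = 1)%E.
Proof.
elim: n f => [|n ih] f cf f0 f1.
  under eq_integral do rewrite big_ord0.
  by rewrite /mu /= integral_dirac// diracT mul1e.
have ip := integrable_prod_coord cf f0.
rewrite (integral_cons_rV ip) (integral_fubini1 (integrable_cons_rV ip)) /=.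
rewrite -(f1 ord0); apply: eq_integral => t _.
have iq := integrable_prod_coord (fun i => cf (lift ord0 i)) (fun i => f0 (lift ord0 i)).
have -> : (fun y => (\prod_i f i (cons_rV (t, y) ord0 i))%:E) =
    (fun y : 'rV[R]_n => (f ord0 t)%:E * (\prod_(i < n) f (lift ord0 i) (y ord0 i))%:E)%E.
  apply/funext => y; rewrite big_ord_recl cons_rV0 -EFinM; congr (_ * _)%:E.
  by apply: eq_bigr => i _; rewrite cons_rVS.
rewrite integralZl//.
by rewrite (ih (fun i => f (lift ord0 i)) (fun i => cf _) (fun i => f0 _) (fun i => f1 _)) mule1.
Qed.

Variable N : nat.
Implicit Types (x y z : 'rV[R]_N) (A K : set 'rV[R]_N).

(** The density is the rescaled derivative of the smooth step: its integral is an increment of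
    [step], so no normalising constant appears. Its support is contained in [0, 1/(k+1)]. *)
Definition approx1 (k : nat) (t : R) : R := k.+1%:R * dstep (k.+1%:R * t).

Definition approx_unit (k : nat) z : R := \prod_j approx1 k (z ord0 j).

Lemma approx1_elementary k : elementary (approx1 k).
Proof.
apply: elementaryM; first exact: elementary_cst.
apply: (elementary_comp dstep_elementary); apply: elementaryM; last exact: elementary_id.
exact: elementary_cst.
Qed.

Lemma approx1_ge0 k t : 0 <= approx1 k t.
Proof. by rewrite mulr_ge0 ?dstep_ge0. Qed.

Lemma approx1_out k t : approx1 k t != 0 -> 0 <= t <= k.+1%:R^-1.
Proof.
have k0 : 0 < k.+1%:R :> R by [].
apply: contraNT; rewrite negb_and -!ltNge => /orP[h|h].
  by rewrite /approx1 dstep_lt0 ?mulr0// pmulr_rlt0.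
by rewrite /approx1 dstep_gt1 ?mulr0// mulrC -ltr_pdivrMr// div1r.
Qed.

Lemma approx_unit_out k z : approx_unit k z != 0 -> forall j, 0 <= z ord0 j <= k.+1%:R^-1.
Proof. by move=> /prodf_neq0 h j; apply: approx1_out; exact: h. Qed.

Lemma approx_unit_ge0 k z : 0 <= approx_unit k z.
Proof. by apply: prodr_ge0 => j _; exact: approx1_ge0. Qed.

Lemma approx_unit_smooth k : smooth (approx_unit k).
Proof.
apply: elementary_rVP; apply: elementary_rV_prod => j.
exact: elementary_rV_comp (approx1_elementary k) (elementary_rV_coord j).
Qed.

Lemma approx_unit_smooth_l k y : smooth (fun x => approx_unit k (x - y)).
Proof.
apply: elementary_rVP; apply: elementary_rV_prod => j.
have -> : (fun x : 'rV[R]_N => approx1 k ((x - y) ord0 j)) =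
    (fun x => (fun t => approx1 k (t + - y ord0 j)) (x ord0 j)).
  by apply/funext => x; rewrite !mxE.
apply: (elementary_rV_comp (h := fun t => approx1 k (t + - y ord0 j)) _ (elementary_rV_coord j)).
apply: (elementary_comp (approx1_elementary k)).
by apply: elementaryD; [exact: elementary_id|exact: elementary_cst].
Qed.

Lemma approx_unit_smooth_r k x : smooth (fun y => approx_unit k (x - y)).
Proof.
apply: elementary_rVP; apply: elementary_rV_prod => j.
have -> : (fun y : 'rV[R]_N => approx1 k ((x - y) ord0 j)) =
    (fun y => (fun t => approx1 k (x ord0 j - t)) (y ord0 j)).
  by apply/funext => y; rewrite !mxE.
apply: (elementary_rV_comp (h := fun t => approx1 k (x ord0 j - t)) _ (elementary_rV_coord j)).
apply: (elementary_comp (approx1_elementary k)).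
by apply: elementaryB; [exact: elementary_cst|exact: elementary_id].
Qed.

Lemma partial_approx_unit_l k i x y :
  partial i (fun x => approx_unit k (x - y)) x = partial i (approx_unit k) (x - y).
Proof.
have d := differentiable_partial i (smooth_differentiable (x - y) (approx_unit_smooth k)).
have := @is_derive_affine _ _ _ (fun x => x - y) (approx_unit k) x (delta_mx ord0 i) _ _ _ d.
rewrite {1}/partial => h; apply: (@derive_val _ _ _ _ _ _ _ (h _)) => t.
by rewrite addrA.
Qed.

Lemma partial_approx_unit_r k i x y :
  partial i (fun y => approx_unit k (x - y)) y = - partial i (approx_unit k) (x - y).
Proof.
have df := smooth_differentiable (x - y) (approx_unit_smooth k).
have d : is_derive (x - y) (- delta_mx ord0 i) (approx_unit k) (- partial i (approx_unit k) (x - y)).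
  apply: DeriveDef; first exact: diff_derivable.
  by rewrite /partial !deriveE// linearN.
have := @is_derive_affine _ _ _ (fun y => x - y) (approx_unit k) y (delta_mx ord0 i) _ _ _ d.
rewrite {1}/partial => h; apply: (@derive_val _ _ _ _ _ _ _ (h _)) => t.
by rewrite scalerN opprD addrCA.
Qed.

Lemma integral_approx1 k (a : R) : (\int[@lebesgue_measure R]_t (approx1 k (a - t))%:E = 1)%E.
Proof.
pose c : R := k.+1%:R; have c0 : 0 < c by [].
have c1 : 1 <= c by rewrite /c ler1n.
(* Antiderivative of the density, equal to -1 far to the left and to 0 far to the right. *)
pose f t := - step (c * (a - t)).
have df (t : R) : is_derive t (1 : R) f (approx1 k (a - t)).
  have h1 : is_derive t (1 : R) (fun t : R => c * (a - t)) (- c).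
    have h := is_deriveM (is_derive_cst c t (1 : R))
      (is_deriveB (is_derive_cst a t (1 : R)) (is_derive_id t (1 : R))).
    by apply: (is_derive_eq h); rewrite /GRing.scale /= /cst mulr0 addr0 sub0r mulrN1.
  have h2 := is_deriveN (@is_derive1_comp _ step (fun t => c * (a - t)) _ _ _ (is_derive_step _) h1).
  by apply: (is_derive_eq h2); rewrite mulrN opprK mulrC.
have a0 : 0 < `|a| + 2 by rewrite ltr_wpDl.
rewrite (@integral_derive_csupp _ f _ (`|a| + 1) (`|a| + 2) df) //.
- rewrite /f step_le0 ?step_ge1 ?oppr0 ?sub0r ?opprK//.
    have : - `|a| <= a by rewrite lerNl -normrN ler_norm.
    by move: `|a| => b hb; nra.
  have := ler_norm a; move: `|a| => b hb; nra.
- apply: elementary_continuous; apply: (elementary_comp (approx1_elementary k)).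
  by apply: elementaryB; [exact: elementary_cst|exact: elementary_id].
- move=> t ht; apply/eqP; apply/negPn/negP => /approx1_out/andP[h1 h2].
  have h3 : `|a - t| <= 1 by rewrite ger0_norm// (le_trans h2)// invf_le1.
  have : `|t| <= `|a| + `|a - t|.
    by have := ler_normB a (a - t); rewrite opprB addrCA subrr addr0.
  by rewrite leNgt => /negP; apply; rewrite (le_lt_trans _ ht)// lerD2l.
- by rewrite ltrD2l ltr1n.
Qed.

Lemma integral_approx_unit k x : (\int[mu N]_y (approx_unit k (x - y))%:E = 1)%E.
Proof.
have -> : (fun y => (approx_unit k (x - y))%:E) =
    (fun y : 'rV[R]_N => (\prod_j (fun t => approx1 k (x ord0 j - t)) (y ord0 j))%:E).
  by apply/funext => y; congr EFin; apply: eq_bigr => j _; rewrite !mxE.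
apply: (@integral_prod_one N (fun j t => approx1 k (x ord0 j - t)) (`|x| + 1)).
- move=> j; apply: elementary_continuous; apply: (elementary_comp (approx1_elementary k)).
  by apply: elementaryB; [exact: elementary_cst|exact: elementary_id].
- move=> j t ht; apply/eqP; apply/negPn/negP => /approx1_out/andP[h1 h2].
  have h3 : `|x ord0 j - t| <= 1 by rewrite ger0_norm// (le_trans h2)// invf_le1// ler1n.
  have : `|t| <= `|x ord0 j| + `|x ord0 j - t|.
    by have := ler_normB (x ord0 j) (x ord0 j - t); rewrite opprB addrCA subrr addr0.
  rewrite leNgt => /negP; apply; rewrite (le_lt_trans _ ht)// lerD//.
  exact: norm_coord_le.
- by move=> j; exact: integral_approx1.
Qed.

Lemma approx_unit_integrable k x : (mu N).-integrable setT (fun y => (approx_unit k (x - y))%:E).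
Proof.
apply: (csupp_integrable (M := `|x| + 1) (smooth_continuous (approx_unit_smooth_r k x))) => y j hy.
apply/eqP/negPn/negP => /approx_unit_out/(_ j); rewrite !mxE => /andP[h1 h2].
have h3 : `|x ord0 j - y ord0 j| <= 1 by rewrite ger0_norm// (le_trans h2)// invf_le1// ler1n.
have : `|y ord0 j| <= `|x ord0 j| + `|x ord0 j - y ord0 j|.
  by have := ler_normB (x ord0 j) (x ord0 j - y ord0 j); rewrite opprB addrCA subrr addr0.
rewrite leNgt => /negP; apply; rewrite (le_lt_trans _ hy)// lerD//.
exact: norm_coord_le.
Qed.

Lemma compact_margin K A : compact K -> open A -> K `<=` A ->
  \forall k \near \oo, forall y, K y -> forall x,
    (forall j, `|x ord0 j - y ord0 j| <= k.+1%:R^-1) -> A x.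
Proof.
move=> cK oA KA.
have := (compact_near_coveringP K).1 cK nat \oo (fun k y => forall x,
    (forall j, `|x ord0 j - y ord0 j| <= k.+1%:R^-1) -> A x) _ _.
apply => y /KA Ay.
have /nbhs_ballP[e /= e0 he] : nbhs y A by exact: open_nbhs_nbhs.
have e20 : 0 < e / 2 by rewrite divr_gt0.
near=> y' k => x hx; apply: he; apply/ball_rVP; split=> // j.
have h1 : ball y (e / 2) y' by near: y'; exact: nbhsx_ballx.
have [_ /(_ j) h2] := (ball_rVP _ _ _).1 h1.
have h3 : k.+1%:R^-1 < e / 2.
  by near: k; exact: near_infty_natSinv_lt (PosNum e20).
have h4 := hx j.
rewrite (le_lt_trans (ler_distD (y' ord0 j) _ _))// [ltRHS](splitr e) ltrD//.
by rewrite distrC (le_lt_trans h4).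
Unshelve. all: by end_near. Qed.

Lemma approx_unit_test K A : compact K -> open A -> K `<=` A ->
  \forall k \near \oo, forall y, K y -> test_function A (fun x => approx_unit k (x - y)).
Proof.
move=> cK oA KA; apply: filterS (compact_margin cK oA KA) => k h y Ky.
apply/test_functionP; split; first exact: approx_unit_smooth_l.
exists (cbox y (y + const_mx k.+1%:R^-1)); split; first exact: compact_cbox.
  move=> x hx; apply: (h y Ky) => j; have := hx j; rewrite !mxE => /andP[h1 h2].
  by rewrite ger0_norm ?subr_ge0// lerBlDl.
move=> x hx; apply/eqP/negPn/negP => /approx_unit_out h'; apply: hx => j.
by have := h' j; rewrite !mxE subr_ge0 lerBlDl.
Qed.

End mollifier.

(** * Testing weak gradients against C^1 functions *)

Section mollification.
Context {R : realType} {N : nat}.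
Let mu := @lebesgue_rV R N.
Variable A : set 'rV[R]_N.
Hypotheses (oA : open A) (bA : bounded_set A).
Implicit Types (F psi u : 'rV[R]_N -> R).

Let mA : measurable A. Proof. exact: open_measurable_rV. Qed.
Let fA : (mu A < +oo)%E. Proof. exact: bounded_mu_fin. Qed.

Lemma mollify_setT k F x : continuous F -> csupp_in A F ->
  mu.-integrable setT (EFin \o (fun y : 'rV[R]_N => approx_unit k (x - y) * F y)) /\
  kop A (approx_unit k) F x = \int[mu]_y (approx_unit k (x - y) * F y).
Proof.
move=> cF [K [cK KA F0]].
have c : continuous (fun y : 'rV[R]_N => approx_unit k (x - y) * F y).
  have ck := smooth_continuous (approx_unit_smooth_r k x).
  exact: (continuous_mul ck cF).
have s : csupp_in A (fun y : 'rV[R]_N => approx_unit k (x - y) * F y).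
  by exists K; split=> // y /F0 ->; rewrite mulr0.
have [i e] := csupp_continuous_integrable c s; split=> //.
exact: e.
Qed.

(** The difference is the average of F y - F x for the probability density
    [approx_unit k (x - y)]. *)
Lemma mollify_close k F x (C : R) : continuous F -> csupp_in A F ->
  (forall y, approx_unit k (x - y) != 0 -> `|F y - F x| <= C) ->
  `|kop A (approx_unit k) F x - F x| <= C.
Proof.
move=> cF sF hC; have [i ->] := mollify_setT k x cF sF.
have ik := approx_unit_integrable k x.
have m1 : \int[mu]_y approx_unit k (x - y) = 1 by rewrite /Rintegral integral_approx_unit.
have icst (c : R) : mu.-integrable setT (EFin \o (fun y => approx_unit k (x - y) * c)).
  have := integrableZr measurableT c ik; apply: eq_integrable => // y _ /=.
have -> : F x = \int[mu]_y (approx_unit k (x - y) * F x).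
  by rewrite RintegralZr// m1 mul1r.
rewrite -RintegralB//.
have iB : mu.-integrable setT (EFin \o (fun y => approx_unit k (x - y) * F y - approx_unit k (x - y) * F x)).
  have := integrableB measurableT i (icst (F x)); apply: eq_integrable => // y _ /=.
apply: (le_trans (le_normr_Rintegral measurableT iB)).
have -> : C = \int[mu]_y (approx_unit k (x - y) * C) by rewrite RintegralZr// m1 mul1r.
apply: le_Rintegral => //; first exact: (integrable_abse iB).
move=> y _; rewrite -mulrBr normrM ger0_norm ?approx_unit_ge0//.
have [->|h] := eqVneq (approx_unit k (x - y)) 0; first by rewrite !mul0r.
by rewrite ler_wpM2l ?approx_unit_ge0// hC.
Qed.

Lemma mollify_cvg F x : continuous F -> csupp_in A F ->
  kop A (approx_unit k) F x @[k --> \oo] --> F x.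
Proof.
move=> cF sF; apply/cvgrPdist_le => e e0.
have /cvgrPdist_le/(_ e e0) := cF x.
move=> /nbhs_ballP[d /= d0 hd].
near=> k; rewrite distrC; apply: mollify_close => // y /approx_unit_out h.
rewrite distrC; apply: hd; apply/ball_rVP; split=> // j.
have := h j; rewrite !mxE => /andP[h1 h2]; rewrite ger0_norm// (le_lt_trans h2)//.
by near: k; exact: near_infty_natSinv_lt (PosNum d0).
Unshelve. all: by end_near. Qed.

Lemma mollify_bounded F : continuous F -> csupp_in A F ->
  exists2 C, 0 <= C & forall k x, `|kop A (approx_unit k) F x| <= C.
Proof.
move=> cF sF; have [K [cK KA F0]] := sF.
have [C C0 hC] := continuous_compact_bound cK (continuous_subspaceT cF).
have hF y : `|F y| <= C.
  by have [/hC//|/F0 ->] := pselect (K y); rewrite normr0.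
exists (C + C + C) => [|k x]; first by rewrite !addr_ge0.
have h : `|kop A (approx_unit k) F x - F x| <= C + C.
  by apply: mollify_close => // y _; rewrite (le_trans (ler_normB _ _))// lerD.
by rewrite -(subrK (F x) (kop _ _ _ _)) (le_trans (ler_normD _ _))// lerD.
Qed.

(** Differentiating the kernel in y instead of x changes the sign, and integration by parts changes
    it back. *)
Lemma mollify_partial k i psi x : C1_on A psi -> csupp_in A psi ->
  kop A (partial i (approx_unit k)) psi x = kop A (approx_unit k) (partial i psi) x.
Proof.
move=> cpsi spsi.
pose dK (y : 'rV[R]_N) := partial i (approx_unit k) (x - y).
have cdK : continuous dK.
  move=> y; apply: continuous_comp; first exact: continuous_subl.
  by apply: smooth_continuous; apply: smooth_partial; exact: approx_unit_smooth.
have cp : continuous psi by apply: (csupp_continuous oA spsi) => y Ay; exact: C1_on_continuous Ay.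
have c : continuous (fun y => dK y * psi y) := continuous_mul cdK cp.
have s : csupp_in A (fun y => dK y * psi y).
  by have [K [cK KA p0]] := spsi; exists K; split=> // y /p0 ->; rewrite mulr0.
have [i1 _] := csupp_continuous_integrable c s.
have i2 : mu.-integrable A (EFin \o (fun y => dK y * psi y)) by apply: integrableS i1.
have cf := smooth_C1_on (A := A) (approx_unit_smooth_r k x).
rewrite /kop (integration_by_parts i oA cf cpsi spsi).
rewrite -[LHS]opprK -[- \int[_]_(_ in _) _ in LHS]mulN1r -(RintegralZl (-1) mA i2).
by congr (- _); apply: eq_Rintegral => y _; rewrite partial_approx_unit_r mulN1r mulNr.
Qed.

(* The weak gradient is tested against x |-> approx_unit k (x - y) for fixed y, and the
   resulting identity is integrated against psi y: no mollified function has to be smooth. *)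
Lemma weak_gradient_C1_csupp u g psi i : L2 A u -> is_weak_gradient A u g ->
  C1_on A psi -> csupp_in A psi ->
  \int[mu]_(x in A) (u x * partial i psi x) = - \int[mu]_(x in A) (g x ord0 i * psi x).
Proof.
move=> Lu [Lg dg] cpsi spsi.
have cp : continuous psi by apply: (csupp_continuous oA spsi) => y Ay; exact: C1_on_continuous Ay.
have sdp := csupp_in_partial i spsi.
have cdp : continuous (partial i psi).
  by apply: (csupp_continuous oA sdp) => y Ay; have [_] := cpsi y Ay; exact.
have Lpsi := csupp_L2 oA bA cp spsi; have Ldpsi := csupp_L2 oA bA cdp sdp.
have iu := L2_integrable mA fA Lu; have ig := L2_integrable mA fA (Lg i).
have ipsi := L2_integrable mA fA Lpsi; have idpsi := L2_integrable mA fA Ldpsi.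
have cK k : continuous (approx_unit k : 'rV[R]_N -> R).
  by apply: smooth_continuous; exact: approx_unit_smooth.
have cdK k : continuous (partial i (approx_unit k) : 'rV[R]_N -> R).
  by apply: smooth_continuous; apply: smooth_partial; exact: approx_unit_smooth.
have [K [cK' KA p0]] := spsi.
have E : \forall k \near \oo, \int[mu]_(x in A) (u x * kop A (approx_unit k) (partial i psi) x) =
    - \int[mu]_(x in A) (g x ord0 i * kop A (approx_unit k) psi x).
  apply: filterS (approx_unit_test cK' oA KA) => k tk.
  have -> : \int[mu]_(x in A) (u x * kop A (approx_unit k) (partial i psi) x) =
      \int[mu]_(x in A) (u x * kop A (partial i (approx_unit k)) psi x).
    by apply: eq_Rintegral => x _; rewrite mollify_partial.
  rewrite (kop_adjoint mA bA mA bA (cdK k) iu ipsi).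
  rewrite (kop_adjoint mA bA mA bA (cK k) ig ipsi).
  have Lk : L2 A (kop A (fun z => approx_unit k (- z)) (fun x => g x ord0 i)).
    by apply: kop_L2 => //; exact: continuous_reflect.
  rewrite -[RHS]mulN1r -(RintegralZl (-1) mA (L2_mul_integrable mA Lpsi Lk)).
  apply: eq_Rintegral => y _; have [Ky|/p0 ->] := pselect (K y); last by rewrite !mul0r mulr0.
  rewrite mulN1r -mulrN; congr (_ * _).
  have := dg _ i (tk y Ky); rewrite /kop.
  have -> : \int[lebesgue_rV N]_(x in A) (u x * partial i (fun x => approx_unit k (x - y)) x) =
     \int[mu]_(x in A) (partial i (approx_unit k) (- (y - x)) * u x).
    by apply: eq_Rintegral => x _; rewrite partial_approx_unit_l opprB mulrC.
  move=> ->; congr (- _); apply: eq_Rintegral => x _; by rewrite opprB mulrC.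
(* Mollified functions converge pointwise and are bounded uniformly in k, so dominated convergence
   applies to both sides of the identity. *)
have lim (w F : 'rV[R]_N -> R) : L2 A w -> L2 A F -> continuous F -> csupp_in A F ->
    \int[mu]_(x in A) (w x * kop A (approx_unit k) F x) @[k --> \oo] -->
    \int[mu]_(x in A) (w x * F x).
  move=> Lw LF cF sF; have [C C0 hC] := mollify_bounded cF sF.
  have iF := L2_integrable mA fA LF; have iw := L2_integrable mA fA Lw.
  apply: (dominated_convergence_Rintegral (g := fun x => C * `|w x|) mA).
  - move=> k; apply: measurable_funM; first exact: Lw.1.
    exact: (kop_measurable mA bA mA bA (cK k) iF).
  - by apply: measurable_funM; [exact: Lw.1|exact: LF.1].
  - by move=> x _; apply: cvgMr; exact: mollify_cvg.
  - have := integrableZl mA C (integrable_abse iw); apply: eq_integrable => // x _ /=.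
  - by move=> k x _; rewrite normrM mulrC ler_wpM2r.
have l1 := lim u _ Lu Ldpsi cdp sdp; have l2 := lim _ _ (Lg i) Lpsi cp spsi.
apply: (cvg_unique _ l1) => //.
have {}E : \forall k \near \oo,
    (- \int[mu]_(x in A) (g x ord0 i * kop A (approx_unit k) psi x)) =
    (\int[mu]_(x in A) (u x * kop A (approx_unit k) (partial i psi) x)) :> R.
  by apply: filterS E.
by apply: cvg_trans (cvgN l2); exact: near_eq_cvg E.
Qed.

End mollification.

(** * Boundary fluxes *)
Section flux.
Context {R : realType} {N : nat}.
Let mu := @lebesgue_rV R N.
Variable A : set 'rV[R]_N.
Hypotheses (oA : open A) (bA : bounded_set A).
Implicit Types (zeta rho phi : 'rV[R]_N -> R).

Let mA : measurable A. Proof. exact: open_measurable_rV. Qed.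
Let fA : (mu A < +oo)%E. Proof. exact: bounded_mu_fin. Qed.

Variables (X : 'I_N -> 'rV[R]_N -> R) (C : R).
Hypotheses (cX : forall i, C1_on A (X i)) (bX : forall i x, A x -> `|X i x| <= C)
  (bdX : forall i j x, A x -> `|partial j (X i) x| <= C).
Variables (phi : 'rV[R]_N -> R) (g : 'rV[R]_N -> 'rV[R]_N).
Hypotheses (Lphi : L2 A phi) (wg : is_weak_gradient A phi g).

Definition field (Y : 'I_N -> 'rV[R]_N -> R) x : 'rV[R]_N := \row_i Y i x.
Definition divergence (Y : 'I_N -> 'rV[R]_N -> R) x : R := \sum_i partial i (Y i) x.

(** This is div (phi X), with g standing for the gradient of phi. *)
Definition weak_div x := dotp (field X x) (g x) + divergence X x * phi x.

(* The density div (zeta phi X), for phi in H1 with weak gradient g: by the divergence theorem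
   [flux zeta] is the flux of zeta phi X through the boundary. *)
Definition flux_density zeta x :=
  zeta x * weak_div x + dotp (grad zeta x) (field X x) * phi x.

Definition flux zeta := \int[mu]_(x in A) flux_density zeta x.

Lemma smooth_bounded_on zeta : smooth zeta -> exists2 D, 0 <= D & forall x, A x -> `|zeta x| <= D.
Proof.
move=> /smooth_continuous cz; have [M _ hM] := bounded_cbox bA.
have [D D0 hD] := continuous_compact_bound (@compact_cbox R N (const_mx (- M)) (const_mx M))
  (continuous_subspaceT cz).
by exists D => // x /hM; exact: hD.
Qed.

Let LX i : L2 A (X i).
Proof.
apply: (L2_bounded mA fA _ (bX i)); apply: continuous_in_measurable_rV => // x Ax.
exact: C1_on_continuous Ax.
Qed.

Let LdX i j : L2 A (partial j (X i)).
Proof.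
apply: (L2_bounded mA fA _ (bdX i j)); apply: continuous_in_measurable_rV => // x Ax.
by have [_] := cX i Ax; exact.
Qed.

Let L2sum (F : 'I_N -> 'rV[R]_N -> R) : (forall i, L2 A (F i)) -> L2 A (fun x => \sum_i F i x).
Proof.
move=> h; elim: (index_enum _) => [|j s ih].
  by under eq_fun do rewrite big_nil; exact: L2_cst.
by under eq_fun do rewrite big_cons; exact: L2D.
Qed.

Let Int (f : 'rV[R]_N -> R) := mu.-integrable A (EFin \o f).

Let IntD f h : Int f -> Int h -> Int (fun x => f x + h x).
Proof. exact: integrable_addr. Qed.

Let Int_sum (F : 'I_N -> 'rV[R]_N -> R) : (forall i, Int (F i)) -> Int (fun x => \sum_i F i x).
Proof. exact: integrable_sumr. Qed.

Let IntMb f (b : 'rV[R]_N -> R) D : Int f -> measurable_fun A b -> (forall x, A x -> `|b x| <= D) ->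
  Int (fun x => b x * f x).
Proof.
move=> hf mb hb; apply: (@le_integrable_real _ _ _ mA _ (fun x => D * `|f x|)).
- by apply: measurable_funM => //; apply/measurable_EFinP; exact: (measurable_int _ hf).
- by move=> x Ax; rewrite normrM ler_wpM2r// hb.
- by have := integrableZl mA D (integrable_abse hf); apply: eq_integrable.
Qed.

Lemma weak_div_integrable : Int weak_div.
Proof.
apply: IntD; last by apply: L2_mul_integrable => //; exact: L2sum.
apply: Int_sum => i.
have := L2_mul_integrable mA (LX i) (wg.1 i).
by apply: eq_integrable => // x _ /=; rewrite mxE.
Qed.

Lemma grad_dot_L2 zeta : smooth zeta -> L2 A (fun x => dotp (grad zeta x) (field X x)).
Proof.
move=> sz; apply: L2sum => i.
have [D D0 hD] := smooth_bounded_on (smooth_partial i sz).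
apply: (L2_eq_in mA _ (L2_mul_bounded mA _ hD (LX i))); last first.
  by apply: continuous_measurable_rV => //; apply: smooth_continuous; exact: smooth_partial.
by move=> x _; rewrite !mxE.
Qed.

Lemma flux_density_integrable zeta : smooth zeta -> Int (flux_density zeta).
Proof.
move=> sz; apply: IntD; last by apply: L2_mul_integrable => //; exact: grad_dot_L2.
have [D D0 hD] := smooth_bounded_on sz.
apply: IntMb hD; first exact: weak_div_integrable.
by apply: continuous_measurable_rV => //; exact: smooth_continuous.
Qed.

Lemma grad_mul zeta chi x : differentiable zeta x -> differentiable chi x ->
  grad (fun y => zeta y * chi y) x = zeta x *: grad chi x + chi x *: grad zeta x.
Proof. by move=> dz dc; apply/rowP => i; rewrite !mxE partialM. Qed.

Lemma dotpDl (x y z : 'rV[R]_N) : dotp (x + y) z = dotp x z + dotp y z.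
Proof. by rewrite /dotp -big_split; apply: eq_bigr => i _; rewrite mxE mulrDl. Qed.

Lemma dotpZl (a : R) (x y : 'rV[R]_N) : dotp (a *: x) y = a * dotp x y.
Proof. by rewrite /dotp mulr_sumr; apply: eq_bigr => i _; rewrite mxE mulrA. Qed.

(** Each product zeta X_i is a compactly supported C^1 function; testing the weak gradient of phi
    against it cancels the i-th terms of the density. *)
Lemma flux_test zeta : test_function A zeta -> flux zeta = 0.
Proof.
move=> tz; have /test_functionP[sz cz] := tz.
have F i x : A x -> partial i (fun y => zeta y * X i y) x = zeta x * partial i (X i) x + X i x * partial i zeta x.
  by move=> Ax; apply: partialM; [exact: smooth_differentiable|have [] := cX i Ax].
have [D D0 hD] := smooth_bounded_on sz.
have mz : measurable_fun A zeta by apply: continuous_measurable_rV => //; exact: smooth_continuous.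
have LzX i : L2 A (fun x => zeta x * X i x) by exact: (L2_mul_bounded mA mz hD (LX i)).
have LdzX i : L2 A (partial i (fun y => zeta y * X i y)).
  have [D' _ hD'] := smooth_bounded_on (smooth_partial i sz).
  have mdz : measurable_fun A (partial i zeta).
    by apply: continuous_measurable_rV => //; apply: smooth_continuous; exact: smooth_partial.
  apply: (L2_eq_in mA _ (L2D mA (L2_mul_bounded mA mz hD (LdX i i)) (L2_mul_bounded mA mdz hD' (LX i)))).
  by move=> x Ax; rewrite F// (mulrC (X i x)).
have W i : \int[mu]_(x in A) (phi x * partial i (fun y => zeta y * X i y) x
    + 1 * (g x ord0 i * (zeta x * X i x))) = 0.
  have i1 := L2_mul_integrable mA Lphi (LdzX i).
  have i2 := L2_mul_integrable mA (wg.1 i) (LzX i).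
  under eq_Rintegral do rewrite mul1r.
  rewrite RintegralD// (weak_gradient_C1_csupp oA bA i Lphi wg); first by rewrite addNr.
    by apply: C1_onM => //; exact: smooth_C1_on.
  exact: csupp_inM.
have Ii i : Int (fun x => phi x * partial i (fun y => zeta y * X i y) x
    + 1 * (g x ord0 i * (zeta x * X i x))).
  apply: IntD; first exact: L2_mul_integrable.
  have := L2_mul_integrable mA (wg.1 i) (LzX i).
  by apply: eq_integrable => // x _ /=; rewrite mul1r.
transitivity (\sum_i \int[mu]_(x in A) (phi x * partial i (fun y => zeta y * X i y) x
    + 1 * (g x ord0 i * (zeta x * X i x)))); last by apply: big1 => i _; exact: W.
rewrite -(Rintegral_sumr mA _ Ii); apply: eq_Rintegral => x; rewrite inE => Ax.
rewrite /flux_density /weak_div /divergence /dotp mulrDr !mulr_sumr !mulr_suml mulr_sumr -!big_split /=.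
by apply: eq_bigr => i _; rewrite F// !mxE; ring.
Qed.

End flux.

(** * Local flux as a limit over layers along the boundary *)

Section cutoff.
Context {R : realType} {N : nat}.
Let mu := @lebesgue_rV R N.
Variable rho : 'rV[R]_N -> R.
Hypothesis srho : smooth rho.

(* Vanishes for rho >= -1/(k+1) and equals 1 for rho <= -2/(k+1), where rho < 0 in A. *)
Definition cutoff (k : nat) x : R := step (- (k.+1%:R * rho x) - 1).

Lemma cutoff_smooth k : smooth (cutoff k).
Proof.
apply: elementary_rVP.
apply: (elementary_rV_comp (h := fun t => step (- (k.+1%:R * t) - 1)) _ (elementary_rV_smooth srho)).
apply: (elementary_comp step_elementary).
apply: elementaryB; last exact: elementary_cst.
by apply: elementaryN; apply: elementaryM; [exact: elementary_cst|exact: elementary_id].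
Qed.

Lemma cutoff_norm k x : `|cutoff k x| <= 1.
Proof. by rewrite ger0_norm ?step_ge0 ?step_le1. Qed.

Lemma cutoff_out k x : cutoff k x != 0 -> rho x <= - k.+1%:R^-1.
Proof.
apply: contraNT; rewrite -ltNge => h; rewrite /cutoff step_le0//.
by rewrite subr_le0 lerNl -ler_pdivrMl// mulrN1 ltW.
Qed.

Lemma grad_cutoff k x :
  grad (cutoff k) x = (- (k.+1%:R * dstep (- (k.+1%:R * rho x) - 1))) *: grad rho x.
Proof.
apply/rowP => i; rewrite !mxE /partial.
have dr : differentiable rho x by exact: smooth_differentiable.
have h1 : is_derive x (delta_mx ord0 i) (fun y => - (k.+1%:R * rho y) - 1)
    (- (k.+1%:R * partial i rho x)).
  have h := is_deriveB (is_deriveN (is_deriveM (is_derive_cst (k.+1%:R : R) x (delta_mx ord0 i))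
     (differentiable_partial i dr))) (is_derive_cst (1 : R) x (delta_mx ord0 i)).
  by apply: (is_derive_eq h); rewrite /GRing.scale /= mulr0 addr0 subr0.
have da : differentiable (fun y => - (k.+1%:R * rho y) - 1) x.
  have s : smooth (fun y => - (k.+1%:R * rho y) - 1).
    apply: elementary_rVP; apply: elementary_rVD; last exact: elementary_rV_cst.
    apply: (elementary_rV_comp (h := fun t => - (k.+1%:R * t)) _ (elementary_rV_smooth srho)).
    by apply: elementaryN; apply: elementaryM; [exact: elementary_cst|exact: elementary_id].
  exact: smooth_differentiable.
have h := is_derive_comp_diff (delta_mx ord0 i) da (is_derive_step _).
rewrite (@derive_val _ _ _ _ _ _ _ h) (@derive_val _ _ _ _ _ _ _ h1) /partial.
by move: (dstep _) ('D_(delta_mx ord0 i) rho x) => a b; ring.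
Qed.

Lemma near_cutoff_arg x : rho x < 0 -> \forall k \near \oo, 1 < - (k.+1%:R * rho x) - 1.
Proof.
move=> r0; have r0' : 0 < - rho x by rewrite oppr_gt0.
near=> k; rewrite ltrBrDr -mulrN -ltr_pdivrMr//.
rewrite (@lt_le_trans _ _ k%:R)// ?ler_nat//.
by near: k; exact: nbhs_infty_gtr.
Unshelve. all: by end_near. Qed.

Lemma dstep_bounded : exists2 D, 0 <= D & forall t : R, `|dstep t| <= D.
Proof.
have [D D0 hD] := continuous_compact_bound (@segment_compact R 0 1)
  (continuous_subspaceT (elementary_continuous dstep_elementary)).
exists D => // t; have [t0|t0] := ltP t 0; first by rewrite dstep_lt0// normr0.
have [t1|t1] := ltP 1 t; first by rewrite dstep_gt1// normr0.
by apply: hD; rewrite /= in_itv /= t0.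
Qed.

Variables A V K : set 'rV[R]_N.
Hypotheses (oA : open A) (bA : bounded_set A) (cK : compact K) (KV : K `<=` V).
Hypothesis AV : forall x, V x -> A x <-> rho x < 0.
Variable zeta : 'rV[R]_N -> R.
Hypotheses (sz : smooth zeta) (z0 : forall x, ~ K x -> zeta x = 0).

Let mA : measurable A. Proof. exact: open_measurable_rV. Qed.
Let fA : (mu A < +oo)%E. Proof. exact: bounded_mu_fin. Qed.

Variables (X : 'I_N -> 'rV[R]_N -> R) (C : R).
Hypotheses (cX : forall i, C1_on A (X i)) (bX : forall i x, A x -> `|X i x| <= C)
  (bdX : forall i j x, A x -> `|partial j (X i) x| <= C).
Variables (phi : 'rV[R]_N -> R) (g : 'rV[R]_N -> 'rV[R]_N).
Hypotheses (Lphi : L2 A phi) (wg : is_weak_gradient A phi g).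

(** The condition rho <= - 1/(k+1) is closed and, within K, keeps the support inside A. *)
Lemma cutoff_test k : test_function A (fun x => zeta x * cutoff k x).
Proof.
apply/test_functionP; split.
  by apply: elementary_rVP; apply: elementary_rVM; apply: elementary_rV_smooth => //; exact: cutoff_smooth.
have crho : continuous rho by exact: smooth_continuous.
exists (K `&` (rho @^-1` [set t | t <= - k.+1%:R^-1])); split.
- apply: (subclosed_compact _ cK); last exact: subIsetl.
  apply: closedI; first exact: compact_closed_rV.
  by apply: closed_comp => [x _|]; [exact: crho|exact: closed_le].
- move=> x [Kx /= rx]; apply/(AV (KV Kx)); apply: (le_lt_trans rx).
  by rewrite oppr_lt0.
- move=> x h; have [Kx|/z0 ->] := pselect (K x); last by rewrite mul0r.
  have [->|h'] := eqVneq (cutoff k x) 0; first by rewrite mulr0.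
  by exfalso; apply: h; split=> //; exact: cutoff_out h'.
Qed.

Lemma flux_density_out x : ~ K x -> flux_density X phi g zeta x = 0.
Proof.
move=> Kx; rewrite /flux_density z0// mul0r add0r /dotp big1 ?mul0r// => i _.
by rewrite !mxE (csupp_partial0 i cK z0 Kx) mul0r.
Qed.

(** The flux weighted by zeta chi_k vanishes. By the product rule the term in grad chi_k is then
    minus the integral of chi_k times the density of zeta, and chi_k tends to 1 wherever that
    density is nonzero in A. *)
Lemma cutoff_limit :
  \int[mu]_(x in A) (zeta x * (dotp (grad (cutoff k) x) (field X x) * phi x)) @[k --> \oo] -->
  - flux A X phi g zeta.
Proof.
have ifd := flux_density_integrable oA bA cX bX bdX Lphi wg sz.
have E k : \int[mu]_(x in A) (zeta x * (dotp (grad (cutoff k) x) (field X x) * phi x)) =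
    - \int[mu]_(x in A) (cutoff k x * flux_density X phi g zeta x).
  have sc := cutoff_smooth k.
  have := flux_test oA bA cX bX bdX Lphi wg (cutoff_test k).
  have [D D0 hD] := smooth_bounded_on bA sz.
  have mz : measurable_fun A zeta by apply: continuous_measurable_rV => //; exact: smooth_continuous.
  have mc : measurable_fun A (cutoff k).
    by apply: continuous_measurable_rV => //; exact: smooth_continuous.
  have i1 : mu.-integrable A (EFin \o (fun x => cutoff k x * flux_density X phi g zeta x)).
    apply: (le_integrable_real mA _ _ (integrable_abse ifd)).
      by apply: measurable_funM => //; apply/measurable_EFinP; exact: (measurable_int _ ifd).
    by move=> x _; rewrite normrM ler_piMl// cutoff_norm.
  have i2 : mu.-integrable A (EFin \o (fun x => zeta x * (dotp (grad (cutoff k) x) (field X x) * phi x))).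
    have Lg := grad_dot_L2 oA bA cX bX sc.
    have := L2_mul_integrable mA (L2_mul_bounded mA mz hD Lg) Lphi.
    by apply: eq_integrable => // x _ /=; rewrite mulrA.
  rewrite /flux => e; apply/eqP; rewrite -addr_eq0 -RintegralD// -[X in _ == X]e; apply/eqP.
  apply: eq_Rintegral => x _; rewrite /flux_density.
  rewrite grad_mul; [|exact: smooth_differentiable|exact: smooth_differentiable].
  by rewrite dotpDl !dotpZl; ring.
rewrite (_ : (fun k => _) = (fun k => - \int[mu]_(x in A) (cutoff k x * flux_density X phi g zeta x))); last first.
  by apply/funext => k; exact: E.
apply: cvgN.
apply: (dominated_convergence_Rintegral (g := fun x => `|flux_density X phi g zeta x|) mA).
- move=> k; apply: measurable_funM; last by apply/measurable_EFinP; exact: (measurable_int _ ifd).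
  by apply: continuous_measurable_rV => //; apply: smooth_continuous; exact: cutoff_smooth.
- by apply/measurable_EFinP; exact: (measurable_int _ ifd).
- move=> x Ax; apply: cvg_near_cst; have [Kx|/flux_density_out ->] := pselect (K x); last first.
    by apply: nearW => k; rewrite mulr0.
  have rx : rho x < 0 by apply/(AV (KV Kx)).
  apply: filterS (near_cutoff_arg rx) => k hk.
  by rewrite /cutoff step_ge1 ?mul1r// ltW.
- exact: (integrable_abse ifd).
- by move=> k x _; rewrite normrM ler_piMl// cutoff_norm.
Qed.

Lemma flux_eq0 (C' : R) :
  (forall x, A x -> K x -> `|dotp (grad rho x) (field X x)| <= C' * `|rho x|) ->
  flux A X phi g zeta = 0.
Proof.
move=> hC; apply: oppr_inj; rewrite oppr0.
have [D D0 hD] := dstep_bounded; have [Z Z0 hZ] := smooth_bounded_on bA sz.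
have C'' : 0 <= `|C'| * (D * 2) by rewrite !mulr_ge0.
have mz : measurable_fun A zeta by apply: continuous_measurable_rV => //; exact: smooth_continuous.
apply: (cvg_unique _ cutoff_limit) => //.
have -> : 0 = \int[mu]_(x in A) (cst 0 x) by rewrite Rintegral_cst// mul0r.
apply: (dominated_convergence_Rintegral (g := fun x => (Z * (`|C'| * (D * 2))) * `|phi x|) mA).
- move=> k; apply: measurable_funM => //; apply: measurable_funM; last exact: Lphi.1.
  exact: (grad_dot_L2 oA bA cX bX (cutoff_smooth k)).1.
- exact: measurable_cst.
(* For fixed x in A the transition layer eventually leaves x behind, so the integrand is zero for
   large k. *)
- move=> x Ax; apply: cvg_near_cst; have [Kx|/z0 ->] := pselect (K x); last first.
    by apply: nearW => k; rewrite mul0r.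
  have rx : rho x < 0 by apply/(AV (KV Kx)).
  apply: filterS (near_cutoff_arg rx) => k hk.
  by rewrite grad_cutoff dstep_gt1// mulr0 oppr0 scale0r /dotp big1 ?mul0r ?mulr0// => i _; rewrite mxE mul0r.
- have := integrableZl mA (Z * (`|C'| * (D * 2))) (integrable_abse (L2_integrable mA fA Lphi)).
  by apply: eq_integrable.
- move=> k x Ax; rewrite mulrA normrM ler_wpM2r// normrM.
  have [Kx|/z0 ->] := pselect (K x); last by rewrite normr0 mul0r mulr_ge0.
  apply: ler_pM => //; first exact: hZ.
  rewrite grad_cutoff dotpZl normrM normrN normrM ger0_norm//.
  set a := - (k.+1%:R * rho x) - 1.
  have [->|da] := eqVneq (dstep a) 0; first by rewrite normr0 mulr0 mul0r.
  have a1 : a <= 1 by rewrite leNgt; apply: contraNN da => /dstep_gt1 ->.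
  have rx : rho x < 0 by apply/(AV (KV Kx)).
  (* Where [dstep a] is nonzero one has a <= 1, that is (k+1) |rho| <= 2; this absorbs the factor
     k+1 of the cutoff gradient. *)
  have h1 : k.+1%:R * `|rho x| <= 2.
    by rewrite ltr0_norm// mulrN; move: a1; rewrite /a lerBlDr -(natrD _ 1 1).
  have h2 := hC x Ax Kx.
  have h3 : `|dotp (grad rho x) (field X x)| <= `|C'| * `|rho x|.
    by rewrite (le_trans h2)// ler_wpM2r// ler_norm.
  rewrite (le_trans (ler_wpM2l _ h3))//.
  rewrite [leLHS](_ : _ = `|C'| * (`|dstep a| * (k.+1%:R * `|rho x|))); last by ring.
  by rewrite ler_wpM2l// ler_pM// mulr_ge0.
Qed.

End cutoff.

(** * Bounds and traces for functions of class C^2 up to the boundary *)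

Section C2_closure_theory.
Context {R : realType} {N : nat}.
Implicit Types (A : set 'rV[R]_N) (u : 'rV[R]_N -> R).

Lemma uniform_bound (I : finType) (T : Type) (D : set T) (f : I -> T -> R) :
  (forall i, exists C, forall x, D x -> `|f i x| <= C) ->
  exists C, forall i x, D x -> `|f i x| <= C.
Proof.
move=> /choice[C hC]; exists (\sum_i `|C i|) => i x Dx.
rewrite (le_trans (hC i x Dx))// (bigD1 i)//= (le_trans (ler_norm _))// lerDl.
by apply: sumr_ge0 => j _.
Qed.

Lemma compact_closure_bounded A : bounded_set A -> compact (closure A).
Proof.
move=> /bounded_cbox[M _ hM].
apply: (subclosed_compact (@closed_closure _ _) (@compact_cbox R N (const_mx (- M)) (const_mx M))).
by rewrite [X in _ `<=` X](closure_id _).1; [exact: closureS|exact: closed_cbox].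
Qed.

Lemma C2_closure_bound A u s : bounded_set A -> C2_closure A u -> (size s <= 2)%N ->
  exists C, forall x, A x -> `|iter_partial s u x| <= C.
Proof.
move=> bA [_ h] /h[g [cg e]].
have [C _ hC] := continuous_compact_bound (compact_closure_bounded bA) cg.
by exists C => x Ax; rewrite -e//; apply: hC; exact: subset_closure.
Qed.

Lemma C2_closure_bounds A u : bounded_set A -> C2_closure A u -> exists C,
  (forall i x, A x -> `|partial i u x| <= C) /\
  (forall i j x, A x -> `|partial j (partial i u) x| <= C).
Proof.
move=> bA cu.
have [C1 h1] := uniform_bound (fun i : 'I_N => C2_closure_bound bA cu (isT : (size [:: i] <= 2)%N)).
have [C2 h2] := uniform_bound (fun p : 'I_N * 'I_N =>
  C2_closure_bound bA cu (isT : (size [:: p.2; p.1] <= 2)%N)).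
exists (Num.max C1 C2); split=> [i x Ax|i j x Ax].
  by rewrite le_max (h1 i x Ax).
by rewrite le_max (h2 (i, j) x Ax) orbT.
Qed.

Lemma within_closure_cvg A (g : 'rV[R]_N -> R) (x : 'rV[R]_N) : {within closure A, continuous g} ->
  closure A x -> g y @[y --> within A (nbhs x)] --> g x.
Proof.
move=> cg Ax; have h0 := (subspace_continuousP _ _).1 cg x Ax.
move=> P hP; have := h0 P hP; rewrite /nbhs /= /within /=.
by apply: filterS => y hy Ay; apply: hy; exact: subset_closure.
Qed.

(** Differentiability is given up to first order partial derivatives; the continuity of the second
    order ones comes from their continuous extensions to the closure. *)
Lemma C2_closure_C1 A u : open A -> C2_closure A u ->
  C1_on A u /\ forall i, C1_on A (partial i u).
Proof.
move=> oA [d h].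
have d0 x : A x -> differentiable u x by exact: (d [::] x isT).
have d1 i x : A x -> differentiable (partial i u) x by exact: (d [:: i] x isT).
split=> [x Ax|i x Ax].
  by split=> [|i]; [exact: d0|apply: differentiable_continuous; exact: d1].
split=> [|j]; first exact: d1.
have [g [cg e]] := h [:: j; i] isT.
apply: (open_near_eq_cvg oA Ax (fun y Ay => esym (e y Ay))).
have cA : closure A x by exact: subset_closure.
have := within_closure_cvg cg cA.
rewrite /continuous_at; apply: cvg_trans; apply: cvg_app => P.
rewrite /within /= => hP; apply: filterS2 (open_nbhs_nbhs (conj oA Ax)) hP => y Ay; exact.
Qed.

Lemma C2_closure_trace A u i x : C2_closure A u -> closure A x ->
  exists c : R, partial i u y @[y --> within A (nbhs x)] --> c.
Proof.
move=> [_ h] Ax; have [g [cg e]] := h [:: i] isT; exists (g x).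
have l := within_closure_cvg cg Ax.
apply: cvg_trans l; apply: near_eq_cvg.
by apply: filterS (withinT A (nbhs_filter x)) => y Ay; rewrite e.
Qed.

End C2_closure_theory.

(** * The outward normal does not depend on the defining function *)

Section normals.
Context {R : realType} {N : nat}.
Implicit Types (A : set 'rV[R]_N) (rho : 'rV[R]_N -> R) (x v : 'rV[R]_N).

Lemma derive_dotp (f : 'rV[R]_N -> R) x v : differentiable f x -> 'D_v f x = dotp (grad f x) v.
Proof.
move=> df; rewrite deriveE// [in LHS](row_sum_delta v) linear_sum.
by apply: eq_bigr => i _; rewrite linearZ /= mxE /partial deriveE// mulrC.
Qed.

Lemma derive_pos_near (f : 'rV[R]_N -> R) x v : differentiable f x -> f x = 0 ->
  0 < dotp (grad f x) v -> \forall t \near (0 : R)^'+, 0 < f (t *: v + x).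
Proof.
move=> df f0 d0; have dv : derivable f x v by exact: diff_derivable.
have /cvg_dnbhs_at_right c : h^-1 *: ((f \o shift x) (h *: v) - f x) @[h --> (0:R)^'] --> 'D_v f x.
  exact: dv.
have : \forall t \near (0 : R)^'+, 0 < t^-1 *: ((f \o shift x) (t *: v) - f x).
  by apply: (cvgr_gt _ c); rewrite derive_dotp.
move=> h; near=> t.
have t0 : 0 < t by near: t; exact: nbhs_right_gt.
have : 0 < t^-1 *: ((f \o shift x) (t *: v) - f x) by near: t.
by rewrite /= f0 subr0 /GRing.scale /= pmulr_rgt0// invr_gt0.
Unshelve. all: by end_near. Qed.

(** A negative value would put x in the open set A, a positive one would keep A away from x. *)
Lemma boundary_defining0 A x rho : open A -> boundary A x -> continuous rho ->
  (\forall y \near x, A y <-> rho y < 0) -> rho x = 0.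
Proof.
move=> oA [cA nA] crho h; apply/eqP; rewrite eq_le; apply/andP; split; last first.
  rewrite leNgt; apply/negP => r0; apply: nA.
  exact: open_nbhs_nbhs (conj oA ((nbhs_singleton h).2 r0)).
rewrite leNgt; apply/negP => r0.
have h0 : \forall y \near x, 0 < rho y by apply: (cvgr_gt _ (crho x)).
have [y [Ay []]] := cA _ (filterI h h0).
by move=> [/(_ Ay) h1 _] h2; move: (lt_trans h1 h2); rewrite ltxx.
Qed.

Lemma dotp_sqr_gt0 x : x != 0 -> 0 < dotp x x.
Proof.
move=> x0; rewrite lt_neqAle eq_sym; apply/andP; split; last first.
  by apply: sumr_ge0 => i _; rewrite -expr2 sqr_ge0.
apply: contra x0 => /eqP h; apply/eqP/rowP => i; rewrite mxE; apply/eqP.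
have := (psumr_eq0P (fun i _ => _) h) i isT.
move=> /(_ _)/eqP; rewrite mulf_eq0 orbb; apply.
by move=> j; rewrite -expr2 sqr_ge0.
Qed.

Lemma enorm_gt0 x : x != 0 -> 0 < enorm x.
Proof. by move=> x0; rewrite sqrtr_gt0 dotp_sqr_gt0. Qed.

Lemma dotpZr (a : R) x v : dotp x (a *: v) = a * dotp x v.
Proof. by rewrite dotpC dotpZl dotpC. Qed.

Lemma dotpDr x v w : dotp x (v + w) = dotp x v + dotp x w.
Proof. by rewrite dotpC dotpDl !(dotpC x). Qed.

Lemma dotpNr x v : dotp x (- v) = - dotp x v.
Proof. by rewrite -scaleN1r dotpZr mulN1r. Qed.

Lemma dotpNl x v : dotp (- x) v = - dotp x v.
Proof. by rewrite -scaleN1r dotpZl mulN1r. Qed.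

Lemma enorm_unit x : x != 0 -> dotp ((enorm x)^-1 *: x) ((enorm x)^-1 *: x) = 1.
Proof.
move=> x0; rewrite dotpZl dotpZr.
have -> : dotp x x = enorm x ^+ 2 by rewrite sqr_sqrtr// ltW// dotp_sqr_gt0.
by field; rewrite gt_eqF// enorm_gt0.
Qed.

(** If the unit normals a and b differ, then along v = b - a the function r1 decreases and r2
    increases from 0, so the points x + t v with small t > 0 lie in A according to r1 and not
    according to r2. *)
Lemma normal_unique A x r1 r2 : open A -> boundary A x ->
  defining_function A x r1 -> defining_function A x r2 ->
  (enorm (grad r1 x))^-1 *: grad r1 x = (enorm (grad r2 x))^-1 *: grad r2 x.
Proof.
move=> oA bx [s1 n1 h1] [s2 n2 h2].
have z1 := boundary_defining0 oA bx (smooth_continuous s1) h1.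
have z2 := boundary_defining0 oA bx (smooth_continuous s2) h2.
set a := _ *: grad r1 x; set b := _ *: grad r2 x.
apply/eqP/negPn/negP => ab.
have e1 := enorm_gt0 n1; have e2 := enorm_gt0 n2.
have aa : dotp a a = 1 by exact: enorm_unit.
have bb : dotp b b = 1 by exact: enorm_unit.
have ab1 : dotp a b < 1.
  have := dotp_sqr_gt0 (_ : a - b != 0); rewrite subr_eq0 => /(_ ab).
  rewrite dotpDl dotpNl !dotpDr !dotpNr aa bb (dotpC b a).
  by move: (dotp a b) => t; lra.
have ga : grad r1 x = enorm (grad r1 x) *: a by rewrite scalerA divff ?scale1r// gt_eqF.
have gb : grad r2 x = enorm (grad r2 x) *: b by rewrite scalerA divff ?scale1r// gt_eqF.
have p1 : 0 < dotp (grad r1 x) (a - b).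
  by rewrite ga dotpZl dotpDr dotpNr aa mulr_gt0// subr_gt0.
have p2 : 0 < dotp (grad r2 x) (b - a).
  by rewrite gb dotpZl dotpDr dotpNr bb (dotpC b a) mulr_gt0// subr_gt0.
pose v := b - a.
have r1neg : \forall t \near (0 : R)^'+, r1 (t *: v + x) < 0.
  have s1' : smooth (fun y => (-1) * r1 y).
    by apply: elementary_rVP; apply: elementary_rVM; [exact: elementary_rV_cst|exact: elementary_rV_smooth].
  have := @derive_pos_near (fun y => (-1) * r1 y) x v (smooth_differentiable x s1').
  rewrite z1 mulr0 => /(_ erefl); have -> : grad (fun y => (-1) * r1 y) x = - grad r1 x.
    apply/rowP => i; rewrite !mxE partialM; last 2 first.
    + exact: differentiable_cst.
    + exact: smooth_differentiable.
    rewrite mulN1r /partial (@derive_val _ _ _ _ _ _ _ (is_derive_cst (-1 : R) x _)).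
    by rewrite mulr0 addr0.
  rewrite dotpNl -dotpNr opprB => /(_ p1); apply: filterS => t.
  by rewrite mulN1r oppr_gt0.
have r2pos := derive_pos_near (smooth_differentiable x s2) z2 p2.
have c0 : t *: v + x @[t --> (0 : R)^'+] --> x.
  have : t *: v + x @[t --> (0 : R)] --> (0 : R) *: v + x.
    by apply: cvgD; [apply: cvgZr_tmp; exact: cvg_id|exact: cvg_cst].
  rewrite scale0r add0r => h; exact: cvg_at_right_filter h.
have [t [[t1 t2] [t3 t4]]] := filter_ex (filterI (filterI r1neg r2pos) (filterI (c0 _ h1) (c0 _ h2))).
have Ax : A (t *: v + x) by apply/t3.
have := (t4.1 Ax); rewrite /= => t5; by move: (lt_trans t5 t2); rewrite ltxx.
Qed.

End normals.

(** * Growth away from the boundary along coordinate segments *)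

Section boundary_paths.
Context {R : realType} {N : nat}.
Implicit Types (A : set 'rV[R]_N) (rho h : 'rV[R]_N -> R) (x y : 'rV[R]_N).

Lemma is_derive_path (f : 'rV[R]_N -> R) y (v : 'rV[R]_N) (t : R) : differentiable f (t *: v + y) ->
  is_derive t (1 : R) (fun t : R => f (t *: v + y)) (dotp (grad f (t *: v + y)) v).
Proof.
move=> df; have d : is_derive (t *: v + y) v f (dotp (grad f (t *: v + y)) v).
  by apply: DeriveDef; [exact: diff_derivable|exact: derive_dotp].
apply: (@is_derive_affine _ _ _ (fun t : R => t *: v + y) f t 1 _ _ _ d) => k.
have -> : k *: (1 : R) = k by rewrite /GRing.scale /= mulr1.
by rewrite scalerDl addrA.
Qed.

Lemma dotp_delta x (a : R) i : dotp x (a *: delta_mx ord0 i) = a * x ord0 i.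
Proof.
rewrite dotpZr; congr (_ * _); rewrite /dotp (bigD1 i)//= mxE !eqxx mulr1 big1 ?addr0//.
by move=> j ji; rewrite mxE eqxx /= (negbTE ji) mulr0.
Qed.

Lemma mean_value_bound (f df : R -> R) (t M : R) : 0 < t ->
  (forall a, a \in `[0, t] -> is_derive a (1 : R) f (df a)) ->
  (forall a, 0 < a -> a < t -> `|df a| <= M) -> `|f t - f 0| <= M * t.
Proof.
move=> t0 d hM.
have h1 a : a \in `]0, t[ -> is_derive a (1 : R) f (df a).
  by move=> ha; apply: d; exact: subset_itv_oo_cc.
have h2 : {within `[0, t], continuous f}.
  apply: derivable_within_continuous => a ha.
  exact: (@ex_derive _ _ _ _ _ _ _ (d a ha)).
have [a + ->] := MVT t0 h1 h2.
rewrite in_itv /= => /andP[a0 at']; rewrite subr0 normrM (gtr0_norm t0).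
by rewrite ler_wpM2r ?(ltW t0)// hM.
Qed.

(* Moving from y in the direction in which rho increases at rate at least m, one reaches the
   boundary after a time at most |rho y| / m, while h varies at rate at most M. *)
Lemma path_estimate A rho h x0 r m M (s : R) i0 y : open A -> `|s| = 1 ->
  smooth rho -> 0 < m -> 0 <= M ->
  (forall z, ball x0 r z -> A z <-> rho z < 0) ->
  (forall z, ball x0 r z -> m <= s * partial i0 rho z) ->
  (forall z, ball x0 r z -> A z -> differentiable h z /\ `|partial i0 h z| <= M) ->
  (forall z, ball x0 r z -> boundary A z -> h w @[w --> within A (nbhs z)] --> (0 : R)) ->
  ball x0 (r / 2) y -> A y -> `|rho y| < m * (r / 2) ->
  `|h y| <= M / m * `|rho y|.
Proof.
move=> oA s1 srho m0 M0 AV hm hh hbd yB Ay hy.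
have [r20 _] := (ball_rVP _ _ _).1 yB.
pose v : 'rV[R]_N := s *: delta_mx ord0 i0.
pose gam t := t *: v + y.
have gB t : 0 <= t < r / 2 -> ball x0 r (gam t).
  move=> /andP[t0 t1]; apply/ball_rVP; split; first by lra.
  move=> j; have [_ /(_ j) hj] := (ball_rVP _ _ _).1 yB.
  rewrite /gam !mxE opprD addrCA [ltRHS]splitr (le_lt_trans (ler_normD _ _))//.
  apply: ler_ltD => //; rewrite normrN normrM (ger0_norm t0) normrM s1 mul1r.
  apply: le_trans (ltW t1); rewrite ler_piMr//; by case: (_ && _); rewrite ?normr1 ?normr0.
have df t : is_derive t (1 : R) (fun t => rho (gam t)) (s * partial i0 rho (gam t)).
  have := is_derive_path (smooth_differentiable (gam t) srho).
  by rewrite dotp_delta mxE.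
have cf : continuous (fun t => rho (gam t)).
  move=> t; apply/differentiable_continuous/derivable1_diffP.
  exact: (@ex_derive _ _ _ _ _ _ _ (df t)).
have gam0 : gam 0 = y by rewrite /gam scale0r add0r.
have yB' : ball x0 r y by rewrite -gam0; apply: gB; rewrite lexx.
have ry : rho y < 0 by exact/(AV y yB').
(* Time by which rho must have reached 0; the smallness of |rho y| makes it less than r / 2, so the
   path stays in the ball. *)
pose T := `|rho y| / m.
have T0 : 0 < T by rewrite divr_gt0// normr_gt0 lt_eqF.
have Tr : T < r / 2 by rewrite ltr_pdivrMr// mulrC.
have incr a b : 0 <= a -> a < b -> b < r / 2 -> m * (b - a) <= rho (gam b) - rho (gam a).
  move=> a0 ab br; have [c cab ->] := MVT ab (fun t _ => df t) (continuous_subspaceT cf).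
  rewrite ler_wpM2r ?subr_ge0 ?(ltW ab)//; apply: hm; apply: gB.
  move: cab; rewrite in_itv /= => /andP[c1 c2].
  by rewrite (le_trans a0 (ltW c1)) (lt_trans c2 br).
have rT : 0 <= rho (gam T).
  have := incr 0 T (lexx _) T0 Tr; rewrite subr0 gam0 /T mulrC divfK ?gt_eqF// (ltr0_norm ry).
  by rewrite lerBrDr addNr.
have [c cT rc] : exists2 c, c \in `[0, T] & rho (gam c) = 0.
  apply: IVT; [exact: ltW|exact: continuous_subspaceT|].
  by rewrite gam0 ge_min (ltW ry) /= le_max rT orbT.
move: cT; rewrite in_itv /= => /andP[c0 cT].
have {}c0 : 0 < c.
  rewrite lt_neqAle c0 andbT; apply/eqP => c0'; move: rc; rewrite -c0' gam0 => ry0.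
  by move: ry; rewrite ry0 ltxx.
have cr : c < r / 2 by exact: le_lt_trans Tr.
(* As rho increases strictly along the path, it is negative before the time c at which it
   vanishes. *)
have Agam t : 0 <= t < c -> A (gam t).
  move=> /andP[t0 tc]; apply/AV; first by apply: gB; rewrite t0 (lt_trans tc).
  have := incr t c t0 tc cr; rewrite rc sub0r => h1.
  by rewrite -oppr_gt0 (lt_le_trans _ h1)// mulr_gt0// subr_gt0.
have cgam : continuous gam.
  move=> t; apply: cvgD; [apply: cvgZr_tmp; exact: cvg_id|exact: cvg_cst].
have gcB : ball x0 r (gam c) by apply: gB; rewrite (ltW c0).
have bc : boundary A (gam c).
  split; last by move=> /interior_subset /(AV _ gcB); rewrite rc ltxx.
  move=> P hP; have h1 : \forall t \near c^'-, P (gam t).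
    exact: (cvg_at_left_filter (cgam c) hP).
  near (c^'-) => t; exists (gam t); split; last by near: t.
  apply: Agam; apply/andP; split; last by near: t; exact: nbhs_left_lt.
  by near: t; apply: nbhs_left_ge.
have hlim := hbd _ gcB bc.
have hM t : 0 < t -> t < c -> `|h (gam t) - h y| <= M * T.
  move=> t0 tc.
  have dh a : a \in `[0, t] -> is_derive a (1 : R) (fun t => h (gam t)) (s * partial i0 h (gam a)).
    rewrite in_itv /= => /andP[a0 at'].
    have ac : a < c by exact: le_lt_trans tc.
    have [dha _] := hh (gam a) (gB a (introT andP (conj a0 (lt_trans ac cr)))) (Agam a (introT andP (conj a0 ac))).
    by have := is_derive_path dha; rewrite dotp_delta mxE.
  have := mean_value_bound t0 dh; rewrite gam0 => /(_ M) h1.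
  apply: le_trans (h1 _) _; last by rewrite ler_wpM2l// (le_trans (ltW tc)).
  move=> a a0 at'; rewrite normrM s1 mul1r.
  have ac : a < c by exact: lt_trans tc.
  have a0' := ltW a0.
  by have [] := hh (gam a) (gB a (introT andP (conj a0' (lt_trans ac cr)))) (Agam a (introT andP (conj a0' ac))).
(* At the end point h has only a limit from inside A: the mean value bound is taken up to some t <
   c, and e absorbs the remaining value of h. *)
rewrite -mulrA (mulrC m^-1) -/T; apply/ler_addgt0Pr => e e0.
have h1 : \forall w \near within A (nbhs (gam c)), `|h w| < e.
  by have /cvgrPdist_lt/(_ e e0) := hlim; apply: filterS => w; rewrite sub0r normrN.
have h2 : \forall t \near c^'-, A (gam t) -> `|h (gam t)| < e.
  exact: (cvg_at_left_filter (cgam c) h1).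
near (c^'-) => t.
have t0 : 0 < t by near: t; exact: nbhs_left_gt.
have tc : t < c by near: t; exact: nbhs_left_lt.
have At : A (gam t) by apply: Agam; rewrite (ltW t0).
have h3 : `|h (gam t)| < e by move: At; near: t.
have := hM t t0 tc; rewrite distrC => h4.
rewrite -[h y](subrK (h (gam t))) (le_trans (ler_normD _ _))// lerD//.
exact: ltW.
Unshelve. all: by end_near. Qed.

End boundary_paths.

(** * Boundary charts and decay of the conormal component *)

Section boundary_chart.
Context {R : realType} {N : nat}.
Implicit Types (A : set 'rV[R]_N) (rho : 'rV[R]_N -> R) (x y z : 'rV[R]_N).

(** Instead of straightening the boundary, a coordinate is chosen whose partial derivative of rho is
    nonzero at x0; s is its sign and m half its absolute value, a lower bound that persists
    nearby. *)
Lemma boundary_chart A x0 rho : defining_function A x0 rho ->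
  exists i0 (s : R) r m, [/\ `|s| = 1, 0 < m, 0 < r &
    forall z, ball x0 r z -> (A z <-> rho z < 0) /\ m <= s * partial i0 rho z].
Proof.
move=> [srho g0 hA].
have [i0 hi0] : exists i0, partial i0 rho x0 != 0.
  apply: contrapT => h; move/negP: g0; apply; apply/eqP/rowP => i; rewrite !mxE.
  by apply/eqP/negPn/negP => hi; apply: h; exists i.
set p := partial i0 rho x0 in hi0.
have p0 : 0 < `|p| by rewrite normr_gt0.
have cp : continuous (fun z => Num.sg p * partial i0 rho z).
  by apply: continuous_mul; [exact: cst_continuous|exact/smooth_continuous/smooth_partial].
have : \forall z \near x0, `|p| / 2 < Num.sg p * partial i0 rho z.
  by apply: (cvgr_gt _ (cp x0)); rewrite -normrEsg ltr_pdivrMr// ltr_pMr// ltr1n.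
move=> /(filterI hA)/nbhs_ballP[r /= r0 hr].
exists i0, (Num.sg p), r, (`|p| / 2); split=> //.
- by rewrite normr_sg hi0.
- by rewrite divr_gt0.
- by move=> z /hr[h1 h2]; split=> //; exact: ltW.
Qed.

(** The same rho serves at every point of the chart, as the lower bound on one partial derivative
    keeps its gradient nonzero. *)
Lemma chart_defining A rho x0 r i0 (s m : R) z : smooth rho -> 0 < m ->
  (forall z, ball x0 r z -> (A z <-> rho z < 0) /\ m <= s * partial i0 rho z) ->
  ball x0 r z -> defining_function A z rho.
Proof.
move=> srho m0 h zB; split=> //.
  apply/negP => /eqP g0; have [_] := h z zB.
  have -> : partial i0 rho z = grad rho z ord0 i0 by rewrite mxE.
  by rewrite g0 mxE mulr0 leNgt m0.
have : \forall y \near z, ball x0 r y.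
  have [r0 _] := (ball_rVP _ _ _).1 zB.
  have := @open_nbhs_nbhs _ z (ball x0 r) (conj (ball_open x0 r) zB); exact.
by apply: filterS => y /h[].
Qed.

Lemma cvg_finite_sum (T I : Type) (F : set_system T) (s : seq I) (f : I -> T -> R) (a : I -> R) :
  Filter F -> (forall i, f i t @[t --> F] --> a i) ->
  \sum_(i <- s) f i t @[t --> F] --> \sum_(i <- s) a i.
Proof.
move=> FF h; elim: s => [|i s ih].
  by rewrite big_nil; under eq_fun do rewrite big_nil; exact: cvg_cst.
by rewrite big_cons; under eq_fun do rewrite big_cons; exact: cvgD.
Qed.

Lemma cvg_mul_bounded0 (T : Type) (F : set_system T) (f g : T -> R) (C : R) : Filter F ->
  f @ F --> (0 : R) -> (\forall t \near F, `|g t| <= C) -> f t * g t @[t --> F] --> (0 : R).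
Proof.
move=> FF f0 gC; apply/cvgrPdist_lt => e e0.
have C1 : 0 < `|C| + 1 by rewrite ltr_pwDr.
have /cvgrPdist_lt/(_ (e / (`|C| + 1)) (divr_gt0 e0 C1)) := f0.
apply: filterS2 gC => t h1; rewrite !sub0r !normrN => h2.
rewrite normrM; have : `|f t| * `|g t| <= `|f t| * (`|C| + 1).
  by rewrite ler_wpM2l// (le_trans h1)// (le_trans (ler_norm _))// lerDl.
by move=> /le_lt_trans; apply; rewrite -ltr_pdivlMr.
Qed.

Variable A : set 'rV[R]_N.
Hypotheses (oA : open A) (bA : bounded_set A).
Variables (X : 'I_N -> 'rV[R]_N -> R) (C : R).
Hypotheses (cX : forall i, C1_on A (X i)) (bX : forall i x, A x -> `|X i x| <= C)
  (bdX : forall i j x, A x -> `|partial j (X i) x| <= C).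

(** Freezing grad rho at z costs (grad rho(y) - grad rho(z)) . X(y), which tends to 0 because X is
    bounded. *)
Lemma conormal_limit rho z (l : R) : smooth rho ->
  dotp (grad rho z) (field X y) @[y --> within A (nbhs z)] --> l ->
  dotp (grad rho y) (field X y) @[y --> within A (nbhs z)] --> l.
Proof.
move=> srho h.
have -> : (fun y => dotp (grad rho y) (field X y)) =
    (fun y => dotp (grad rho z) (field X y) +
      \sum_i (partial i rho y - partial i rho z) * X i y).
  apply/funext => y; rewrite /dotp -big_split; apply: eq_bigr => i _ /=.
  by rewrite !mxE; ring.
rewrite -[X in _ --> X]addr0; apply: cvgD => //.
suff : \sum_(i < N) (partial i rho y - partial i rho z) * X i y @[y --> within A (nbhs z)] -->
    \sum_(i < N) (0 : R).
  have -> : \sum_(i < N) (0 : R) = 0 by rewrite big1.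
  exact.
apply: cvg_finite_sum => i; apply: (@cvg_mul_bounded0 _ _ _ _ C).
  have cp : continuous (partial i rho) by exact/smooth_continuous/smooth_partial.
  have h1 : partial i rho y @[y --> within A (nbhs z)] --> partial i rho z.
    exact: cvg_within_filter (cp z).
  rewrite -[X in _ --> X](subrr (partial i rho z)).
  by apply: cvgB => //; exact: cvg_cst.
by apply: filterS (withinT A (nbhs_filter z)) => y; exact: bX.
Qed.

Lemma conormal_partial rho j z : smooth rho -> A z ->
  is_derive z (delta_mx ord0 j) (fun y => dotp (grad rho y) (field X y))
    (\sum_i (partial i rho z * partial j (X i) z + X i z * partial j (partial i rho) z)).
Proof.
move=> srho Az.
have -> : (fun y => dotp (grad rho y) (field X y)) = \sum_i (fun y => partial i rho y * X i y).
  by apply/funext => y; rewrite fct_sumE; apply: eq_bigr => i _; rewrite !mxE.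
apply: is_derive_sum => i.
have d1 := differentiable_partial j (smooth_differentiable z (smooth_partial i srho)).
have d2 := differentiable_partial j (cX i Az).1.
exact: (is_deriveM d1 d2).
Qed.

Lemma conormal_differentiable rho z : smooth rho -> A z ->
  differentiable (fun y => dotp (grad rho y) (field X y)) z.
Proof.
move=> srho Az.
have -> : (fun y => dotp (grad rho y) (field X y)) = \sum_i (fun y => partial i rho y * X i y).
  by apply/funext => y; rewrite fct_sumE; apply: eq_bigr => i _; rewrite !mxE.
apply: differentiable_sum => i; apply: differentiableM.
  exact: (smooth_differentiable z (smooth_partial i srho)).
exact: (cX i Az).1.
Qed.

Lemma conormal_partial_bound rho : smooth rho -> exists2 M, 0 <= M &
  forall j z, A z -> `|partial j (fun y => dotp (grad rho y) (field X y)) z| <= M.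
Proof.
move=> srho.
have [D1 h1] : exists D, forall i x, A x -> `|partial i rho x| <= D.
  apply: uniform_bound => i.
  by have [D _ hD] := smooth_bounded_on bA (smooth_partial i srho); exists D.
have [D2 h2] : exists D, forall (p : 'I_N * 'I_N) x, A x -> `|partial p.1 (partial p.2 rho) x| <= D.
  apply: uniform_bound => p.
  by have [D _ hD] := smooth_bounded_on bA (smooth_partial p.1 (smooth_partial p.2 srho)); exists D.
exists (\sum_(i < N) (`|D1| * `|C| + `|C| * `|D2|)).
  by apply: sumr_ge0 => i _; rewrite addr_ge0// mulr_ge0.
move=> j z Az; rewrite /partial (@derive_val _ _ _ _ _ _ _ (conormal_partial j srho Az)).
apply: (le_trans (ler_norm_sum _ _ _)); apply: ler_sum => i _.
have h3 (x y : R) : x <= y -> x <= `|y| by move=> h; exact: le_trans (ler_norm y).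
apply: (le_trans (ler_normD _ _)); rewrite !normrM; apply: lerD; apply: ler_pM => //; apply: h3.
- exact: h1.
- exact: bdX.
- exact: bX.
- exact: (h2 (j, i)).
Qed.

(** Quantified over all defining functions, so that the rho of one chart can be used at each nearby
    boundary point. *)
Definition no_flux := forall z rho, boundary A z -> defining_function A z rho ->
  dotp (grad rho z) (field X y) @[y --> within A (nbhs z)] --> (0 : R).

(** [path_estimate] for h = grad rho . X, which has bounded partial derivatives in A and tends to 0
    at every boundary point of the chart. *)
Lemma conormal_decay x0 rho : no_flux -> boundary A x0 -> defining_function A x0 rho ->
  exists r C', 0 < r /\ forall z, ball x0 r z -> (A z <-> rho z < 0) /\
    (A z -> `|dotp (grad rho z) (field X z)| <= C' * `|rho z|).
Proof.
move=> nX bx dx; have [srho g0 hA] := dx.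
have [i0 [s [r [m [s1 m0 r0 hr]]]]] := boundary_chart dx.
have [M M0 hM] := conormal_partial_bound srho.
have crho := smooth_continuous srho.
have rx := boundary_defining0 oA bx crho hA.
(* Close to x0 the value of rho is so small that the segment from z meets the boundary before
   leaving the chart. *)
have : \forall z \near x0, `|rho z| < m * (r / 2).
  have /cvgrPdist_lt/(_ (m * (r / 2))) := crho x0.
  rewrite rx => /(_ _); rewrite mulr_gt0 ?divr_gt0// => /(_ isT).
  by apply: filterS => z; rewrite sub0r normrN.
have hb : \forall z \near x0, ball x0 (r / 2) z by apply: nbhsx_ballx; rewrite divr_gt0.
move=> /(filterI hb)/nbhs_ballP[q /= q0 hq].
exists q, (M / m); split=> // z /hq[zB hz].
have zB' : ball x0 r z by apply: le_ball zB; rewrite ler_pdivrMr// ler_pMr// ler1n.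
split=> [|Az]; first by have [] := hr z zB'.
apply: (@path_estimate _ _ A rho (fun y => dotp (grad rho y) (field X y)) x0 r m M s i0 z) => //.
- by move=> y /hr[].
- by move=> y /hr[].
- by move=> y yB Ay; split; [exact: conormal_differentiable|exact: hM].
- move=> y yB by'; apply: conormal_limit => //; apply: nX => //.
  exact: chart_defining srho m0 hr yB.
Qed.

End boundary_chart.

(** * From local to global vanishing of the flux *)

Section no_flux_global.
Context {R : realType} {N : nat}.
Let mu := @lebesgue_rV R N.
Implicit Types (A : set 'rV[R]_N) (zeta : 'rV[R]_N -> R) (x y z : 'rV[R]_N).

Lemma plateau (O : set 'rV[R]_N) x0 : open O -> O x0 -> exists b K,
  [/\ smooth b, compact K, K `<=` O, forall x, ~ K x -> b x = 0 & \forall x \near x0, b x = 1].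
Proof.
move=> oO Ox; have [p [px pO]] := open_rat_box oO Ox.
set l := rat_lo p in px pO; set h := rat_hi p in px pO.
have b0 : 0 < bump l h x0 by exact: bump_gt0.
(* The argument of [step] equals 2 at x0, hence is still at least 1 where the bump exceeds half its
   value at x0. *)
exists (fun x => step (2 / bump l h x0 * bump l h x)), (cbox l h); split=> //.
- apply: elementary_rVP; apply: (elementary_rV_comp step_elementary); apply: elementary_rVM.
    exact: elementary_rV_cst.
  exact: bump_elementary.
- exact: compact_cbox.
- move=> x hx; rewrite step_le0//; have [->|/bump_out/obox_cbox//] := eqVneq (bump l h x) 0.
  by rewrite mulr0.
- have cb : continuous (bump l h) by exact: smooth_continuous (elementary_rVP (bump_elementary l h)).
  have : \forall x \near x0, bump l h x0 / 2 < bump l h x.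
    by apply: (cvgr_gt _ (cb x0)); rewrite ltr_pdivrMr// ltr_pMr// ltr1n.
  apply: filterS => x hx; apply: step_ge1.
  by rewrite -ler_pdivrMl ?divr_gt0// mulr1 invf_div ltW.
Qed.

Variable A : set 'rV[R]_N.
Hypotheses (oA : open A) (bA : bounded_set A).
Variables (X : 'I_N -> 'rV[R]_N -> R) (C : R).
Hypotheses (cX : forall i, C1_on A (X i)) (bX : forall i x, A x -> `|X i x| <= C)
  (bdX : forall i j x, A x -> `|partial j (X i) x| <= C).
Variables (phi : 'rV[R]_N -> R) (g : 'rV[R]_N -> 'rV[R]_N).
Hypotheses (Lphi : L2 A phi) (wg : is_weak_gradient A phi g).

Let mA : measurable A. Proof. exact: open_measurable_rV. Qed.

Lemma fluxD (z1 z2 : 'rV[R]_N -> R) : smooth z1 -> smooth z2 ->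
  flux A X phi g (fun x => z1 x + z2 x) = flux A X phi g z1 + flux A X phi g z2.
Proof.
move=> s1 s2; rewrite /flux -RintegralD//; last 2 first.
- exact: (flux_density_integrable oA bA cX bX bdX Lphi wg s1).
- exact: (flux_density_integrable oA bA cX bX bdX Lphi wg s2).
apply: eq_Rintegral => x _; rewrite /flux_density.
have -> : grad (fun y => z1 y + z2 y) x = grad z1 x + grad z2 x.
  apply/rowP => i; rewrite !mxE; apply: partialD.
    exact: (smooth_differentiable x s1).
  exact: (smooth_differentiable x s2).
by rewrite dotpDl; ring.
Qed.

(** Quantifying over all smooth zeta makes the property stable under unions, which takes the place
    of a partition of unity. *)
Definition flux_negligible (U : set 'rV[R]_N) := exists b : 'rV[R]_N -> R,
  [/\ smooth b, forall x, U x -> b x = 1 &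
    forall zeta, smooth zeta -> flux A X phi g (fun x => zeta x * b x) = 0].

(** The weight is 1 - (1 - a)(1 - b) = a + (1 - a) b, equal to 1 as soon as a or b is; the factor 1
    - a is absorbed in zeta. *)
Lemma flux_negligibleU U V : flux_negligible U -> flux_negligible V -> flux_negligible (U `|` V).
Proof.
move=> [a [sa aU fa]] [b [sb bV fb]].
have sMl (z c : 'rV[R]_N -> R) : smooth z -> smooth c -> smooth (fun x => z x * c x).
  by move=> sz sc; apply: elementary_rVP; apply: elementary_rVM; exact: elementary_rV_smooth.
have s1a : smooth (fun x => 1 + (-1) * a x).
  apply: elementary_rVP; apply: elementary_rVD; first exact: elementary_rV_cst.
  by apply: elementary_rVM; [exact: elementary_rV_cst|exact: elementary_rV_smooth].
have s2 := sMl _ _ s1a sb.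
exists (fun x => a x + (1 + (-1) * a x) * b x); split.
- by apply: elementary_rVP; apply: elementary_rVD; exact: elementary_rV_smooth.
- move=> x [/aU ->|/bV ->]; first by rewrite mulr1 subrr mul0r addr0.
  by ring.
- move=> zeta sz.
  have -> : (fun x => zeta x * (a x + (1 + (-1) * a x) * b x)) =
      (fun x => zeta x * a x + (zeta x * (1 + (-1) * a x)) * b x).
    by apply/funext => x; ring.
  have h := fluxD (sMl _ _ sz sa) (sMl _ _ (sMl _ _ sz s1a) sb).
  by apply: (etrans h); rewrite (fa _ sz) (fb _ (sMl _ _ sz s1a)) addr0.
Qed.

Lemma flux_negligible0 : flux_negligible set0.
Proof.
exists (fun=> 0); split=> //; first exact: elementary_rVP (elementary_rV_cst _).
move=> zeta sz; apply: (flux_test oA bA cX bX bdX Lphi wg).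
apply/test_functionP; split.
  apply: elementary_rVP; apply: elementary_rVM; first exact: elementary_rV_smooth.
  exact: elementary_rV_cst.
by exists set0; split=> [|//|x _]; [exact: compact0|rewrite mulr0].
Qed.

Hypotheses (nX : no_flux A X)
  (hdef : forall x, boundary A x -> exists rho, defining_function A x rho).

(** Around a point of A the weighted functions are test functions; around a boundary point the decay
    of the conormal component applies in a chart. *)
Lemma flux_negligible_local x0 : closure A x0 ->
  exists U, [/\ open U, U x0 & flux_negligible U].
Proof.
move=> cx.
suff [b [sb nb fb]] : exists b : 'rV[R]_N -> R, [/\ smooth b, \forall x \near x0, b x = 1 &
    forall zeta, smooth zeta -> flux A X phi g (fun x => zeta x * b x) = 0].
  exists (interior [set y | b y = 1]); split; [exact: open_interior|exact: nb|].
  by exists b; split=> // y /interior_subset.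
have sM (z c : 'rV[R]_N -> R) : smooth z -> smooth c -> smooth (fun x => z x * c x).
  by move=> sz sc; apply: elementary_rVP; apply: elementary_rVM; exact: elementary_rV_smooth.
have [Ax|Ax] := pselect (A x0).
  have [b [K [sb cK KA b0 nb]]] := plateau oA Ax.
  exists b; split=> // zeta sz; apply: (flux_test oA bA cX bX bdX Lphi wg).
  apply/test_functionP; split; first exact: sM.
  by exists K; split=> // x /b0 ->; rewrite mulr0.
have bx : boundary A x0 by split=> // /interior_subset.
have [rho dx] : exists rho, defining_function A x0 rho by exact: hdef.
have [srho _ _] := dx.
have [r [C' [r0 hr]]] := conormal_decay oA bA cX bX bdX nX bx dx.
have [b [K [sb cK KA b0 nb]]] := plateau (ball_open x0 r) (ballxx x0 r0).
exists b; split=> // zeta sz.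
have z0 x : ~ K x -> zeta x * b x = 0 by move=> /b0 ->; rewrite mulr0.
apply: (flux_eq0 srho oA bA cK KA _ (sM _ _ sz sb) z0 cX bX bdX Lphi wg (C' := C')).
  by move=> x /hr[].
by move=> x Ax' /KA/hr[_]; exact.
Qed.

(** The closure of A is compact, so finitely many negligible neighbourhoods cover it and their union
    is negligible. *)
Lemma no_flux_integral : \int[mu]_(x in A) weak_div X phi g x = 0.
Proof.
have cA := compact_closure_bounded bA.
pose f x := if pselect (closure A x) is left cx then sval (cid (flux_negligible_local cx)) else set0.
have fP x : closure A x -> [/\ open (f x), f x x & flux_negligible (f x)].
  by move=> cx; rewrite /f; case: pselect => // cx'; exact: (svalP (cid (flux_negligible_local cx'))).
move: cA; rewrite compact_cover => /(_ _ (closure A) f)[|x cx|D DA cD].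
- by move=> x cx; have [] := fP x cx.
- by exists x => //; have [] := fP x cx.
have [b [sb b1 fb]] : flux_negligible (closure A).
  suff : forall s : seq 'rV[R]_N, {subset s <= closure A} ->
      flux_negligible (\bigcup_(x in [set` s]) f x).
    move=> /(_ (finmap.enum_fset D)) [|b [sb b1 fb]].
      by move=> x xD; exact: DA.
    by exists b; split=> // x /cD h; exact: b1.
  elim=> [_|x s ih hs]; first by rewrite set_nil bigcup_set0; exact: flux_negligible0.
  have hx : closure A x by have := hs x (mem_head _ _); rewrite inE.
  have [_ _ gx] := fP x hx.
  have gs := ih (fun y ys => hs y (mem_behead (s := x :: s) ys)).
  rewrite (_ : \bigcup_(y in _) f y = f x `|` \bigcup_(y in [set` s]) f y); first exact: flux_negligibleU.
  rewrite -bigcup_setU1; congr (\bigcup_(y in _) f y); apply/seteqP; split=> y /=; rewrite inE.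
    by case/orP => [/eqP ->|ys]; [left|right].
  by case=> [->|->]; rewrite ?eqxx ?orbT.
(* For zeta = 1 the weight is 1 in a neighbourhood of each point of A: its gradient vanishes there
   and the density reduces to [weak_div]. *)
have := fb (cst 1) (elementary_rVP (elementary_rV_cst _)).
move=> <-; apply: eq_Rintegral => x; rewrite inE => Ax.
have nb : \forall y \near x, cst (1 : R) y = 1 * b y.
  apply: filterS (open_nbhs_nbhs (conj oA Ax)) => y Ay.
  by rewrite mul1r b1//; exact: subset_closure.
rewrite /flux_density b1; last exact: subset_closure.
rewrite mulr1 mul1r /dotp big1 ?mul0r ?addr0// => i _; rewrite !mxE.
have h : is_derive x (delta_mx ord0 i) (fun y => 1 * b y) (0 : R).
  exact: (near_eq_is_derive nb).
by rewrite /partial (@derive_val _ _ _ _ _ _ _ h) mul0r.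
Qed.

End no_flux_global.

(** * Nonempty open sets have positive measure *)

Section open_positive_measure.
Context {R : realType} {N : nat}.
Let mu := @lebesgue_rV R N.
Implicit Types (A : set 'rV[R]_N).

(** If A were null, the mollifications over A of a plateau function around y would all be 0 at y,
    although they converge to its value 1. *)
Lemma open_mu_neq0 A : open A -> A !=set0 -> mu A != 0%E.
Proof.
move=> oA [y Ay]; apply/negP => /eqP A0.
have [b [K [sb cK KA b0 nb]]] := plateau oA Ay.
have sA : csupp_in A b by exists K.
have h := mollify_cvg oA (x := y) (smooth_continuous sb) sA.
have b1 : b y = 1 by exact: (nbhs_singleton nb).
have z k : kop A (approx_unit k) b y = 0.
  have mA := open_measurable_rV oA.
  rewrite /kop /Rintegral null_set_integral//; last first.
  apply: measurable_funTS; apply/measurable_EFinP; apply: continuous_measurable_rV => //.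
  apply: continuous_mul; last exact: smooth_continuous.
  exact: smooth_continuous (approx_unit_smooth_r k y).
have h0 : kop A (approx_unit k) b y @[k --> \oo] --> (0 : R).
  by under eq_fun do rewrite z; exact: cvg_cst.
have b2 : b y = 0 by exact: (cvg_unique _ h h0).
by have /eqP := b1; rewrite b2 eq_sym oner_eq0.
Qed.

Lemma integral_le0_eq0 A (f : 'rV[R]_N -> R) : measurable A -> mu.-integrable A (EFin \o f) ->
  (forall x, A x -> 0 <= f x) -> \int[mu]_(x in A) f x <= 0 ->
  {ae mu, forall x, A x -> f x = 0}.
Proof.
move=> mA fi f0 h.
have h1 : (\int[mu]_(x in A) `|(f x)%:E| = 0)%E.
  have e : (\int[mu]_(x in A) `|(f x)%:E| = \int[mu]_(x in A) (f x)%:E)%E.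
    by apply: eq_integral => x; rewrite inE => Ax; rewrite gee0_abs// lee_fin f0.
  rewrite e -(fineK (integrable_fin_num mA fi)); congr EFin.
  apply/eqP; rewrite eq_le; apply/andP; split; first exact: h.
  by apply: Rintegral_ge0 => x Ax; exact: f0.
have /(ae_eq_integral_abs mu mA (measurable_int _ fi)) := h1.
by apply: filterS => x hx Ax; have := hx Ax; rewrite /= => -[].
Qed.

End open_positive_measure.

(** * Sign of the derivatives of a box bump *)

Section outward_bump.
Context {R : realType} {N : nat}.
Let mu := @lebesgue_rV R N.
Implicit Types (A : set 'rV[R]_N) (rho : 'rV[R]_N -> R) (x y z a b : 'rV[R]_N).

(** Closed form of the i-th partial derivative of [bump a b]; the derivative of [exp_inv 0] is
    [exp_inv 2]. *)
Definition bump_slope a b i x : R :=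
  (exp_inv 2 (x ord0 i - a ord0 i) * exp_inv 0 (b ord0 i - x ord0 i)
   - exp_inv 0 (x ord0 i - a ord0 i) * exp_inv 2 (b ord0 i - x ord0 i)) *
  \prod_(j < N | j != i) (exp_inv 0 (x ord0 j - a ord0 j) * exp_inv 0 (b ord0 j - x ord0 j)).

Lemma partial_bump a b i x : partial i (bump a b) x = bump_slope a b i x.
Proof.
rewrite /bump_slope /partial; set P := \prod_(j < N | _) _.
pose f t := exp_inv 0 (t - a ord0 i) * exp_inv 0 (b ord0 i - t).
pose v : 'rV[R]_N := delta_mx ord0 i.
pose t0 := x ord0 i.
have h1 : is_derive (t0 - a ord0 i) (1 : R) (exp_inv 0) (exp_inv 2 (t0 - a ord0 i)).
  by have := is_derive_exp_inv 0 (t0 - a ord0 i); rewrite mul0r subr0.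
have h2 : is_derive (b ord0 i - t0) (- (1 : R)) (exp_inv 0) (- exp_inv 2 (b ord0 i - t0)).
  have h := is_derive_exp_inv 0 (b ord0 i - t0); rewrite mul0r subr0 in h.
  have dh : differentiable (exp_inv 0) (b ord0 i - t0).
    by apply/derivable1_diffP; exact: (@ex_derive _ _ _ _ _ _ _ h).
  apply: DeriveDef; first exact: diff_derivable.
  by rewrite deriveE// linearN -deriveE// (@derive_val _ _ _ _ _ _ _ h).
have d1 : is_derive t0 (1 : R) (fun t => exp_inv 0 (t - a ord0 i)) (exp_inv 2 (t0 - a ord0 i)).
  apply: (@is_derive_affine _ _ _ (fun t : R => t - a ord0 i) (exp_inv 0) t0 1 _ _ _ h1) => k.
  by rewrite addrA.
have d2 : is_derive t0 (1 : R) (fun t => exp_inv 0 (b ord0 i - t)) (- exp_inv 2 (b ord0 i - t0)).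
  apply: (@is_derive_affine _ _ _ (fun t : R => b ord0 i - t) (exp_inv 0) t0 1 _ _ _ h2) => k.
  by rewrite scalerN opprD addrCA.
have d3 : is_derive t0 (1 : R) f (exp_inv 2 (t0 - a ord0 i) * exp_inv 0 (b ord0 i - t0)
   - exp_inv 0 (t0 - a ord0 i) * exp_inv 2 (b ord0 i - t0)).
  by apply: (is_derive_eq (is_deriveM d1 d2)); rewrite /GRing.scale /=; ring.
have d4 : is_derive (0 : R) (1 : R) (fun h : R => P * f (h + t0)) (P * (exp_inv 2 (t0 - a ord0 i) * exp_inv 0 (b ord0 i - t0)
   - exp_inv 0 (t0 - a ord0 i) * exp_inv 2 (b ord0 i - t0))).
  have d5 : is_derive (0 : R) (1 : R) (fun h : R => f (h + t0)) (exp_inv 2 (t0 - a ord0 i) * exp_inv 0 (b ord0 i - t0)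
   - exp_inv 0 (t0 - a ord0 i) * exp_inv 2 (b ord0 i - t0)).
    rewrite -{1}[t0]add0r in d3.
    apply: (@is_derive_affine _ _ _ (fun h : R => h + t0) f 0 1 _ _ _ d3) => k.
    by rewrite addrA.
  by apply: (is_derive_eq (is_deriveZ P d5)).
have e : (fun h : R => bump a b (h *: v + x)) = (fun h : R => P * f (h + t0)).
  apply/funext => h; rewrite /bump (bigD1 i)//= mulrC; congr (_ * _).
    by apply: eq_bigr => j ji; rewrite !mxE eqxx /= (negbTE ji) mulr0 add0r.
  by rewrite /f !mxE !eqxx mulr1.
have db : differentiable (bump a b) (0 *: v + x).
  exact: smooth_differentiable (elementary_rVP (bump_elementary a b)).
have := is_derive_path db; rewrite e => h.
have := @derive_val _ _ _ _ _ _ _ h; rewrite (@derive_val _ _ _ _ _ _ _ d4) scale0r add0r => {}h.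
rewrite derive_dotp; last by move: db; rewrite scale0r add0r.
by rewrite -h mulrC.
Qed.

(* Each factor of the bump is symmetric and unimodal around the midpoint of its interval. *)
Lemma bump_slope_gt0 a b i (s : R) x : `|s| = 1 -> obox a b x ->
  s * (x ord0 i - (a ord0 i + b ord0 i) / 2) < 0 -> 0 < s * bump_slope a b i x.
Proof.
move=> s1 hx hs; rewrite /bump_slope mulrA mulr_gt0//; last first.
  apply: prodr_gt0 => j _; have /andP[h1 h2] := hx j.
  by rewrite mulr_gt0// exp_inv_gt0// subr_gt0.
have /andP[h1 h2] := hx i; set p := x ord0 i - a ord0 i; set q := b ord0 i - x ord0 i.
have p0 : 0 < p by rewrite subr_gt0.
have q0 : 0 < q by rewrite subr_gt0.
have hpq : s * (p - q) < 0.
  have -> : p - q = 2 * (x ord0 i - (a ord0 i + b ord0 i) / 2) by rewrite /p /q; field.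
  by rewrite mulrCA pmulr_rlt0.
move: p0 q0 hpq; move: p q => p q p0 q0 hpq; rewrite /exp_inv !leNgt p0 q0 /= !expr0 !mul1r.
(* Since p^-2 - q^-2 = (q - p)(p + q) / (p q)^2, the sign is that of s (q - p). *)
have -> : s * (p^-1 ^+ 2 * expR (- p^-1) * expR (- q^-1) - expR (- p^-1) * (q^-1 ^+ 2 * expR (- q^-1))) =
   (- (s * (p - q))) * ((p + q) * (p^-1 ^+ 2 * q^-1 ^+ 2) * (expR (- p^-1) * expR (- q^-1))).
  by field; rewrite !gt_eqF.
have h3 : 0 < p^-1 ^+ 2 by rewrite exprn_gt0// invr_gt0.
have h4 : 0 < q^-1 ^+ 2 by rewrite exprn_gt0// invr_gt0.
rewrite mulr_gt0 ?oppr_gt0// mulr_gt0//; last by rewrite mulr_gt0// expR_gt0.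
by rewrite mulr_gt0 ?addr_gt0// mulr_gt0.
Qed.

Lemma bump_slope_out a b i x : ~ obox a b x -> bump_slope a b i x = 0.
Proof.
move=> hx.
have [j hj] : exists j, ~~ (a ord0 j < x ord0 j < b ord0 j).
  by apply: contrapT => h; apply: hx => j; apply/negPn/negP => hj; apply: h; exists j.
have z k : exp_inv k (x ord0 j - a ord0 j) * exp_inv 0 (b ord0 j - x ord0 j) = 0 /\
    exp_inv 0 (x ord0 j - a ord0 j) * exp_inv k (b ord0 j - x ord0 j) = 0.
  move: hj; rewrite negb_and -!leNgt => /orP[h|h].
    by rewrite !(@exp_inv_le0 _ _ (x ord0 j - a ord0 j)) ?subr_le0// !mul0r.
  by rewrite !(@exp_inv_le0 _ _ (b ord0 j - x ord0 j)) ?subr_le0// !mulr0.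
rewrite /bump_slope; have [->|ij] := eqVneq i j.
  by rewrite !(z 2).1 !(z 2).2 subrr mul0r.
by rewrite (bigD1 j) 1?eq_sym//= (z 0).1 mul0r mulr0.
Qed.

End outward_bump.

(** * A nonzero conormal component produces a nonzero flux *)

Section flux_sign.
Context {R : realType} {N : nat}.
Let mu := @lebesgue_rV R N.
Implicit Types (rho zeta : 'rV[R]_N -> R) (x y z : 'rV[R]_N).

Lemma chart_increase rho x0 r (s m : R) i0 z T : smooth rho ->
  (forall y, ball x0 r y -> m <= s * partial i0 rho y) -> 0 <= T ->
  (forall t, 0 <= t -> t <= T -> ball x0 r (t *: (s *: delta_mx ord0 i0) + z)) ->
  m * T <= rho (T *: (s *: delta_mx ord0 i0) + z) - rho z.
Proof.
move=> srho hm; rewrite le_eqVlt => /orP[/eqP<- _|T0 hB].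
  by rewrite mulr0 scale0r add0r subrr.
pose v : 'rV[R]_N := s *: delta_mx ord0 i0.
have df t : is_derive t (1 : R) (fun t => rho (t *: v + z)) (s * partial i0 rho (t *: v + z)).
  have := is_derive_path (smooth_differentiable (t *: v + z) srho).
  by rewrite dotp_delta mxE.
have cf : continuous (fun t : R => rho (t *: v + z)).
  move=> t; apply/differentiable_continuous/derivable1_diffP.
  exact: (@ex_derive _ _ _ _ _ _ _ (df t)).
have [c + e] := MVT T0 (fun t _ => df t) (continuous_subspaceT cf).
rewrite in_itv /= => /andP[c0 cT].
rewrite scale0r add0r in e; rewrite e subr0 ler_wpM2r ?(ltW T0)//.
by apply: hm; apply: hB; exact: ltW.
Qed.

Variable A : set 'rV[R]_N.
Hypotheses (oA : open A) (bA : bounded_set A).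

Let mA : measurable A. Proof. exact: open_measurable_rV. Qed.
Let fA : (mu A < +oo)%E. Proof. exact: bounded_mu_fin. Qed.

(* A box centred on the outer side of the boundary, so that A meets only its inner half. *)
Lemma outer_box x0 rho i0 (s r m : R) : boundary A x0 -> smooth rho -> `|s| = 1 -> 0 < m -> 0 < r ->
  (forall z, ball x0 r z -> (A z <-> rho z < 0) /\ m <= s * partial i0 rho z) ->
  exists a b : 'rV[R]_N, [/\ cbox a b `<=` ball x0 r, obox a b x0 &
    forall y, A y -> obox a b y -> s * (y ord0 i0 - (a ord0 i0 + b ord0 i0) / 2) < 0].
Proof.
move=> bx srho s1 m0 r0 hr.
have hm y : ball x0 r y -> m <= s * partial i0 rho y by move=> /hr[].
have rx : rho x0 = 0.
  apply: (boundary_defining0 oA bx (smooth_continuous srho)).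
  by apply: filterS (nbhsx_ballx x0 r r0) => y /hr[].
pose L := r / 4; have L0 : 0 < L by rewrite divr_gt0.
pose v : 'rV[R]_N := s *: delta_mx ord0 i0.
(* Centre of the box: x0 moved outward by L = r / 4, so that rho p > 0 while the box below still
   fits in the ball. *)
pose p : 'rV[R]_N := L *: v + x0.
have ss : s * s = 1 by rewrite -expr2 -real_normK ?num_real// s1 expr1n.
have vE j : v ord0 j = if j == i0 then s else 0.
  by rewrite !mxE eqxx /=; case: eqP; rewrite ?mulr1 ?mulr0.
have pE j : p ord0 j = (if j == i0 then L * s else 0) + x0 ord0 j.
  by rewrite !mxE eqxx /=; case: eqP; rewrite ?mulr1 ?mulr0.
have rp : 0 < rho p.
  have := @chart_increase rho x0 r s m i0 x0 L srho hm (ltW L0); rewrite rx subr0.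
  move=> h; apply: lt_le_trans (h _); first by rewrite mulr_gt0.
  move=> t t0 tL; apply/ball_rVP; split=> // j; rewrite -/v mxE opprD addrCA subrr addr0 normrN mxE.
  rewrite vE; case: (j == i0); last by rewrite mulr0 normr0.
  rewrite normrM s1 mulr1 ger0_norm// (le_lt_trans tL)// /L.
  by rewrite ltr_pdivrMr// ltr_pMr// ltr1n.
clearbody p.
have : \forall y \near p, 0 < rho y.
  have crho : {for p, continuous rho} by exact: smooth_continuous.
  by apply: (cvgr_gt _ crho).
move=> /nbhs_ballP[w0 /= w00 hw0].
pose w := Num.min w0 L; have w_gt0 : 0 < w by rewrite lt_min w00.
have hw y : ball p w y -> 0 < rho y.
  by move=> h; apply: hw0; apply: le_ball h; rewrite ge_min lexx.
have wL : w <= L by rewrite ge_min lexx orbT.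
(* Half-widths: 2 L along i0 keeps x0, at distance L from the centre, inside the box; w in the other
   directions keeps the cross-section through p in rho > 0. *)
pose l j := if j == i0 then 2 * L else w.
exists (\row_j (p ord0 j - l j)), (\row_j (p ord0 j + l j)).
have box_ball y : cbox (\row_j (p ord0 j - l j)) (\row_j (p ord0 j + l j)) y -> ball x0 r y.
  move=> hy; apply/ball_rVP; split=> // j; have := hy j; rewrite !mxE pE /l /L.
  case: eqP => [->|_]; last by move: wL; rewrite /L; rewrite ltr_norml; lra.
  move=> h; rewrite ltr_norml; have : `|s| <= 1 by rewrite s1.
  rewrite ler_norml => /andP[h1 h2].
  have k1 : r / 4 * s <= r / 4 by rewrite -[leRHS]mulr1 ler_pM2l// divr_gt0.
  have k2 : - (r / 4) <= r / 4 * s by rewrite -mulrN1 ler_pM2l// divr_gt0.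
  by move: h k1 k2; move: (r / 4 * s) (y ord0 i0) (x0 ord0 i0) => c d e; lra.
split=> //.
  move=> j; rewrite !mxE pE /l; case: eqP => [->|_]; last by lra.
  have : `|s| <= 1 by rewrite s1.
  rewrite ler_norml => /andP[h1 h2].
  have k1 : L * s <= L by rewrite -[leRHS]mulr1 ler_pM2l.
  have k2 : - L <= L * s by rewrite -mulrN1 ler_pM2l.
  by move: k1 k2; move: (L * s) (x0 ord0 i0) => c d; lra.
move=> y Ay hy.
have -> : ((\row_j (p ord0 j - l j)) ord0 i0 + (\row_j (p ord0 j + l j)) ord0 i0) / 2 = p ord0 i0.
  by rewrite !mxE; field.
have yB := box_ball _ (obox_cbox hy).
rewrite ltNge; apply/negP => T0; set T := s * (y ord0 i0 - p ord0 i0) in T0.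
have TL : T < 2 * L.
  rewrite (le_lt_trans (ler_norm _))// normrM s1 mul1r ltr_distl.
  by have := hy i0; rewrite !mxE /l eqxx andbC => /andP[-> ->].
(* Projection of y along e_i0 on the cross-section through p. If y lay on the outer side, rho would
   increase from z, where it is positive, to y, against y in A. *)
pose z := y - T *: v.
have yE : y = T *: v + z by rewrite addrC subrK.
have zE j : z ord0 j = y ord0 j - T * v ord0 j by rewrite /z !mxE.
have zi : z ord0 i0 = p ord0 i0.
  rewrite zE vE eqxx /T mulrAC ss mul1r.
  by rewrite opprB addrC subrK.
have zj j : j != i0 -> z ord0 j = y ord0 j.
  by move=> ji; rewrite zE vE (negbTE ji) mulr0 subr0.
have rz : 0 < rho z.
  apply: hw; apply/ball_rVP; split=> // j; have [->|ji] := eqVneq j i0.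
    by rewrite zi subrr normr0.
  rewrite zj// distrC ltr_distl; have := hy j; rewrite !mxE /l (negbTE ji) andbC.
  by case/andP => -> ->.
have : m * T <= rho y - rho z.
  rewrite [in leRHS]yE; apply: (chart_increase (r := r) (x0 := x0) srho hm T0) => t t0 tT.
  apply/ball_rVP; split=> // j; rewrite -/v mxE [(t *: v) _ _]mxE vE.
  have [->|ji] := eqVneq j i0; last first.
    by rewrite mulr0 add0r zj//; have [_] := (ball_rVP _ _ _).1 yB; exact.
  rewrite zi pE eqxx addrA -mulrDl opprD addrCA subrr addr0 normrN normrM s1 mulr1.
  rewrite ger0_norm ?addr_ge0// ?(ltW L0)//.
  by move: tT TL; rewrite /L; lra.
have : rho y < 0 by apply/(hr y yB).1.
have : 0 <= m * T by rewrite mulr_ge0// ltW.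
by move: (m * T) (rho y) (rho z) rz => c d e; lra.
Qed.

Lemma C1_on_affine (f : 'rV[R]_N -> R) (c d : R) : C1_on A f ->
  C1_on A (fun x => c * f x + d) /\
  forall i x, A x -> partial i (fun x => c * f x + d) x = c * partial i f x.
Proof.
move=> cf.
have E i x : A x -> partial i (fun x => c * f x + d) x = c * partial i f x.
  move=> Ax; have [df _] := cf x Ax.
  have h := is_deriveD (is_deriveZ c (differentiable_partial i df)) (is_derive_cst d x (delta_mx ord0 i)).
  by rewrite {1}/partial (@derive_val _ _ _ _ _ _ _ h) addr0.
split=> // x Ax; have [df pf] := cf x Ax; split=> [|i].
  apply: differentiableD; last exact: differentiable_cst.
  by apply: differentiableM => //; exact: differentiable_cst.
apply: (open_near_eq_cvg oA Ax (E i)).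
by apply: continuousM; [exact: cst_continuous|exact: pf].
Qed.

Variables (X : 'I_N -> 'rV[R]_N -> R) (C : R).
Hypotheses (cX : forall i, C1_on A (X i)) (bX : forall i x, A x -> `|X i x| <= C)
  (bdX : forall i j x, A x -> `|partial j (X i) x| <= C).

Hypothesis flux0 : forall zeta, smooth zeta -> flux A X (cst 1) (fun=> 0) zeta = 0.

(* If the conormal component of tau X stayed above k near x0, then tau X would push at least
   k / M1 times the flux of the constant field s e_i0 through the boundary. *)
Lemma flux_no_sign x0 rho (tau k : R) : boundary A x0 -> defining_function A x0 rho ->
  `|tau| = 1 -> 0 < k ->
  (\forall y \near within A (nbhs x0), k <= tau * dotp (grad rho y) (field X y)) -> False.
Proof.
move=> bx dx tau1 k0 hk; have [srho _ hA] := dx.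
have [i0 [s [r1 [m [s1 m0 r10 hr1]]]]] := boundary_chart dx.
have : \forall y \near x0, A y -> k <= tau * dotp (grad rho y) (field X y) by exact: hk.
move=> /nbhs_ballP[r2 /= r20 hr2].
pose r := Num.min r1 r2; have r0 : 0 < r by rewrite lt_min r10.
have rr1 : ball x0 r `<=` ball x0 r1 by apply: le_ball; rewrite ge_min lexx.
have rr2 : ball x0 r `<=` ball x0 r2 by apply: le_ball; rewrite ge_min lexx orbT.
have hr z : ball x0 r z -> (A z <-> rho z < 0) /\ m <= s * partial i0 rho z.
  by move=> /rr1/hr1.
have [a [b [boxB xb hbox]]] := outer_box bx srho s1 m0 r0 hr.
have [D D0 hD] := smooth_bounded_on bA (smooth_partial i0 srho).
(* D bounds the i0-th partial derivative of rho on A, so the conormal component of q s e_i0 is at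
   most k; D + 1 avoids a zero denominator. *)
pose q := k / (D + 1); have q0 : 0 < q by rewrite divr_gt0// ltr_wpDl.
pose d i := if i == i0 then q * s else 0.
pose Y i x := (- tau) * X i x + d i.
pose C' := `|C| + q.
have hd i : `|d i| <= q.
  by rewrite /d; case: eqP => _; rewrite ?normr0 ?(ltW q0)// normrM s1 mulr1 gtr0_norm.
have cY i : C1_on A (Y i) by exact: (C1_on_affine (- tau) (d i) (cX i)).1.
have bY i x : A x -> `|Y i x| <= C'.
  move=> Ax; rewrite (le_trans (ler_normD _ _))// lerD// normrM normrN tau1 mul1r.
  by rewrite (le_trans (bX i Ax))// ler_norm.
have bdY i j x : A x -> `|partial j (Y i) x| <= C'.
  move=> Ax; rewrite (C1_on_affine (- tau) (d i) (cX i)).2// normrM normrN tau1 mul1r.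
  by rewrite (le_trans (bdX i j Ax))// (le_trans (ler_norm _))// lerDl ltW.
have L1 : L2 A (cst (1 : R)) by exact: L2_cst.
have s1' : smooth (cst (1 : R) : 'rV[R]_N -> R) by exact: elementary_rVP (elementary_rV_cst _).
have p1 i : partial i (cst (1 : R) : 'rV[R]_N -> R) = cst 0.
  by apply/funext => x; rewrite /partial (@derive_val _ _ _ _ _ _ _ (is_derive_cst (1 : R) x _)).
have w1 : is_weak_gradient A (cst (1 : R)) (fun=> 0).
  have := C1_bounded_weak_gradient oA (smooth_C1_on (A := A) s1') L1 (fun i => _).
  have -> : grad (cst (1 : R) : 'rV[R]_N -> R) = (fun=> 0).
    by apply/funext => x; apply/rowP => i; rewrite !mxE p1.
  by apply => i; rewrite p1; exact: L2_cst.
pose zeta := bump a b.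
have sz : smooth zeta by exact: elementary_rVP (bump_elementary a b).
have z0 x : ~ cbox a b x -> zeta x = 0.
  by move=> h; apply/eqP/negPn/negP => /bump_out/obox_cbox.
have AV z : ball x0 r z -> A z <-> rho z < 0 by move=> /hr[].
have lim := cutoff_limit srho oA bA (@compact_cbox _ _ a b) boxB AV sz z0 cY bY bdY L1 w1.
(* On the box grad rho . Y <= 0, and the gradient of the cutoff is a nonpositive multiple of grad
   rho. *)
have step1 j : 0 <= \int[mu]_(x in A) (zeta x * (dotp (grad (cutoff rho j) x) (field Y x) * cst 1 x)).
  apply: Rintegral_ge0 => x Ax; rewrite mulr1.
  have [/boxB xB|/z0 ->] := pselect (cbox a b x); last by rewrite mul0r.
  apply: mulr_ge0; first exact: bump_ge0.
  rewrite (grad_cutoff srho j x).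
  rewrite (@dotpZl R N).
  have -> : dotp (grad rho x) (field Y x) = q * (s * partial i0 rho x) - tau * dotp (grad rho x) (field X x).
    rewrite /dotp mulr_sumr (bigD1 i0)//= [in RHS](bigD1 i0)//= !mxE /Y /d eqxx.
    set S1 := \sum_(i < N | _) _; set S2 := \sum_(i < N | _) _.
    have -> : S1 = - S2.
      rewrite /S1 /S2 -sumrN; apply: eq_bigr => i ii; rewrite !mxE (negbTE ii); ring.
    by ring.
  rewrite mulNr -mulrN mulr_ge0//; first by rewrite mulr_ge0// dstep_ge0.
  rewrite opprB subr_ge0 (le_trans _ (hr2 x (rr2 _ xB) Ax))//.
  have h1 : s * partial i0 rho x <= D.
    by rewrite (le_trans (ler_norm _))// normrM s1 mul1r hD.
  rewrite /q mulrAC ler_pdivrMr ?ltr_wpDl// ler_pM2l// (le_trans h1)// lerDl//.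
have fY : flux A Y (cst 1) (fun=> 0) zeta <= 0.
  have h1 : \forall j \near \oo, 0 <= \int[mu]_(x in A) (zeta x * (dotp (grad (cutoff rho j) x) (field Y x) * cst 1 x)).
    by apply: nearW.
  have : 0 <= limn (fun j => \int[mu]_(x in A) (zeta x * (dotp (grad (cutoff rho j) x) (field Y x) * cst 1 x))).
    by apply: limr_ge h1; exact: cvgP lim.
  by rewrite (cvg_lim _ lim)// oppr_ge0.
have dotp0 (x : 'rV[R]_N) : dotp x 0 = 0 by rewrite /dotp big1// => i _; rewrite mxE mulr0.
have FE x : A x -> flux_density Y (cst 1) (fun=> 0) zeta x =
    q * (s * partial i0 zeta x) + (- tau) * flux_density X (cst 1) (fun=> 0) zeta x.
  move=> Ax; rewrite /flux_density /weak_div !dotp0 !add0r !mulr1.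
  have -> : divergence Y x = (- tau) * divergence X x.
    by rewrite /divergence mulr_sumr; apply: eq_bigr => i _; rewrite (C1_on_affine (- tau) (d i) (cX i)).2.
  have -> : dotp (grad zeta x) (field Y x) = q * (s * partial i0 zeta x) - tau * dotp (grad zeta x) (field X x).
    rewrite /dotp mulr_sumr (bigD1 i0)//= [in RHS](bigD1 i0)//= !mxE /Y /d eqxx.
    set S1 := \sum_(i < N | _) _; set S2 := \sum_(i < N | _) _.
    have -> : S1 = - S2.
      rewrite /S1 /S2 -sumrN; apply: eq_bigr => i ii; rewrite !mxE (negbTE ii); ring.
    by ring.
  by ring.
have iX := flux_density_integrable oA bA cX bX bdX L1 w1 sz.
have i1 : mu.-integrable A (EFin \o (fun x => s * partial i0 zeta x)).
  have [D1 _ hD1] := smooth_bounded_on bA (smooth_partial i0 sz).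
  apply: (L2_integrable mA fA); apply: L2Z => //; apply: (L2_bounded mA fA _ hD1).
  by apply: continuous_measurable_rV => //; exact/smooth_continuous/smooth_partial.
(* The flux of X vanishes by hypothesis, so only the constant field, of zero divergence, remains. *)
have fE : flux A Y (cst 1) (fun=> 0) zeta = q * \int[mu]_(x in A) (s * partial i0 zeta x).
  have -> : flux A Y (cst 1) (fun=> 0) zeta = \int[mu]_(x in A)
      (q * (s * partial i0 zeta x) + (- tau) * flux_density X (cst 1) (fun=> 0) zeta x).
    by apply: eq_Rintegral => x; rewrite inE => Ax; exact: FE.
  rewrite RintegralD//; last 2 first.
  - by have := integrableZl mA q i1; apply: eq_integrable.
  - by have := integrableZl mA (- tau) iX; apply: eq_integrable.
  rewrite (RintegralZl q mA i1) (RintegralZl (- tau) mA iX).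
  have := flux0 sz; rewrite /flux => ->.
  by rewrite mulr0 addr0.
have F0 x : A x -> 0 <= s * partial i0 zeta x.
  move=> Ax; rewrite partial_bump; have [hx|/bump_slope_out ->] := pselect (obox a b x).
    by apply/ltW/bump_slope_gt0 => //; exact: hbox.
  by rewrite mulr0.
(* The integrand is nonnegative on A because A meets only the inner half of the box; a nonpositive
   integral then makes it vanish almost everywhere on A. *)
have I0 : \int[mu]_(x in A) (s * partial i0 zeta x) <= 0.
  by move: fY; rewrite fE pmulr_rle0.
have [M [mM M0 hM]] := integral_le0_eq0 mA i1 F0 I0.
have ob : open (obox a b).
  have -> : obox a b = [set x | 0 < bump a b x].
    by apply/seteqP; split=> x; [exact: bump_gt0|move=> /= h; apply: bump_out; rewrite gt_eqF].
  have cb : continuous (bump a b) by exact: smooth_continuous.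
  by apply: (open_comp (f := bump a b) (D := [set t | 0 < t])) => [x _|]; [exact: cb|exact: open_gt].
have oAb : open (A `&` obox a b) by exact: openI.
(* The integrand is strictly positive on this open set, which is nonempty since x0 is adherent to A
   and lies in the box. *)
have : mu (A `&` obox a b) != 0%E.
  by apply: open_mu_neq0 => //; apply: bx.1; exact: (open_nbhs_nbhs (conj ob xb)).
move=> /eqP; apply; apply: (subset_measure0 (open_measurable_rV oAb) mM _ M0).
move=> x [Ax hx]; apply: hM => /= /(_ Ax); rewrite partial_bump => e.
by have := bump_slope_gt0 s1 hx (hbox x Ax hx); rewrite e ltxx.
Qed.

(** A nonzero limit c would give the conormal component the sign of c and size at least |c| / 2 near
    x0, also after grad rho is no longer frozen at x0. *)
Lemma flux0_conormal x0 rho (c : R) : boundary A x0 -> defining_function A x0 rho ->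
  dotp (grad rho x0) (field X y) @[y --> within A (nbhs x0)] --> c -> c = 0.
Proof.
move=> bx dx hc; have [srho _ _] := dx.
have lim := conormal_limit bX srho hc.
apply/eqP/negPn/negP => c0.
apply: (@flux_no_sign x0 rho (Num.sg c) (`|c| / 2) bx dx).
- by rewrite normr_sg c0.
- by rewrite divr_gt0// normr_gt0.
- have h : Num.sg c * dotp (grad rho y) (field X y) @[y --> within A (nbhs x0)] --> Num.sg c * c.
    by apply: cvgM => //; exact: cvg_cst.
  have : \forall y \near within A (nbhs x0), `|c| / 2 < Num.sg c * dotp (grad rho y) (field X y).
    by apply: (cvgr_gt _ h); rewrite -normrEsg ltr_pdivrMr// ltr_pMr ?ltr1n// normr_gt0.
  by apply: filterS => y; exact: ltW.
Qed.

End flux_sign.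

(** * The classical Neumann condition *)
Section classical_neumann_condition.
Context {R : realType} {N : nat}.
Let mu := @lebesgue_rV R N.
Variables (A : set 'rV[R]_N) (eta : 'rV[R]_N -> 'rV[R]_N).
Hypotheses (oA : open A) (bA : bounded_set A)
  (heta : forall x, boundary A x -> outward_normal A x (eta x)).
Implicit Types (u phi zeta : 'rV[R]_N -> R).

Let mA : measurable A. Proof. exact: open_measurable_rV. Qed.
Let fA : (mu A < +oo)%E. Proof. exact: bounded_mu_fin. Qed.

Lemma dotp_integrable (g k : 'rV[R]_N -> 'rV[R]_N) : L2_field A g -> L2_field A k ->
  mu.-integrable A (EFin \o (fun x => dotp (g x) (k x))).
Proof. by move=> hg hk; apply: integrable_sumr => // i; exact: L2_mul_integrable. Qed.

(** The normal eta may come from another defining function at x; uniqueness of the unit normal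
    identifies it with that of rho. *)
Lemma normal_scale rho x : boundary A x -> defining_function A x rho ->
  grad rho x = enorm (grad rho x) *: eta x.
Proof.
move=> bx dx; have [rho' dx' ->] := heta bx.
rewrite -(normal_unique oA bx dx dx') scalerA divff ?scale1r// gt_eqF//.
by apply: enorm_gt0; have [] := dx.
Qed.

Lemma smooth_weak_gradient zeta : smooth zeta -> L2 A zeta /\ is_weak_gradient A zeta (grad zeta).
Proof.
move=> sz; have L z : smooth z -> L2 A z.
  move=> s; have [D _ hD] := smooth_bounded_on bA s.
  by apply: (L2_bounded mA fA _ hD); apply: continuous_measurable_rV => //; exact: smooth_continuous.
split; first exact: L.
apply: C1_bounded_weak_gradient => //; [exact: smooth_C1_on|exact: L|].
by move=> i; apply: L; exact: smooth_partial.
Qed.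

Variable u : 'rV[R]_N -> R.
Hypothesis cu : C2_closure A u.

Let X i := partial i u.

Let cX i : C1_on A (X i). Proof. exact: (C2_closure_C1 oA cu).2. Qed.

Let bnd : exists C, (forall i x, A x -> `|X i x| <= C) /\
  (forall i j x, A x -> `|partial j (X i) x| <= C).
Proof. exact: C2_closure_bounds. Qed.

Let LX i : L2 A (X i).
Proof.
have [C [bX _]] := bnd; apply: (L2_bounded mA fA _ (bX i)).
by apply: continuous_in_measurable_rV => // x Ax; exact: C1_on_continuous Ax.
Qed.

Let gX : L2_field A (grad u).
Proof. by move=> i; apply: (L2_eq_in mA _ (LX i)) => x _; rewrite mxE. Qed.

Lemma C2_closure_laplacian_L2 : L2 A (laplacian u).
Proof.
have [C [_ bdX]] := bnd.
have LdX i j : L2 A (partial j (X i)).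
  apply: (L2_bounded mA fA _ (bdX i j)); apply: continuous_in_measurable_rV => // x Ax.
  by have [_] := cX i Ax; exact.
rewrite /laplacian; elim: (index_enum _) => [|j s ih].
  by under eq_fun do rewrite big_nil; exact: L2_cst.
by under eq_fun do rewrite big_cons; exact: (L2D mA (LdX j j) ih).
Qed.

Let Llap := C2_closure_laplacian_L2.

Lemma C2_closure_weak_gradient : L2 A u -> is_weak_gradient A u (grad u).
Proof. by move=> Lu; apply: C1_bounded_weak_gradient => //; exact: (C2_closure_C1 oA cu).1. Qed.

(** For X = grad u the divergence is the Laplacian, and this integral is the weak normal derivative
    of u paired with phi. *)
Lemma weak_div_integral phi g : L2 A phi -> is_weak_gradient A phi g ->
  \int[mu]_(x in A) weak_div X phi g x =
  dirichlet A (grad u) g + \int[mu]_(x in A) (laplacian u x * phi x).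
Proof.
move=> Lphi wg; rewrite -RintegralD//; first exact: (dotp_integrable gX wg.1).
exact: (L2_mul_integrable mA Llap Lphi).
Qed.

(** With phi = 1 and zero gradient, the weight zeta takes over the role of the H^1 function. *)
Lemma flux_cst1 zeta : smooth zeta -> flux A X (cst 1) (fun=> 0) zeta =
  dirichlet A (grad u) (grad zeta) + \int[mu]_(x in A) (laplacian u x * zeta x).
Proof.
move=> sz; have [Lz wz] := smooth_weak_gradient sz.
rewrite -(weak_div_integral Lz wz); apply: eq_Rintegral => x _.
rewrite /flux_density /weak_div; have -> : dotp (field X x) 0 = 0.
  by rewrite /dotp big1// => i _; rewrite !mxE mulr0.
by rewrite add0r !mulr1 (dotpC (grad zeta x)) addrC mulrC.
Qed.

Lemma classical_no_flux : classical_neumann A eta u -> no_flux A X.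
Proof.
move=> hN z rho bz dz.
have -> : (fun y => dotp (grad rho z) (field X y)) =
    (fun y => enorm (grad rho z) * dotp (grad u y) (eta z)).
  by apply/funext => y; rewrite {1}(normal_scale bz dz) dotpZl dotpC.
have h := hN z bz.
rewrite -[X in _ --> X](mulr0 (enorm (grad rho z))).
by apply: cvgM => //; exact: cvg_cst.
Qed.

Hypothesis Lu : L2 A u.

Lemma C2_closure_H1 : H1 A u.
Proof. by split=> //; exists (grad u); exact: C2_closure_weak_gradient. Qed.

Let dirE phi g : H1 A phi -> is_weak_gradient A phi g ->
  dirichlet A (weak_grad A u) (weak_grad A phi) = dirichlet A (grad u) g.
Proof.
move=> hphi wg; have hu := C2_closure_H1.
apply: (ae_eq_dirichlet oA (weak_grad_field hu) (weak_grad_field hphi) gX wg.1).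
  exact: (weak_gradient_unique oA bA (weak_gradP hu) (C2_closure_weak_gradient Lu)).
exact: (weak_gradient_unique oA bA (weak_gradP hphi) wg).
Qed.

(** Against a test function the weak Neumann identity holds with w by hypothesis and with the
    classical Laplacian because the flux is zero; the fundamental lemma compares the two. *)
Lemma weak_laplacian_classical w : L2 A w -> weak_neumann A u w ->
  {ae mu, forall x, A x -> w x = laplacian u x}.
Proof.
move=> Lw hn; have [C [bX bdX]] := bnd.
have [L1 w1] := smooth_weak_gradient (elementary_rVP (elementary_rV_cst (1 : R))).
have g1 : grad (fun=> 1 : R) = (fun=> 0) :> ('rV[R]_N -> 'rV[R]_N).
  apply/funext => x; apply/rowP => i; rewrite !mxE /partial.
  exact: (@derive_val _ _ _ _ _ _ _ (is_derive_cst (1 : R) x _)).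
have Ld := L2B mA Lw Llap.
have : {ae mu, forall x, A x -> w x - laplacian u x = 0}.
  apply: (fundamental_lemma oA (L2_integrable mA fA Ld)) => phi tphi.
  have Lphi := test_L2 oA bA tphi; have hphi := test_H1 oA bA tphi.
  rewrite g1 in w1; have := flux_test oA bA cX bX bdX L1 w1 tphi.
  rewrite flux_cst1; last exact: test_function_smooth tphi.
  have := hn phi hphi.
  rewrite /weak_normal_derivative -/(dirichlet A _ _) (dirE hphi (test_weak_gradient oA bA tphi)).
  have := Rintegral_L2_lin mA (-1) Lw Llap Lphi.
  have -> : \int[lebesgue_rV N]_(x in A) ((w x + -1 * laplacian u x) * phi x) =
      \int[mu]_(x in A) ((w x - laplacian u x) * phi x).
    by apply: eq_Rintegral => x _; rewrite mulN1r.
  by move=> -> e1 e2; lra.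
by apply: filterS => x hx Ax; apply/eqP; rewrite -subr_eq0 hx.
Qed.

Lemma classical_neumannP : classical_neumann A eta u <-> weak_neumann A u (laplacian u).
Proof.
have [C [bX bdX]] := bnd; split=> [hN phi hphi|hn].
  have wg := weak_gradP hphi.
  rewrite /weak_normal_derivative -/(dirichlet A _ _) (dirE hphi wg) -(weak_div_integral hphi.1 wg).
  apply: (no_flux_integral oA bA cX bX bdX hphi.1 wg (classical_no_flux hN)).
  by move=> x /heta[rho drho _]; exists rho.
(* Smooth functions restricted to the bounded set A lie in H^1, so they are admissible in the weak
   Neumann condition. *)
have f0 zeta : smooth zeta -> flux A X (cst 1) (fun=> 0) zeta = 0.
  move=> sz; have [Lz wz] := smooth_weak_gradient sz.
  have hz : H1 A zeta by split=> //; exists (grad zeta).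
  by rewrite (flux_cst1 sz) -(dirE hz wz); exact: hn.
move=> x bx; have [rho dx etaE] := heta bx.
(* The partial derivatives of u have limits at x from inside A, so the conormal component converges
   and only the value of its limit is in question. *)
have /choice[c hc] i := C2_closure_trace i cu bx.1.
have lim : dotp (grad rho x) (field X y) @[y --> within A (nbhs x)] -->
    \sum_i partial i rho x * c i.
  have -> : (fun y => dotp (grad rho x) (field X y)) = (fun y => \sum_i partial i rho x * X i y).
    by apply/funext => y; apply: eq_bigr => i _; rewrite !mxE.
  by apply: cvg_finite_sum => i; apply: cvgM; [exact: cvg_cst|exact: hc].
have c0 := flux0_conormal oA bA cX bX bdX f0 bx dx lim.
rewrite c0 in lim.
have -> : (fun y => dotp (grad u y) (eta x)) =
    (fun y => (enorm (grad rho x))^-1 * dotp (grad rho x) (field X y)).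
  by apply/funext => y; rewrite etaE dotpZr dotpC.
rewrite -[X in _ --> X](mulr0 (enorm (grad rho x))^-1).
by apply: cvgM => //; exact: cvg_cst.
Qed.

Variables (B : set 'rV[R]_N) (J : 'rV[R]_N -> R).
Hypotheses (mB : measurable B) (bB : bounded_set B) (cJ : continuous J).

(** Reduction to [weak_solution_stepP]: any admissible w coincides almost everywhere with the
    classical Laplacian, and then the two Neumann conditions are equivalent. *)
Lemma classical_solution_stepP v ut : L2 B v -> L2 A ut ->
  (classical_neumann A eta u /\
     {ae mu, forall x, A x -> ut x = laplacian u x + reaction B J u v x}) <->
  (exists xi, first_variation A (energy A B J v) u xi /\ {ae mu, forall x, A x -> ut x + xi x = 0}).
Proof.
move=> Lv Lut; rewrite -(weak_solution_stepP oA bA mB bB cJ Lu Lv Lut).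
have hu := C2_closure_H1; split=> [[/classical_neumannP hn e]|[w [_ [Lw _] hn e]]].
  by exists (laplacian u); split=> //; exact: weak_neumann_laplacian.
have wl := weak_laplacian_classical Lw hn; split; last first.
  by apply: filterS2 wl e => x h1 h2 Ax; rewrite h2// h1.
apply/classical_neumannP => phi hphi; rewrite -(hn phi hphi) /weak_normal_derivative; congr (_ + _).
apply: (ae_eq_Rintegral mA).
- by apply: measurable_funM; [exact: Llap.1|exact: hphi.1.1].
- by apply: measurable_funM; [exact: Lw.1|exact: hphi.1.1].
- by apply: filterS wl => x h1 Ax; rewrite h1.
Qed.

End classical_neumann_condition.

(** * Assembly of the two assertions at each positive time *)

Lemma radial_even {R : realType} {N : nat} (K : 'rV[R]_N -> R) :
  (forall z z', enorm z = enorm z' -> K z = K z') -> forall z, K (- z) = K z.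
Proof. by move=> h z; apply: h; rewrite /enorm dotpNl dotpNr opprK. Qed.

Theorem lemma2p1 (R : realType) (N : nat) (hN : (0 < N)%N)
  (Omega A B : set 'rV[R]_N) (eta : 'rV[R]_N -> 'rV[R]_N)
  (J G : 'rV[R]_N -> R)
  (hOmega : smooth_domain Omega) (bOmega : bounded_set Omega)
  (hA : smooth_domain A) (hB : connected B)
  (hAB : Omega = A `|` B) (dAB : A `&` B = set0)
  (heta : forall x, boundary A x -> outward_normal A x (eta x))
  (hJ : coupling_kernel A B J) (hG : coupling_kernel A B G) :
  (forall (u v : R -> 'rV[R]_N -> R) (u0 : 'rV[R]_N -> R),
     L2 A u0 ->
     (forall t, 0 <= t -> L2 A (u t)) ->
     (forall t, 0 < t -> minimizer B (nonlocal_energy A B J G (u t)) (v t)) ->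
     (weak_solution A B J u v u0 <->
        gradient_flow A (fun t => energy A B J (v t)) u u0) /\
     ((forall t, 0 < t -> C2_closure A (u t)) ->
        (classical_solution A B J eta u v u0 <->
           gradient_flow A (fun t => energy A B J (v t)) u u0))) /\
  (forall (u v : R -> 'rV[R]_N -> R) (t : R), 0 < t ->
     L2 A (u t) -> L2 B (v t) ->
     (first_variation B (EFin \o nonlocal_energy A B J G (u t)) (v t) (cst 0)
        <-> nonlocal_equation A B J G (u t) (v t)) /\
     (minimizer B (nonlocal_energy A B J G (u t)) (v t)
        <-> nonlocal_equation A B J G (u t) (v t))).
Proof.
have [oA _ _ dA] := hA; have [oOmega _ _ _] := hOmega.
have [[cJ J0 rJ _ _] _] := hJ; have [[cG G0 rG _ _] _] := hG.
have eJ := radial_even rJ; have eG := radial_even rG.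
have bS S : S `<=` Omega -> bounded_set S.
  by move=> SO; have [M [rM hM]] := bOmega; exists M; split=> // c /hM h x /SO; exact: h.
have bA : bounded_set A by apply: bS; rewrite hAB; exact: subsetUl.
have bB : bounded_set B by apply: bS; rewrite hAB; exact: subsetUr.
have mA : measurable A by exact: open_measurable_rV.
(* No regularity of B is given; its measurability comes from that of the open sets Omega and A. *)
have BE : B = Omega `\` A.
  by rewrite hAB setDUl setDv set0U; apply/esym/setDidl; rewrite setIC.
have mB : measurable B by rewrite BE; apply: measurableD => //; exact: open_measurable_rV.
split=> [u v u0 Lu0 Lu mv|u v t t0 Lu Lv]; last first.
  split; first exact: first_variation_nonlocal.
  exact: minimizer_nonlocal.
have Lv t : 0 < t -> L2 B (v t) by move=> /mv[].
(* The initial condition and the time derivative in L^2 are common to all formulations, so what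
   remains is an equivalence at a fixed t > 0. *)
split=> [|cu]; split=> -[ic h]; split=> // t t0; have Lut := Lu t (ltW t0).
- have [ut [w [[Ld dut] hu hl hn e]]] := h t t0.
  have [|xi [fv e']] := (weak_solution_stepP oA bA mB bB cJ Lut (Lv t t0) Ld).1.
    by exists w.
  by exists ut, xi.
- have [ut [xi [[Ld dut] fv e]]] := h t t0.
  have [|w [hu hl hn e']] := (weak_solution_stepP oA bA mB bB cJ Lut (Lv t t0) Ld).2.
    by exists xi.
  by exists ut, w.
- have [ut [[Ld dut] hn e]] := h t t0.
  have [|xi [fv e']] := (classical_solution_stepP oA bA heta (cu t t0) Lut mB bB cJ (Lv t t0) Ld).1.
    by split.
  by exists ut, xi.
- have [ut [xi [[Ld dut] fv e]]] := h t t0.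
  have [|hn e'] := (classical_solution_stepP oA bA heta (cu t t0) Lut mB bB cJ (Lv t t0) Ld).2.
    by exists xi.
  by exists ut.
Qed.
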